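(* Let $\Omega\subset\mathbb{R}^2$ be a bounded domain with $\partial\Omega\in C^\infty$, and let $u=u(x,y,t)\in C^2(\overline\Omega\times\mathbb{R})$ satisfy the wave equation $\partial_t^2u-\Delta u=0$ in $\Omega\times\mathbb{R}$ (where $\Delta=\partial_x^2+\partial_y^2$) and the Dirichlet boundary condition $u|_{\partial\Omega\times\mathbb{R}}=0$. Then for every $(x^*,y^* )\in\Omega$ and every $t^*\in\mathbb{R}$, $$u(x^*,y^*,t^* )=\lim_{h\to0}\int_{\partial\Omega}d\sigma_{x,y}\int_{t^*-\tau(x,y)}^{t^*+\tau(x,y)}V_h^*(x,y,t)\,\partial_\nu u(x,y,t)\,dt,$$ where $h\to 0$ through positive values, $V_h^*(x,y,t)=V_h(x-x^*,y-y^*,t-t^* )$ with $V_h$ the explicit function defined in the context, and $\tau(x,y)=\sqrt{(x-x^* )^2+(y-y^* )^2}$.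
   Context: $\nu$ is the outward unit normal to $\partial\Omega$, $\partial_\nu u$ is the derivative of $u$ (in the space variables) along $\nu$, and $d\sigma$ is the arc length element on $\partial\Omega$. Definition of $V_h$. Let $h>0$. For real $x,y,t$ with $y\geqslant|t|$ put $$w_h(x,y,t)=\frac{1}{4\pi^{3/2}\sqrt h}\int_{-\pi}^{\pi}\exp\left(-\frac1h\left(x-i\sqrt{y^2-t^2}\,\sin s\right)^2\right)ds .$$ For $(x,y,t)\in\mathbb{R}^3$ put $$v_h(x,y,t)=-\theta(y-|t|)\,w_h(x,y,t),$$ where $\theta$ is the Heaviside function; thus $v_h=0$ if $y<|t|$ (the value chosen for $\theta(0)$ plays no role). For $\alpha\in[-\pi,\pi]$ put $$v_h^\alpha(x,y,t)=v_h(x\cos\alpha+y\sin\alpha,\,-x\sin\alpha+y\cos\alpha,\,t),$$ and define $$V_h(x,y,t)=\frac1{2\pi}\int_{-\pi}^{\pi}v_h^\alpha(x,y,t)\,d\alpha .$$ *)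

(* Defs.v *)
From HB Require Import structures.
From mathcomp Require Import all_boot all_order all_algebra complex.
From mathcomp Require Import ring.
From mathcomp Require Import all_classical all_reals all_analysis.

Set Implicit Arguments.
Unset Strict Implicit.
Unset Printing Implicit Defensive.

Import Order.TTheory GRing.Theory Num.Theory.
Import numFieldNormedType.Exports.

Local Open Scope complex_scope.
Local Open Scope classical_set_scope.
Local Open Scope ring_scope.

Section Geometry.
Context {R : realType}.
Implicit Types (p q n : R * R) (A Omega : set (R * R)).

Definition dot p q : R := p.1 * q.1 + p.2 * q.2.

(* The library norm on [R * R] is the sup norm. *)
Definition enorm p : R := Num.sqrt (p.1 ^+ 2 + p.2 ^+ 2).

(* Coordinates of [p] in the axes turned counterclockwise by [alpha]. *)
Definition rotate_axes (alpha : R) p : R * R :=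
  (p.1 * cos alpha + p.2 * sin alpha, - p.1 * sin alpha + p.2 * cos alpha).

Definition boundary A : set (R * R) := closure A `\` interior A.

Definition smooth (f : R -> R) : Prop := forall k x, derivable (derive1n k f) x 1.

Definition bounded_domain Omega : Prop :=
  [/\ open Omega, connected Omega, Omega !=set0 & bounded_set Omega].

(* Near each boundary point, in suitably rotated axes, [Omega] is exactly the
   set of points above the graph of a smooth function. *)
Definition smooth_boundary Omega : Prop :=
  forall p, boundary Omega p ->
    exists (alpha : R) (phi : R -> R), smooth phi /\
      \forall q \near p, Omega q <-> phi (rotate_axes alpha q).1 < (rotate_axes alpha q).2.

Definition smooth_curve (gamma : R -> R * R) : Prop :=
  smooth (fun s => (gamma s).1) /\ smooth (fun s => (gamma s).2).

Definition velocity (gamma : R -> R * R) (s : R) : R * R :=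
  (derive1 (fun r => (gamma r).1) s, derive1 (fun r => (gamma r).2) s).

Definition regular_arc A (gamma : R -> R * R) (a b : R) : Prop :=
  [/\ smooth_curve gamma,
      forall s r, a <= s <= b -> a <= r <= b -> gamma s = gamma r -> s = r &
      forall s, a <= s <= b -> A (gamma s) /\ velocity gamma s != 0].

Definition plane : measurableType _ :=
  (measurableTypeR R * measurableTypeR R)%type.

Definition is_arc_length A (sigma : {measure set plane -> \bar R}) : Prop :=
  sigma (~` A) = 0%E /\
  forall (gamma : R -> R * R) (a b : R), a <= b -> regular_arc A gamma a b ->
    sigma (gamma @` `[a, b]) =
      (\int[lebesgue_measure]_(s in `[a, b]) (enorm (velocity gamma s))%:E)%E.

(* When [A] is a smooth boundary, exactly one measure satisfies
   [is_arc_length A]. *)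
Definition arc_length A : {measure set plane -> \bar R} :=
  if pselect (exists sigma, is_arc_length A sigma) is left H
  then projT1 (cid H) else mzero.

Definition is_outward_normal Omega p n : Prop :=
  [/\ enorm n = 1,
      forall gamma : R -> R * R, smooth_curve gamma -> gamma 0 = p ->
        (\forall s \near (0 : R), boundary Omega (gamma s)) ->
        dot (velocity gamma 0) n = 0 &
      \forall e \near (0 : R)^'+,
        Omega (p - e *: n) /\ ~ closure Omega (p + e *: n)].

Definition outward_normal Omega p : R * R := xget 0 [set n | is_outward_normal Omega p n].

End Geometry.

Section SpaceTime.
Context {R : realType}.
Implicit Types (Omega : set (R * R)) (f u : R * R * R -> R).

(* A point of space-time is [((x, y), t)]. *)
Definition dir_x : R * R * R := (1, 0, 0).
Definition dir_y : R * R * R := (0, 1, 0).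
Definition dir_t : R * R * R := (0, 0, 1).

(* All partial derivatives of order at most [k] exist in the open set [D] and
   extend continuously to the closure of [D]. *)
Fixpoint Ck_closure (k : nat) (D : set (R * R * R)) f : Prop :=
  {within closure D, continuous f} /\
  if k is k'.+1 then
    forall e, e \in [:: dir_x; dir_y; dir_t] ->
      exists g, (forall z, D z -> is_derive z e f (g z)) /\ Ck_closure k' D g
  else True.

Definition wave_equation Omega u : Prop :=
  forall z, (Omega `*` setT) z ->
    'D_dir_t ('D_dir_t u) z - ('D_dir_x ('D_dir_x u) z + 'D_dir_y ('D_dir_y u) z) = 0.

Definition dirichlet Omega u : Prop :=
  forall p t, boundary Omega p -> u (p, t) = 0.

(* One-sided, since [u] is only meaningful on the closure of [Omega]. *)
Definition normal_derivative Omega u (p : R * R) (t : R) : R :=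
  lim ((e^-1 * (u (p, t) - u (p - e *: outward_normal Omega p, t))) @[e --> 0^'+]).

End SpaceTime.

Section Kernel.
Context {R : realType}.
Local Notation C := R[i].
Local Notation mu := (@lebesgue_measure R).

Definition cexp (z : C) : C :=
  (expR (complex.Re z) * cos (complex.Im z)) +i* (expR (complex.Re z) * sin (complex.Im z)).

Definition cintegral (a b : R) (f : R -> C) : C :=
  (\int[mu]_(s in `[a, b]) complex.Re (f s)) +i*
  (\int[mu]_(s in `[a, b]) complex.Im (f s)).

Definition w_h_complex (h x y t : R) : C :=
  ((4 * pi `^ (3 / 2) * Num.sqrt h)^-1)%:C *
  cintegral (- pi) pi (fun s =>
    cexp (- (h^-1)%:C *
      (x%:C - 'i%C * (Num.sqrt (y ^+ 2 - t ^+ 2) * sin s)%:C) ^+ 2)).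

(* The exponent separated into its real and imaginary parts. *)
Lemma w_h_exponentE (h x r s : R) :
  - (h^-1)%:C * (x%:C - 'i%C * (r * sin s)%:C) ^+ 2 =
  (- (h^-1 * (x ^+ 2 - (r * sin s) ^+ 2))) +i* (h^-1 * (2 * x * (r * sin s))).
Proof.
rewrite expr2; move: (h^-1) (r * sin s) => k q.
by simpc; congr (_ +i* _); ring.
Qed.

Lemma Im_w_h_complex (h x y t : R) :
  complex.Im (w_h_complex h x y t) = 0.
Proof.
rewrite /w_h_complex /cintegral; set K := _^-1.
set F := fun s : R => complex.Im _.
have FE : F = fun s => expR (- (h^-1 * (x ^+ 2 - (Num.sqrt (y ^+ 2 - t ^+ 2) * sin s) ^+ 2)))
    * sin (h^-1 * (2 * x * (Num.sqrt (y ^+ 2 - t ^+ 2) * sin s))).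
  by apply/funext => s; rewrite /F w_h_exponentE.
have oddF s : F (- s) = - F s.
  by rewrite FE sinN !mulrN sqrrN sinN mulrN.
have cF : continuous F.
  have c (k : R) : continuous (fun s : R => k * (Num.sqrt (y ^+ 2 - t ^+ 2) * sin s)).
    move=> s; apply: cvgM; first exact: cvg_cst.
    by apply: cvgM; [exact: cvg_cst|exact: continuous_sin].
  rewrite FE => s; apply: cvgM.
    apply: continuous_comp; last exact: continuous_expR.
    apply: cvgN; apply: cvgM; first exact: cvg_cst.
    apply: cvgB; first exact: cvg_cst.
    have cs : {for s, continuous (fun r : R => Num.sqrt (y ^+ 2 - t ^+ 2) * sin r)}.
      by apply: cvgM; [exact: cvg_cst|exact: continuous_sin].
    by under eq_fun do rewrite expr2; rewrite expr2; apply: cvgM; exact: cs.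
  apply: continuous_comp; last exact: continuous_sin.
  by apply: cvgM; [exact: cvg_cst|exact: c].
have I0 : \int[mu]_(s in `[- pi, pi]) F s = 0.
  have pi0 : (- pi : R) <= pi by rewrite (@le_trans _ _ 0)// ?oppr_le0 pi_ge0.
  have iF : mu.-integrable `[- pi, pi] (EFin \o F).
    by apply: continuous_compact_integrable;
      [exact: segment_compact|exact: continuous_subspaceT].
  have := @integration_by_substitution_oppr R F (- pi) pi pi0.
  rewrite opprK => /(_ (continuous_subspaceT cF)) /(congr1 fine).
  rewrite -/(Rintegral _ _ _) => e.
  have {}e : \int[mu]_(s in `[- pi, pi]) F s = (- 1) * \int[mu]_(s in `[- pi, pi]) F s.
    rewrite [LHS]e -RintegralZl//; apply: eq_Rintegral => s _ /=.
    by rewrite oddF mulN1r.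
  by apply/eqP; rewrite -[_ == 0](@mulrn_eq0 _ _ 2) mulr2n {1}e mulN1r addNr.
by rewrite /= I0 mul0r mulr0 addr0.
Qed.

Lemma w_h_complex_real (h x y t : R) :
  w_h_complex h x y t = (complex.Re (w_h_complex h x y t))%:C.
Proof.
by case: (w_h_complex h x y t) (Im_w_h_complex h x y t) => a b /= ->.
Qed.

(* [w_h_complex] is real-valued by [w_h_complex_real]. *)
Definition w_h (h x y t : R) : R := complex.Re (w_h_complex h x y t).

Definition heaviside (x : R) : R := if 0 <= x then 1 else 0.

Definition v_h (h x y t : R) : R := - heaviside (y - `|t|) * w_h h x y t.

Definition v_h_rot (alpha h x y t : R) : R :=
  v_h h (rotate_axes alpha (x, y)).1 (rotate_axes alpha (x, y)).2 t.

Definition V_h (h x y t : R) : R :=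
  (2 * pi)^-1 * \int[mu]_(alpha in `[- pi, pi]) v_h_rot alpha h x y t.

End Kernel.

(* Main.v *)
(** Fix an angle and use coordinates [(X, Y)] centred at [(x0, y0)] in the
    rotated axes, with [S = t - t0].  On [|S| <= Y] the kernel is, up to the
    scale [1 / (4 pi^(3/2) sqrt h)], a function [W (X, Y, S)] that solves the wave
    equation, depends on [(Y, S)] only through [Y^2 - S^2], and equals
    [2 pi exp (- X^2 / h)] on the cone [Y = |S|].  Integrate Green's vector field
    [W grad u - u grad W] over [|S| <= Y]: this gives a plane field whose
    divergence for [Y > 0] is the [Y]-derivative of the trace
    [2 pi exp (- X^2 / h) (u (X, Y, Y) + u (X, Y, - Y))].  Subtracting the trace
    from the second component leaves a divergence-free field.  Cut off to [Y > 0]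
    by a C^1 ramp whose width tends to 0; since [u = 0] on the boundary, the
    divergence theorem expresses the boundary integral of [W] times the normal
    derivative as [- 4 pi] times the integral of [exp (- X^2 / h) u] over the line
    [Y = 0], [S = 0].  Averaging over the angle turns these line integrals into
    Gaussian means of [u (., t0)] around [(x0, y0)], which converge to
    [u (x0, y0, t0)]. *)

Require Import Defs.
From HB Require Import structures.
From mathcomp Require Import all_boot all_order all_algebra complex.
From mathcomp Require Import ring lra.
From mathcomp Require Import all_classical all_reals all_analysis measurable_realfun.

Set Implicit Arguments.
Unset Strict Implicit.
Unset Printing Implicit Defensive.

Import Order.TTheory GRing.Theory Num.Theory.
Import numFieldNormedType.Exports.

Local Open Scope classical_set_scope.
Local Open Scope ring_scope.

(** * Continuity within a set *)

Section ContinuousWithin.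
Context {R : realType}.

(** Green's formula in space-time would leave terms on the cone, where the kernel jumps. There [kW]
    is constant along each generator, so its [Y]- and [S]-derivatives cancel and the remaining terms
    form a total [Y]-derivative; this is what allows the trace to be moved into the flux. At [Y = 0]
    the fibre [|S| <= Y] collapses: the integrated Green field is [O(Y)] there, and the derivative
    of the ramp, concentrating on the line, sees only the trace. The time window loses nothing,
    since [|S| <= Y] forces [|S|] to be at most the distance to the centre. The scale is fixed at
    the very end: the angular average contributes [1 / (2 pi)] and the identity for one angle
    [4 pi], so a Gaussian of mass [sqrt (pi h)], integrated over an angle range of length [2 pi],
    gets total weight 1. [arc_length] is specified only by its values on regular arcs; a measure
    with these values has to be built, and both it and the divergence theorem come from a finite
    atlas with a partition of unity. *)

Definition cwi {T U : topologicalType} (A : set T) (f : T -> U) :=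
  forall x, A x -> f y @[y --> within A (nbhs x)] --> f x.

Lemma cwiP {T U : topologicalType} (A : set T) (f : T -> U) :
  {within A, continuous f} <-> cwi A f.
Proof. exact: subspace_continuousP. Qed.

Lemma continuous_cwi {T U : topologicalType} (A : set T) (f : T -> U) :
  continuous f -> cwi A f.
Proof. by move=> cf x _; apply: cvg_within_filter; exact: cf. Qed.

Lemma cwi_setT {T U : topologicalType} (f : T -> U) :
  cwi setT f -> continuous f.
Proof.
move=> cf x P /(cf x I) H; have {}H : nbhs x (fun y => setT y -> P (f y)) := H.
by change (nbhs x (fun y => P (f y))); apply: filterS H => y /(_ I).
Qed.

Lemma cwi_sub {T U : topologicalType} (A B : set T) (f : T -> U) :
  B `<=` A -> cwi A f -> cwi B f.
Proof.
by move=> BA cf x /BA/cf; apply: cvg_trans; apply: cvg_app; exact: within_subset.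
Qed.

Lemma cwi_comp {S T U : topologicalType} (B : set S) (A : set T)
    (g : S -> T) (f : T -> U) :
  cwi A f -> cwi B g -> (forall x, B x -> A (g x)) -> cwi B (fun x => f (g x)).
Proof.
move=> cf cg BA x Bx.
apply: cvg_comp (cf _ (BA _ Bx)).
move=> P /= /(cg _ Bx) H.
have {}H : nbhs x (fun y => B y -> A (g y) -> P (g y)) := H.
change (nbhs x (fun y => B y -> P (g y))).
by apply: filterS H => y H By; apply: H => //; exact: BA.
Qed.

Lemma cwi_cst {T U : topologicalType} (A : set T) (c : U) : cwi A (fun _ => c).
Proof. by move=> x _; exact: cvg_cst. Qed.

Lemma cwi_id {T : topologicalType} (A : set T) : cwi A id.
Proof. by move=> x _; apply: cvg_within_filter; exact: cvg_id. Qed.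

Lemma cwi_fst {S T : topologicalType} (A : set (S * T)) : cwi A fst.
Proof. by move=> x _; apply: cvg_within_filter; exact: cvg_fst. Qed.

Lemma cwi_snd {S T : topologicalType} (A : set (S * T)) : cwi A snd.
Proof. by move=> x _; apply: cvg_within_filter; exact: cvg_snd. Qed.

Lemma cwi_pair {S T U : topologicalType} (A : set S) (f : S -> T) (g : S -> U) :
  cwi A f -> cwi A g -> cwi A (fun x => (f x, g x)).
Proof. by move=> cf cg x Ax; apply: cvg_pair; [exact: cf|exact: cg]. Qed.

Lemma cwi_eq {T U : topologicalType} (A : set T) (f g : T -> U) :
  (forall x, A x -> f x = g x) -> cwi A f -> cwi A g.
Proof.
move=> fg cf x Ax; rewrite -fg//; apply: cvg_trans (cf x Ax).
apply: near_eq_cvg; have := withinT A (nbhs_filter x).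
by apply: filterS => y Ay; rewrite fg.
Qed.

Section real.
Context {T : topologicalType}.
Implicit Types (A : set T) (f g : T -> R).

Lemma cwiD A f g : cwi A f -> cwi A g -> cwi A (fun x => f x + g x).
Proof. by move=> cf cg x Ax; apply: cvgD; [exact: cf|exact: cg]. Qed.

Lemma cwiN A f : cwi A f -> cwi A (fun x => - f x).
Proof. by move=> cf x Ax; apply: cvgN; exact: cf. Qed.

Lemma cwiB A f g : cwi A f -> cwi A g -> cwi A (fun x => f x - g x).
Proof. by move=> cf cg; apply: cwiD => //; exact: cwiN. Qed.

Lemma cwiM A f g : cwi A f -> cwi A g -> cwi A (fun x => f x * g x).
Proof. by move=> cf cg x Ax; apply: cvgM; [exact: cf|exact: cg]. Qed.

Lemma cwiV A f : (forall x, A x -> f x != 0) -> cwi A f -> cwi A (fun x => (f x)^-1).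
Proof. by move=> f0 cf x Ax; apply: cvgV; [exact: f0|exact: cf]. Qed.

Lemma cwi_sum (I : Type) (r : seq I) A (F : I -> T -> R) :
  (forall i, cwi A (F i)) -> cwi A (fun x => \sum_(i <- r) F i x).
Proof.
move=> cF; elim: r => [|i r IH].
  by under eq_fun do rewrite big_nil; exact: cwi_cst.
by under eq_fun do rewrite big_cons; exact: cwiD.
Qed.

End real.

Lemma cwi_bounded {T : topologicalType} (K : set T) (f : T -> R) :
  compact K -> cwi K f -> exists2 M, 0 <= M & forall x, K x -> `|f x| <= M.
Proof.
move=> cK /cwiP cf.
have /compact_bounded[M [_ HM]] := continuous_compact cf cK.
exists (`|M| + 1) => [|x Kx]; first by rewrite addr_ge0.
by apply: HM; [rewrite ltr_pwDr// ler_norm|exists x].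
Qed.

End ContinuousWithin.

(** * Measurability in the plane *)

Section PlaneMeasure.
Context {R : realType}.
Local Notation mu := (@lebesgue_measure R).
Local Notation plane := (@plane R).

(** The sigma-algebra on [plane] is the product one; an open set belongs to it because it is the
    union of the countably many rational boxes that it contains. *)
Lemma open_plane_measurable (A : set (R * R)) : open A -> measurable (A : set plane).
Proof.
move=> oA.
pose box (k : rat * rat * rat) : set (R * R) :=
  [set z | `|ratr k.1.1 - z.1| < ratr k.2 /\ `|ratr k.1.2 - z.2| < ratr k.2].
have mbox k : measurable (box k : set plane).
  have -> : box k = `](ratr k.1.1 - ratr k.2), (ratr k.1.1 + ratr k.2)[%classic `*`
                    `](ratr k.1.2 - ratr k.2), (ratr k.1.2 + ratr k.2)[%classic.
    by apply/seteqP; split => z /=; rewrite /box/= !in_itv/= -!ltr_distlC.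
  by apply: measurableX; exact: measurable_itv.
pose D : set (rat * rat * rat) := [set k | box k `<=` A].
have -> : A = \bigcup_(k in D) box k.
  apply/seteqP; split; last by move=> z [k Dk /Dk].
  move=> z Az; have /nbhs_ballP[e /= e0 zeA] : nbhs z A by exact: open_nbhs_nbhs.
  (* With a rational radius below [e / 2] and a rational centre closer to [z] than this radius, the
     box contains [z] and stays within [e] of it. *)
  have [r] := @rat_in_itvoo R 0 (e / 2) ltac:(by rewrite divr_gt0).
  rewrite in_itv/= => /andP[r0 re].
  have rat_near (a : R) : exists q : rat, `|ratr q - a| < ratr r.
    have [q] := @rat_in_itvoo R (a - ratr r) (a + ratr r) ltac:(by lra).
    by rewrite in_itv/= => qa; exists q; rewrite ltr_distl.
  have [q1 Hq1] := rat_near z.1; have [q2 Hq2] := rat_near z.2.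
  exists (q1, q2, r) => // w [/= w1 w2]; apply: zeA; split => /=; rewrite /ball/=.
    rewrite (_ : z.1 - w.1 = - (ratr q1 - z.1) + (ratr q1 - w.1)); last by ring.
    by rewrite (le_lt_trans (ler_normD _ _))// normrN; lra.
  rewrite (_ : z.2 - w.2 = - (ratr q2 - z.2) + (ratr q2 - w.2)); last by ring.
  by rewrite (le_lt_trans (ler_normD _ _))// normrN; lra.
rewrite bigcup_mkcond; apply: countable_bigcupT_measurable => [|k]; first exact: countableP.
by case: ifPn => _; [exact: mbox|exact: measurable0].
Qed.

Lemma closed_plane_measurable (A : set (R * R)) : closed A -> measurable (A : set plane).
Proof.
move=> cA; have /open_plane_measurable/measurableC : open (~` A) by exact: closed_openC.
by rewrite setCK.
Qed.

Lemma compact_plane_measurable (A : set (R * R)) : compact A -> measurable (A : set plane).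
Proof.
by move=> cA; apply: closed_plane_measurable; apply: compact_closed => //; exact: norm_hausdorff.
Qed.

Lemma cwi_measurable_plane (D : set (R * R)) (f : R * R -> R) :
  measurable (D : set plane) -> cwi D f -> measurable_fun (D : set plane) f.
Proof.
move=> mD /cwiP/continuousP cf; apply: (measurability _ (RGenOpens.measurableE R)).
move=> _ [_ [a [b ->] <-]].
have /cf/open_subspaceP [V oV VD] : open `]a, b[%classic by exact: interval_open.
by rewrite setIC -VD; apply: measurableI => //; exact: open_plane_measurable.
Qed.

Lemma cwi_integrable_plane (nu : {measure set plane -> \bar R}) (K : set (R * R))
    (f : R * R -> R) :
  compact K -> (nu K < +oo)%E -> cwi K f -> nu.-integrable K (EFin \o f).
Proof.
move=> cK nuK cf; have mK := compact_plane_measurable cK.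
apply: measurable_bounded_integrable => //; first exact: cwi_measurable_plane.
have [M M0 HM] := cwi_bounded cK cf.
by exists M; split; rewrite ?num_real// => x Mx y Ky /=; rewrite (le_trans (HM _ Ky))// ltW.
Qed.

End PlaneMeasure.

(** * Integration in the plane *)

Section PlaneIntegral.
Context {R : realType}.
Local Notation mu := (@lebesgue_measure R).
Local Notation plane := (@plane R).
Local Notation mu2 := (mu \x mu)%E.

Definition square (L : R) : set (R * R) := [set z | `|z.1| <= L /\ `|z.2| <= L].

(** What Fubini's theorem needs, in a form that a continuous function on a compact set acquires when
    it is extended by zero. *)
Definition bounded_support (L M : R) (F : R * R -> R) :=
  [/\ measurable_fun (setT : set plane) F, forall z, `|F z| <= M &
      forall z, ~ square L z -> F z = 0].

Lemma squareE L : square L = `[- L, L]%classic `*` `[- L, L]%classic.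
Proof.
by apply/seteqP; split => z; rewrite /square/= !in_itv/= -!ler_norml => -[].
Qed.

Lemma compact_square L : compact (square L).
Proof. by rewrite squareE; apply: compact_setX; exact: segment_compact. Qed.

Lemma compact_in_square (K : set (R * R)) : compact K -> exists2 L, 0 <= L & K `<=` square L.
Proof.
move=> cK; have [M1 M10 H1] := cwi_bounded cK (cwi_fst (A := K)).
have [M2 M20 H2] := cwi_bounded cK (cwi_snd (A := K)).
exists (M1 + M2); first by rewrite addr_ge0.
by move=> z Kz; split; [have := H1 z Kz|have := H2 z Kz]; lra.
Qed.

Lemma lebesgue_itv_lty (a b : R) : (mu `[a, b]%classic < +oo)%E.
Proof. by apply: compact_finite_measure; exact: segment_compact. Qed.

Lemma square_lty L : (mu2 (square L) < +oo)%E.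
Proof.
rewrite squareE product_measure1E//.
by apply: lte_mul_pinfty => //; rewrite ?ge0_fin_numE//; exact: lebesgue_itv_lty.
Qed.

Lemma bounded_support_integrable L M F : bounded_support L M F ->
  mu2.-integrable setT (EFin \o F).
Proof.
move=> [mF bF sF].
have mS : measurable (square L : set plane).
  by apply: compact_plane_measurable; exact: compact_square.
have -> : EFin \o F = (EFin \o F) \_ (square L).
  apply/funext => z; rewrite patchE; case: ifPn => // /negP zL /=.
  by rewrite sF// => Sz; apply: zL; rewrite inE.
apply/integrable_restrict => //; rewrite setTI; apply: measurable_bounded_integrable => //.
- exact: square_lty.
- exact: measurable_funTS.
- by exists M; split; rewrite ?num_real// => x Mx y _ /=; rewrite (le_trans (bF _))// ltW.
Qed.

Lemma bounded_support_section1 L M F x : bounded_support L M F ->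
  mu.-integrable setT (EFin \o (fun y => F (x, y))).
Proof.
move=> [mF bF sF].
have -> : EFin \o (fun y => F (x, y)) = (EFin \o (fun y => F (x, y))) \_ `[- L, L]%classic.
  apply/funext => y; rewrite patchE; case: ifPn => // /negP yL /=.
  by rewrite sF// => -[_ /= Sz]; apply: yL; rewrite inE/= in_itv/= -ler_norml.
apply/integrable_restrict => //=.
rewrite setTI; apply: measurable_bounded_integrable => //.
- exact: lebesgue_itv_lty.
- apply: measurable_funTS; exact: (@measurable_fun_pair2 _ _ _ (measurableTypeR R) (measurableTypeR R) (measurableTypeR R) F x mF).
- by exists M; split; rewrite ?num_real// => r Mr y _ /=; rewrite (le_trans (bF _))// ltW.
Qed.

Lemma bounded_support_swap L M F : bounded_support L M F ->
  bounded_support L M (fun z => F (z.2, z.1)).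
Proof.
move=> [mF bF sF]; split => //.
- have msw : measurable_fun (setT : set plane) (fun z : plane => (z.2, z.1) : plane).
    by apply: measurable_fun_pair; [exact: measurable_snd|exact: measurable_fst].
  exact: (measurableT_comp mF msw).
- by move=> z Sz; apply: sF => -[/= ? ?]; apply: Sz.
Qed.

Lemma bounded_support_iterated L M F : bounded_support L M F ->
  \int[mu2]_z F z = \int[mu]_x \int[mu]_y F (x, y).
Proof.
move=> bF; rewrite /Rintegral; congr fine.
rewrite -(integral12_prod_meas1 (bounded_support_integrable bF)).
apply: eq_integral => x _; rewrite fineK//.
exact: (integrable_fin_num _ (bounded_support_section1 x bF)).
Qed.

Lemma bounded_support_Fubini L M F : bounded_support L M F ->
  \int[mu]_x \int[mu]_y F (x, y) = \int[mu]_y \int[mu]_x F (x, y).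
Proof.
move=> bF; rewrite /Rintegral; congr fine.
transitivity (\int[mu]_x \int[mu]_y (F (x, y))%:E)%E.
  apply: eq_integral => x _; rewrite fineK//.
  exact: (integrable_fin_num _ (bounded_support_section1 x bF)).
rewrite (Fubini (bounded_support_integrable bF)).
apply: eq_integral => x _; rewrite fineK//.
have := bounded_support_section1 x (bounded_support_swap bF).
exact: integrable_fin_num.
Qed.

Lemma cwi_bounded_support (K : set (R * R)) f : compact K -> cwi K f ->
  exists L M, [/\ 0 <= L, 0 <= M & bounded_support L M (f \_ K)].
Proof.
move=> cK cf; have [M M0 HM] := cwi_bounded cK cf.
have [L L0 HL] := compact_in_square cK; exists L, M; split => //; split.
- apply/(measurable_restrictT _ _).1 => //; first exact: compact_plane_measurable.
  by apply: cwi_measurable_plane => //; exact: compact_plane_measurable.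
- by move=> z; rewrite patchE; case: ifPn => [/[!inE]/HM//|_]; rewrite normr0.
- move=> z Sz; rewrite patchE; case: ifPn => // /[!inE] /HL //.
Qed.

Lemma cwi_itv_integrable (a b : R) (f : R -> R) : cwi `[a, b]%classic f ->
  mu.-integrable `[a, b]%classic (EFin \o f).
Proof.
by move=> /cwiP cf; apply: continuous_compact_integrable => //; exact: segment_compact.
Qed.

Lemma rectangle_Fubini (a b c d : R) (f : R * R -> R) :
  cwi (`[a, b]%classic `*` `[c, d]%classic) f ->
  \int[mu]_(x in `[a, b]) \int[mu]_(y in `[c, d]) f (x, y) =
  \int[mu]_(y in `[c, d]) \int[mu]_(x in `[a, b]) f (x, y).
Proof.
move=> cf; have cK : compact (`[a, b]%classic `*` `[c, d]%classic : set (R * R)).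
  by apply: compact_setX; exact: segment_compact.
have [L [M [_ _ /bounded_support_Fubini]]] := cwi_bounded_support cK cf.
have mem2 x y : ((x, y) \in (`[a, b]%classic `*` `[c, d]%classic : set (R * R))) =
    ((x \in `[a, b]) && (y \in `[c, d])).
  by apply/idP/andP; rewrite inE => -[].
set F := f \_ _ => FF.
have E1 : \int[mu]_x \int[mu]_y F (x, y) =
    \int[mu]_(x in `[a, b]) \int[mu]_(y in `[c, d]) f (x, y).
  rewrite [RHS]Rintegral_mkcond; apply: eq_Rintegral => x _; rewrite patchE mem_setE.
  case: ifPn => xab.
    rewrite [RHS]Rintegral_mkcond; apply: eq_Rintegral => y _.
    by rewrite /F !patchE mem2 xab mem_setE.
  by rewrite (_ : (fun y => _) = cst 0) ?Rintegral_cst ?mul0r//; apply/funext => y;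
    rewrite /F patchE mem2 (negbTE xab).
have E2 : \int[mu]_y \int[mu]_x F (x, y) =
    \int[mu]_(y in `[c, d]) \int[mu]_(x in `[a, b]) f (x, y).
  rewrite [RHS]Rintegral_mkcond; apply: eq_Rintegral => y _; rewrite patchE mem_setE.
  case: ifPn => xab.
    rewrite [RHS]Rintegral_mkcond; apply: eq_Rintegral => x _.
    by rewrite /F !patchE mem2 xab mem_setE andbT.
  by rewrite (_ : (fun y => _) = cst 0) ?Rintegral_cst ?mul0r//; apply/funext => x;
    rewrite /F patchE mem2 (negbTE xab) andbF.
by rewrite -E1 FF E2.
Qed.

(** Uniqueness of Lebesgue measure: the image measure under the shift takes the same values on
    half-open intervals. *)
Lemma lebesgue_measure_shift (c : R) (A : set R) : measurable A ->
  mu [set x | A (x + c)] = mu A.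
Proof.
move=> mA.
pose phi : measurableTypeR R -> measurableTypeR R := fun x => x + c.
have mphi : measurable_fun setT phi.
  by apply: measurable_funD => //; exact: measurable_cst.
pose mphi_mixin := isMeasurableFun.Build _ _ _ _ phi mphi.
pose mphi_pack : {mfun _ >-> _} := HB.pack phi mphi_mixin.
rewrite [RHS](@lebesgue_measure_unique R (pushforward mu mphi_pack))// => _ [[a b]] _ <-.
transitivity (mu `]a - c, b - c]%classic); last first.
  by congr (mu _); apply/seteqP; split => x /=; rewrite !in_itv/= /phi ltrBlDr lerBrDr.
rewrite !lebesgue_measure_itv/= !lte_fin ltrD2r; case: ifP => // _.
by rewrite -!EFinB; congr EFin; ring.
Qed.

Lemma Rintegral_shift (c : R) (f : R -> R) : measurable_fun setT f ->
  mu.-integrable setT (EFin \o (fun x => f (x + c))) ->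
  \int[mu]_x f (x + c) = \int[mu]_x f x.
Proof.
move=> mf If; rewrite /Rintegral; congr fine.
pose phi : measurableTypeR R -> measurableTypeR R := fun x => x + c.
have mphi : measurable_fun setT phi.
  by apply: measurable_funD => //; exact: measurable_cst.
transitivity (\int[pushforward mu phi]_x (f x)%:E)%E; last first.
  by apply: eq_measure_integral => A mA _; exact: lebesgue_measure_shift.
by rewrite (integral_pushforward mphi) //; exact/measurable_EFinP.
Qed.

End PlaneIntegral.

(** * Rigid motions preserve plane measure *)

Section RigidMotion.
Context {R : realType}.
Local Notation mu := (@lebesgue_measure R).
Local Notation plane := (@plane R).
Local Notation mu2 := (mu \x mu)%E.

Definition measure_preserving (phi : R * R -> R * R) :=
  measurable_fun (setT : set plane) (phi : plane -> plane) /\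
  forall E : set plane, measurable E -> mu2 (phi @^-1` E) = mu2 E.

Lemma measure_preserving_comp phi psi : measure_preserving phi ->
  measure_preserving psi -> measure_preserving (fun z => phi (psi z)).
Proof.
move=> [mphi ephi] [mpsi epsi]; split; first exact: (measurableT_comp mphi mpsi).
move=> E mE; have mphiE : measurable (phi @^-1` E : set plane).
  by rewrite -[X in measurable X]setTI; exact: mphi.
by have := epsi _ mphiE; rewrite -(ephi _ mE).
Qed.

(** The image of [mu2] under [phi] is a measure that agrees with the product measure on rectangles,
    hence everywhere. *)
Lemma measure_preserving_rect phi :
  measurable_fun (setT : set plane) (phi : plane -> plane) ->
  (forall A B : set R, measurable A -> measurable B ->
     mu2 (phi @^-1` (A `*` B)) = (mu A * mu B)%E) ->
  measure_preserving phi.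
Proof.
move=> mphi H; split=> // E mE.
pose mphi_mixin := isMeasurableFun.Build _ _ plane plane phi mphi.
pose mphi_pack : {mfun plane >-> plane} := HB.pack phi mphi_mixin.
rewrite [RHS](@product_measure_unique _ _ _ _ _ mu mu (pushforward mu2 mphi_pack)) => //.
Qed.

Lemma measurable_plane_affine (a b c : R) :
  measurable_fun (setT : set plane) (fun z : plane => a * z.1 + b * z.2 + c).
Proof.
apply: cwi_measurable_plane => //; apply: cwiD; last exact: cwi_cst.
by apply: cwiD; apply: cwiM; [exact: cwi_cst|exact: cwi_fst|exact: cwi_cst|exact: cwi_snd].
Qed.

(** Each vertical section of the preimage of [A * B] is either empty or a translate of [B]. *)
Lemma measure_preserving_shear2 (k c : R) :
  measure_preserving (fun z => (z.1, z.2 + k * z.1 + c)).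
Proof.
apply: measure_preserving_rect.
  apply: measurable_fun_pair; first exact: measurable_fst.
  have := measurable_plane_affine k 1 c; congr measurable_fun.
  by apply/funext => z /=; ring.
move=> A B mA mB; rewrite /product_measure1.
rewrite (_ : (fun x => _) = fun x => (mu B * (\1_A x)%:E)%E); last first.
  apply/funext => x /=; rewrite indicE.
  have [xA|xA] := boolP (x \in A); last first.
    rewrite mule0 (_ : xsection _ _ = set0) ?measure0//.
    apply/seteqP; split => // y; rewrite /xsection/= inE/= => -[/mem_set].
    by rewrite (negbTE xA).
  rewrite mule1 -(lebesgue_measure_shift (k * x + c) mB); congr (mu _).
  apply/seteqP; split => y; rewrite /xsection/= inE/= addrA; first by case.
  by move=> yB; split => //; exact/set_mem.
rewrite ge0_integralZl ?integral_indic ?setIT//; last exact: measurableT_comp.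
by rewrite muleC.
Qed.

Lemma measure_preserving_swap : measure_preserving (fun z => (z.2, z.1)).
Proof.
apply: measure_preserving_rect.
  by apply: measurable_fun_pair; [exact: measurable_snd|exact: measurable_fst].
move=> A B mA mB; rewrite (_ : _ @^-1` _ = B `*` A); last first.
  by apply/seteqP; split => z [].
by rewrite product_measure1E// muleC.
Qed.

Lemma measure_preserving_shear1 (k c : R) :
  measure_preserving (fun z => (z.1 + k * z.2 + c, z.2)).
Proof.
apply: (measure_preserving_comp measure_preserving_swap
  (measure_preserving_comp (measure_preserving_shear2 k c) measure_preserving_swap)).
Qed.

(** For [s != 0] a rotation is a product of three shears, of slopes [a], [s], [a] with
    [a = (c - 1) / s]. The identity is a shear of slope 0, and the half turn is the square of a
    quarter turn. *)
Lemma measure_preserving_turn (c s : R) : c ^+ 2 + s ^+ 2 = 1 ->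
  measure_preserving (fun z => (c * z.1 - s * z.2, s * z.1 + c * z.2)).
Proof.
have turn_shear (c0 s0 : R) : s0 != 0 -> c0 ^+ 2 + s0 ^+ 2 = 1 ->
    measure_preserving (fun z => (c0 * z.1 - s0 * z.2, s0 * z.1 + c0 * z.2)).
  move=> s00 cs1; pose a := (c0 - 1) / s0.
  have as1 : a * s0 = c0 - 1 by rewrite /a divfK.
  have ac1 : a * (1 + c0) = - s0.
    have s2 : s0 ^+ 2 = 1 - c0 ^+ 2 by rewrite -cs1; ring.
    apply: (mulfI s00); transitivity (a * s0 * (1 + c0)); first by ring.
    by rewrite as1 mulrN -expr2 s2; ring.
  have := measure_preserving_comp (measure_preserving_shear1 a 0)
    (measure_preserving_comp (measure_preserving_shear2 s0 0) (measure_preserving_shear1 a 0)).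
  congr measure_preserving; apply/funext => z /=; rewrite !addr0; congr pair.
    transitivity ((1 + a * s0) * z.1 + (a + a * (1 + a * s0)) * z.2); first by ring.
    rewrite as1 (_ : a + a * (1 + (c0 - 1)) = a * (1 + c0)); last by ring.
    by rewrite ac1; ring.
  transitivity (s0 * z.1 + (1 + a * s0) * z.2); first by ring.
  by rewrite as1; ring.
have [s0|s0 cs1] := eqVneq s 0; last exact: turn_shear.
rewrite s0 expr0n addr0 => /eqP; rewrite sqrf_eq1 => /orP[] /eqP ->.
  have := measure_preserving_shear1 0 0; congr measure_preserving.
  by apply/funext => z; congr pair => /=; ring.
have J := @turn_shear 0 1 (oner_neq0 _) ltac:(by ring).
have := measure_preserving_comp J J; congr measure_preserving.
by apply/funext => z /=; congr pair; ring.
Qed.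

(** Takes coordinates in turned axes centred at [p] back to the plane, hence the sign of the angle;
    [frame] below is the inverse. *)
Definition rigid_motion (p : R * R) (al : R) (z : R * R) := p + rotate_axes (- al) z.

Lemma rotate_axesNE al (z : R * R) : rotate_axes (- al) z =
  (cos al * z.1 - sin al * z.2, sin al * z.1 + cos al * z.2).
Proof. by rewrite /rotate_axes cosN sinN; congr pair; ring. Qed.

Lemma rotate_axesK al : cancel (@rotate_axes R al) (rotate_axes (- al)).
Proof.
move=> [x y]; rewrite rotate_axesNE /rotate_axes/=; have := cos2Dsin2 al.
by move=> cs1; congr pair; [rewrite -[RHS]mul1r -[in RHS]cs1|rewrite -[RHS]mul1r -[in RHS]cs1]; ring.
Qed.

Lemma rotate_axesNK al : cancel (@rotate_axes R (- al)) (rotate_axes al).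
Proof. by move=> z; have := rotate_axesK (- al) z; rewrite opprK. Qed.

Lemma measure_preserving_rigid p al : measure_preserving (rigid_motion p al).
Proof.
have := measure_preserving_comp (measure_preserving_comp
  (measure_preserving_shear1 0 p.1) (measure_preserving_shear2 0 p.2))
  (measure_preserving_turn (cos2Dsin2 al)).
congr measure_preserving; apply/funext => z /=.
by rewrite /rigid_motion rotate_axesNE; congr pair => /=; ring.
Qed.

Lemma Rintegral_measure_preserving phi (F : R * R -> R) : measure_preserving phi ->
  measurable_fun (setT : set plane) F -> mu2.-integrable setT (EFin \o F) ->
  \int[mu2]_z F (phi z) = \int[mu2]_z F z.
Proof.
move=> [mphi ephi] mF iF; rewrite /Rintegral; congr fine.
have mF' : measurable_fun (setT : set plane) (EFin \o F) by exact/measurable_EFinP.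
pose mphi_mixin := isMeasurableFun.Build _ _ plane plane phi mphi.
pose mphi_pack : {mfun plane >-> plane} := HB.pack phi mphi_mixin.
transitivity (\int[pushforward mu2 mphi_pack]_z (F z)%:E)%E; last first.
  by apply: eq_measure_integral => A mA _; exact: ephi.
rewrite (integral_pushforward mphi mF')//.
apply/integrableP; split; first exact: (measurableT_comp mF' mphi).
have /integrableP[_] := iF; congr (_ < _)%E.
transitivity (\int[pushforward mu2 mphi_pack]_z `|(F z)%:E|)%E.
  by apply: eq_measure_integral => A mA _; exact/esym/ephi.
rewrite (ge0_integral_pushforward mphi)//.
by apply: measurableT_comp => //.
Qed.

End RigidMotion.

(** * Integrals over intervals *)

Section OneVariable.
Context {R : realType}.
Local Notation mu := (@lebesgue_measure R).

Lemma Rintegral_bound d (T : measurableType d) (nu : {measure set T -> \bar R})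
    (D : set T) (f : T -> R) (M : R) :
  measurable D -> (nu D < +oo)%E -> nu.-integrable D (EFin \o f) ->
  (forall x, D x -> `|f x| <= M) -> `|\int[nu]_(x in D) f x| <= M * fine (nu D).
Proof.
move=> mD nD iF fM; apply: (le_trans (le_normr_Rintegral mD iF)).
rewrite -(Rintegral_cst nu mD); apply: le_Rintegral => //; first exact: integrable_norm.
apply: measurable_bounded_integrable => //.
by exists `|M|; split; rewrite ?num_real// => x Mx y _ /=; exact: ltW.
Qed.

Lemma fine_lebesgue_itv (a b : R) : a <= b -> fine (mu `[a, b]%classic) = b - a.
Proof.
rewrite lebesgue_measure_itv/= lte_fin le_eqVlt => /predU1P[->|->//].
by rewrite ltxx subrr.
Qed.

Lemma Rintegral_itv_bound (a b M : R) (f : R -> R) : a <= b -> cwi `[a, b]%classic f ->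
  (forall x, a <= x <= b -> `|f x| <= M) -> `|\int[mu]_(x in `[a, b]) f x| <= M * (b - a).
Proof.
move=> ab cf fM; rewrite -(fine_lebesgue_itv ab); apply: Rintegral_bound => //.
- exact: lebesgue_itv_lty.
- exact: cwi_itv_integrable.
Qed.

Lemma Rintegral_itv_cat (a b c : R) (f : R -> R) : a <= b -> b <= c ->
  cwi `[a, c]%classic f ->
  \int[mu]_(x in `[a, c]) f x = \int[mu]_(x in `[a, b]) f x + \int[mu]_(x in `[b, c]) f x.
Proof.
move=> ab bc cf; have i := cwi_itv_integrable cf.
have := @Rintegral_itvB R f (BLeft a) (BRight c) b i.
rewrite !bnd_simp => /(_ ab bc) /eqP; rewrite subr_eq addrC => /eqP ->.
rewrite Rintegral_itv_obnd_cbnd//; apply: integrableS i => //.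
by apply: subset_itv; rewrite bnd_simp.
Qed.

Lemma Rintegral_FTC (f F : R -> R) (a b : R) : a <= b ->
  cwi `[a, b]%classic f -> cwi `[a, b]%classic F ->
  (forall x, a < x < b -> is_derive x 1 F (f x)) ->
  \int[mu]_(x in `[a, b]) f x = F b - F a.
Proof.
rewrite le_eqVlt => /predU1P[<- _ _ _|ab cf cF dF].
  by rewrite set_itv1 Rintegral_set1 subrr.
have /cwiP/(continuous_within_itvP _ ab)[_ Fa Fb] := cF.
rewrite /Rintegral (@continuous_FTC2 _ f F)//; first exact/cwiP.
- by split => // x; rewrite in_itv/= => /dF H; exact: ex_derive.
- by move=> x; rewrite in_itv/= => /dF H; rewrite derive1E derive_val.
Qed.

(** A tube argument: [[a, b]] is compact, so for [x'] in [A] close to [x] the values [f (x', y)] are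
    close to [f (x, y)] uniformly in [y]. For [b < a] the interval is empty and the integral is
    0. *)
Lemma cwi_param (T : topologicalType) (A : set T) (a b : R) (f : T * R -> R) :
  cwi (A `*` `[a, b]%classic) f -> cwi A (fun x => \int[mu]_(y in `[a, b]) f (x, y)).
Proof.
have [ba _|ab cf] := ltP b a.
  rewrite (_ : (fun x => _) = fun=> 0); first exact: cwi_cst.
  by apply/funext => x; rewrite set_itv_ge -?ltNge// Rintegral_set0.
have cfx x : A x -> cwi `[a, b]%classic (fun y => f (x, y)).
  move=> Ax; apply: (cwi_comp cf); last by move=> y yab; split.
  by apply: cwi_pair; [exact: cwi_cst|exact: cwi_id].
move=> x Ax; apply/cvgrPdist_le => e e0.
(* The summand 1 keeps the denominator positive when [a = b]. *)
pose d := e / (b - a + 1).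
have ba0 : 0 < b - a + 1 by rewrite ltr_pwDr// subr_ge0.
have d0 : 0 < d by rewrite divr_gt0.
have : \forall x' \near within A (nbhs x), `[a, b]%classic `<=` (fun y => `|f (x, y) - f (x', y)| <= d).
  have /compact_near_coveringP/near_covering_withinP := @segment_compact _ a b.
  apply => y yab.
  have /cvgrPdist_lt/(_ (d / 2)) : f z @[z --> within (A `*` `[a, b]%classic) (nbhs (x, y))] --> f (x, y).
    exact: cf.
  rewrite divr_gt0// => /(_ isT) [[P Q]/= [Px Qy] PQ].
  exists (Q, fun x' => P x' /\ A x') => /=.
    by split => //; move: Px; apply: filterS => x' Px' Ax'.
  move=> [y' x'] /= [Qy' [Px' Ax']] y'ab.
  have h1 := PQ (x', y') (conj Px' Qy') (conj Ax' y'ab).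
  have h2 := PQ (x, y') (conj (nbhs_singleton Px) Qy') (conj Ax y'ab).
  rewrite (_ : _ - _ = (f (x, y) - f (x', y')) - (f (x, y) - f (x, y'))); last by ring.
  rewrite (le_trans (ler_normB _ _))// ltW//.
  by rewrite /= in h1 h2; lra.
move=> H; near=> x'.
have Ax' : A x' by near: x'; exact: withinT.
have Hx' : `[a, b]%classic `<=` (fun y => `|f (x, y) - f (x', y)| <= d) by near: x'.
rewrite -RintegralB//; last 2 first.
- by apply: cwi_itv_integrable; exact: cfx.
- by apply: cwi_itv_integrable; exact: cfx.
apply: (@le_trans _ _ (d * (b - a))).
  apply: Rintegral_itv_bound => //; first by apply: cwiB; exact: cfx.
rewrite (_ : d * (b - a) = e * (b - a) / (b - a + 1)); last by rewrite /d mulrAC.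
by rewrite ler_pdivrMr// ler_pM2l// lerDl.
Unshelve. all: by end_near.
Qed.

(** Real induction: the supremum of the points that [P] reaches from [a] is reached itself, and
    local validity leads beyond it unless it is [b]. It extends to a whole arc a statement that is
    known on short arcs and survives concatenation. *)
Lemma interval_chain (P : R -> R -> Prop) (a b : R) : a <= b ->
  (forall x y z, a <= x -> x <= y -> y <= z -> z <= b -> P x y -> P y z -> P x z) ->
  (forall x, a <= x <= b -> exists2 d, 0 < d & forall c e, a <= c -> c <= x -> x <= e ->
     e <= b -> x - d < c -> e < x + d -> P c e) ->
  P a b.
Proof.
move=> ab Ptrans Ploc.
pose S := [set x | a <= x <= b /\ P a x].
have Sa : S a.
  have [|d d0 H] := Ploc a; first by rewrite lexx.
  by split; [rewrite lexx|apply: H => //; lra].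
have bS : ubound S b by move=> x [/andP[]].
have hS : has_sup S by split; [exists a|exists b].
have sab : a <= sup S <= b by rewrite ge_sup ?sup_ubound//; [case: hS|exists a].
have [d d0 H] := Ploc _ sab.
have [x Sx xs] := sup_adherent d0 hS.
have xs' : x <= sup S by apply: sup_ubound => //; case: hS.
have Pas : P a (sup S).
  case: (Sx) => /andP[ax xb] Pax; case/andP: sab => as1 sb.
  apply: (Ptrans _ x) => //; apply: H => //; lra.
have [sb|bs] := ltP (sup S) b; last first.
  by rewrite (_ : b = sup S)//; apply/eqP; rewrite eq_le bs; case/andP: sab.
case/andP: sab => as1 _.
pose y := Num.min b (sup S + d / 2).
have sy : sup S < y by rewrite lt_min sb ltrDl divr_gt0.
have yb : y <= b by rewrite ge_min lexx.
suff Sy : S y by have := sup_ubound hS.2 Sy; rewrite leNgt sy.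
split; first by rewrite yb andbT; lra.
apply: (Ptrans _ (sup S)) => //; first exact: ltW.
apply: H => //; [exact: ltW|lra|].
by rewrite gt_min; apply/orP; right; lra.
Qed.

End OneVariable.

(** * Differentiation along lines and under the integral *)

Section Partials.
Context {R : realType}.
Local Notation mu := (@lebesgue_measure R).

(** A directional derivative depends only on the increments along its direction; this moves
    derivatives between functions on different spaces. *)
Lemma is_derive_quotient {V W : normedModType R} (f : V -> R) (g : W -> R) a v b w d :
  (forall h : R, f (h *: v + a) - f a = g (h *: w + b) - g b) ->
  is_derive a v f d -> is_derive b w g d.
Proof.
move=> fg [df <-].
have e : (fun h : R => h^-1 *: (g (h *: w + b) - g b)) = (fun h => h^-1 *: (f (h *: v + a) - f a)).
  by apply/funext => h; rewrite fg.
split; first by rewrite /derivable e; exact: df.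
by rewrite /derive e.
Qed.

Lemma is_derive_line {V : normedModType R} (f : V -> R) z e (h df : R) :
  is_derive (z + h *: e) e f df -> is_derive h 1 (fun s : R => f (z + s *: e)) df.
Proof.
apply: is_derive_quotient => k.
by rewrite [k *: 1]mulr1 scalerDl addrCA.
Qed.

Lemma is_derive_cvg (f : R -> R) (x d : R) : is_derive x 1 f d ->
  (h^-1 * (f (x + h) - f x)) @[h --> 0^'] --> d.
Proof.
move=> [df <-]; have := df; rewrite /derivable => /cvg_ex[l Hl].
rewrite /derive (cvg_lim _ Hl)//; move: Hl; apply: cvg_trans; apply: near_eq_cvg.
by apply: nearW => h /=; rewrite [h *: 1]mulr1 [h + x]addrC.
Qed.

Lemma cvg_is_derive (f : R -> R) (x d : R) :
  (h^-1 * (f (x + h) - f x)) @[h --> 0^'] --> d -> is_derive x 1 f d.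
Proof.
move=> Hd.
have Hl : (h^-1 *: (f (h *: 1 + x) - f x)) @[h --> 0^'] --> d.
  move: Hd; apply: cvg_trans; apply: near_eq_cvg.
  by apply: nearW => h /=; rewrite [h *: 1]mulr1 [h + x]addrC.
split; first by apply/cvg_ex; exists d.
by rewrite /derive (cvg_lim _ Hl).
Qed.

Lemma is_derive_continuous (f : R -> R) (x d : R) : is_derive x 1 f d ->
  {for x, continuous f}.
Proof. by move=> [df _]; apply: differentiable_continuous; exact/derivable1_diffP. Qed.

Lemma is_derive_near (f g : R -> R) (x d : R) : (\forall y \near x, f y = g y) ->
  is_derive x 1 f d -> is_derive x 1 g d.
Proof.
move=> fg /is_derive_cvg Hf; apply: cvg_is_derive; move: Hf; apply: cvg_trans.
apply: near_eq_cvg.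
have fgx : f x = g x by exact: nbhs_singleton fg.
have H : nbhs (0 : R) (fun h => f (x + h) = g (x + h)).
  have : x + h @[h --> (0 : R)] --> x + 0 by apply: cvgD; [exact: cvg_cst|exact: cvg_id].
  by rewrite addr0 => /(_ _ fg).
near=> h => /=; suff -> : f (x + h) = g (x + h) by rewrite fgx.
by near: h; apply: cvg_within; exact: H.
Unshelve. all: by end_near.
Qed.

(** The absolute values let one statement cover both signs of [h]. *)
Lemma mvt_direction {V : normedModType R} (f df : V -> R) z e (h : R) :
  (forall s : R, `|s| <= `|h| -> is_derive (z + s *: e) e f (df (z + s *: e))) ->
  exists2 s : R, `|s| <= `|h| & f (z + h *: e) - f z = h * df (z + s *: e).
Proof.
move=> H; pose g (s : R) := f (z + s *: e).
have dg (s : R) : `|s| <= `|h| -> is_derive s 1 g (df (z + s *: e)).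
  by move=> /H; exact: is_derive_line.
have g0 : g 0 = f z by rewrite /g scale0r addr0.
have cg (A : set R) : (forall s : R, A s -> `|s| <= `|h|) -> {within A, continuous g}.
  move=> Ah; apply/cwiP => s As; apply: cvg_within_filter.
  by apply: is_derive_continuous; apply: dg; exact: Ah.
have [h0|h0] := leP 0 h.
  have le (s : R) : s \in `[0, h] -> `|s| <= `|h|.
    by rewrite in_itv/= => /andP[s0 sh]; rewrite !ger0_norm.
  have [|s s0 E] := @MVT_segment R g (fun s => df (z + s *: e)) 0 h h0 _ (cg _ le).
    by move=> s sh; apply: dg; apply: le; exact: subset_itv_oo_cc.
  by exists s; [exact: le|rewrite -g0 -/(g h) E subr0 mulrC].
have le (s : R) : s \in `[h, 0] -> `|s| <= `|h|.
  by rewrite in_itv/= => /andP[s0 sh]; rewrite (ltr0_norm h0) ler0_norm// lerN2.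
have [|s s0 E] := @MVT_segment R g (fun s => df (z + s *: e)) h 0 (ltW h0) _ (cg _ le).
  by move=> s sh; apply: dg; apply: le; exact: subset_itv_oo_cc.
exists s; first exact: le.
by rewrite -g0 -/(g h) -opprB E; ring.
Qed.

Lemma cvg2 {T : Type} {U V : topologicalType} (F : set_system T) {FF : Filter F}
    (f : T -> U) (g : T -> V) (a : U) (b : V) :
  f x @[x --> F] --> a -> g x @[x --> F] --> b -> (f x, g x) @[x --> F] --> (a, b).
Proof. by move=> fa gb; apply: cvg_pair. Qed.

Definition has_partials (D : set (R * R * R)) (f f1 f2 f3 : R * R * R -> R) :=
  forall z, D z -> [/\ is_derive z dir_x f (f1 z), is_derive z dir_y f (f2 z) &
                       is_derive z dir_t f (f3 z)].

(** The argument is moved one coordinate at a time and the mean value theorem is applied to each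
    move; continuity of the partial derivatives then plays the part of total differentiability. *)
Lemma chain_rule3 (D : set (R * R * R)) f f1 f2 f3 (c1 c2 c3 : R -> R) (r d1 d2 d3 : R) :
  open D -> has_partials D f f1 f2 f3 -> cwi D f1 -> cwi D f2 -> cwi D f3 ->
  D (c1 r, c2 r, c3 r) ->
  is_derive r 1 c1 d1 -> is_derive r 1 c2 d2 -> is_derive r 1 c3 d3 ->
  is_derive r 1 (fun s => f (c1 s, c2 s, c3 s))
    (f1 (c1 r, c2 r, c3 r) * d1 + f2 (c1 r, c2 r, c3 r) * d2 + f3 (c1 r, c2 r, c3 r) * d3).
Proof.
move=> oD pf cf1 cf2 cf3 Dz h1 h2 h3.
set z := (c1 r, c2 r, c3 r) in Dz *.
have [e /= e0 De] : exists2 e, 0 < e & forall w : R * R * R,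
    `|w.1.1 - z.1.1| < e -> `|w.1.2 - z.1.2| < e -> `|w.2 - z.2| < e -> D w.
  have /nbhs_ballP[e /= e0 zD] : nbhs z D by exact: open_nbhs_nbhs.
  exists e => // w w1 w2 w3; apply: zD; split; last by rewrite /ball/= distrC.
  by split; rewrite /ball/= distrC.
pose near_z (h : R) := [/\ `|c1 (r + h) - c1 r| < e, `|c2 (r + h) - c2 r| < e & `|c3 (r + h) - c3 r| < e].
have dist0 (k : R) : `|k - k| < e by rewrite subrr normr0.
(* The equation is guarded by [near_z h], and other [h] get the witness 0, so that the intermediate
   points form a total function of [h]. *)
have step (h : R) : exists s : R * R * R,
    [/\ `|s.1.1| <= `|c1 (r + h) - c1 r|, `|s.1.2| <= `|c2 (r + h) - c2 r|,
        `|s.2| <= `|c3 (r + h) - c3 r| & near_z h ->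
        f (c1 (r + h), c2 (r + h), c3 (r + h)) - f z =
        (c1 (r + h) - c1 r) * f1 (c1 r + s.1.1, c2 (r + h), c3 (r + h)) +
        (c2 (r + h) - c2 r) * f2 (c1 r, c2 r + s.1.2, c3 (r + h)) +
        (c3 (r + h) - c3 r) * f3 (c1 r, c2 r, c3 r + s.2)].
  have [n|nn] := pselect (near_z h); last first.
    by exists (0, 0, 0); split => //=; rewrite normr0.
  case: (n) => n1 n2 n3.
  set k1 := c1 (r + h) - c1 r in n1 *; set k2 := c2 (r + h) - c2 r in n2 *.
  set k3 := c3 (r + h) - c3 r in n3 *.
  have add0 (x y : R) : x + y * 0 = x by rewrite mulr0 addr0.
  have add1 (x y : R) : x + y * 1 = x + y by rewrite mulr1.
  have E1 (s : R) : (c1 r, c2 (r + h), c3 (r + h)) + s *: dir_x = (c1 r + s, c2 (r + h), c3 (r + h)).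
    by congr (_, _, _); rewrite /= ?add0 ?add1.
  have E2 (s : R) : (c1 r, c2 r, c3 (r + h)) + s *: dir_y = (c1 r, c2 r + s, c3 (r + h)).
    by congr (_, _, _); rewrite /= ?add0 ?add1.
  have E3 (s : R) : (c1 r, c2 r, c3 r) + s *: dir_t = (c1 r, c2 r, c3 r + s).
    by congr (_, _, _); rewrite /= ?add0 ?add1.
  have addK (x y : R) : x + y - x = y by rewrite addrAC subrr add0r.
  have [|s1 s1k e1] := @mvt_direction _ f f1 (c1 r, c2 (r + h), c3 (r + h)) dir_x k1.
    move=> s sk; rewrite E1; have [] // := pf (c1 r + s, c2 (r + h), c3 (r + h)).
    by apply: De => //=; rewrite addK (le_lt_trans sk).
  have [|s2 s2k e2] := @mvt_direction _ f f2 (c1 r, c2 r, c3 (r + h)) dir_y k2.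
    move=> s sk; rewrite E2; have [] // := pf (c1 r, c2 r + s, c3 (r + h)).
    by apply: De => //=; rewrite addK (le_lt_trans sk).
  have [|s3 s3k e3] := @mvt_direction _ f f3 (c1 r, c2 r, c3 r) dir_t k3.
    move=> s sk; rewrite E3; have [] // := pf (c1 r, c2 r, c3 r + s).
    by apply: De => //=; rewrite addK (le_lt_trans sk).
  exists (s1, s2, s3); split => //= _.
  move: e1 e2 e3; rewrite !E1 !E2 !E3 => <- <- <-.
  rewrite (_ : c1 r + k1 = c1 (r + h)); last by rewrite /k1; ring.
  rewrite (_ : c2 r + k2 = c2 (r + h)); last by rewrite /k2; ring.
  rewrite (_ : c3 r + k3 = c3 (r + h)); last by rewrite /k3; ring.
  by rewrite /z; ring.
have /choice [s Hs] := step.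
have cvgc (c : R -> R) d : is_derive r 1 c d -> c (r + h) @[h --> 0^'] --> c r.
  move=> /is_derive_continuous cc.
  have -> : c r = c (r + 0) by rewrite addr0.
  apply: cvg_within_filter; apply: continuous_comp; last by rewrite addr0.
  by apply: cvgD; [exact: cvg_cst|exact: cvg_id].
have cc1 := cvgc _ _ h1; have cc2 := cvgc _ _ h2; have cc3 := cvgc _ _ h3.
have cvgs (c : R -> R) (si : R -> R) : c (r + h) @[h --> 0^'] --> c r ->
    (forall h, `|si h| <= `|c (r + h) - c r|) -> c r + si h @[h --> 0^'] --> c r.
  move=> cc le; rewrite -[X in _ --> X]addr0; apply: cvgD; first exact: cvg_cst.
  apply: norm_cvg0; apply: (@squeeze_cvgr _ _ _ _ (fun=> 0) (fun h => `|c (r + h) - c r|)).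
  - by apply: nearW => h; rewrite normr_ge0 le.
  - exact: cvg_cst.
  - rewrite -[X in _ --> X](@normr0 _ R); apply: cvg_norm.
    rewrite -[X in _ --> X](subrr (c r)); apply: cvgB; first exact: cc.
    exact: cvg_cst.
have cs1 : c1 r + (s h).1.1 @[h --> 0^'] --> c1 r by apply: cvgs => // h; case: (Hs h).
have cs2 : c2 r + (s h).1.2 @[h --> 0^'] --> c2 r by apply: cvgs => // h; case: (Hs h).
have cs3 : c3 r + (s h).2 @[h --> 0^'] --> c3 r by apply: cvgs => // h; case: (Hs h).
have nDz : nbhs z D by exact: open_nbhs_nbhs.
have cont (g : R * R * R -> R) : cwi D g -> {for z, continuous g}.
  move=> cg P /(cg _ Dz) H; have {}H : nbhs z (fun y => D y -> P (g y)) := H.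
  change (nbhs z (fun y => P (g y))); near=> y.
  have Dy : D y by near: y.
  by move: (Dy); near: y.
apply: cvg_is_derive.
have lim : (f1 (c1 r + (s h).1.1, c2 (r + h), c3 (r + h)) * (h^-1 * (c1 (r + h) - c1 r)) +
   f2 (c1 r, c2 r + (s h).1.2, c3 (r + h)) * (h^-1 * (c2 (r + h) - c2 r)) +
   f3 (c1 r, c2 r, c3 r + (s h).2) * (h^-1 * (c3 (r + h) - c3 r))) @[h --> 0^'] -->
   f1 z * d1 + f2 z * d2 + f3 z * d3.
  apply: cvgD; first apply: cvgD; apply: cvgM; try exact: is_derive_cvg.
  - exact: (cvg_comp _ _ (cvg2 (cvg2 cs1 cc2) cc3) (cont _ cf1)).
  - exact: (cvg_comp _ _ (cvg2 (cvg2 (cvg_cst (c1 r)) cs2) cc3) (cont _ cf2)).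
  - exact: (cvg_comp _ _ (cvg2 (cvg2 (cvg_cst (c1 r)) (cvg_cst (c2 r))) cs3) (cont _ cf3)).
move: lim; apply: cvg_trans; apply: near_eq_cvg; near=> h.
have nz : near_z h.
  by split; near: h; apply: cvgr_distC_lt.
have [_ _ _ /(_ nz) ->] := Hs h.
by ring.
Unshelve. all: by end_near.
Qed.

End Partials.

Section ParamDerive.
Context {R : realType}.
Local Notation mu := (@lebesgue_measure R).

(** The dominating function is a constant: [f'] is bounded on the compact rectangle over the
    interval of half the radius. *)
Lemma derive_param (f f' : R * R -> R) (r0 d a b : R) : 0 < d ->
  (forall r, r0 - d < r < r0 + d -> cwi `[a, b]%classic (fun y => f (r, y))) ->
  (forall r y, r0 - d < r < r0 + d -> a <= y <= b ->
     is_derive r 1 (fun s => f (s, y)) (f' (r, y))) ->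
  cwi (`]r0 - d, r0 + d[%classic `*` `[a, b]%classic) f' ->
  is_derive r0 1 (fun r => \int[mu]_(y in `[a, b]) f (r, y)) (\int[mu]_(y in `[a, b]) f' (r0, y)).
Proof.
move=> d0 cf df cf'.
have [M M0 HM] : exists2 M, 0 <= M & forall r y, r0 - d / 2 <= r <= r0 + d / 2 -> a <= y <= b -> `|f' (r, y)| <= M.
  have [M M0 HM] := @cwi_bounded R _ (`[r0 - d / 2, r0 + d / 2]%classic `*` `[a, b]%classic) f'
    ltac:(by apply: compact_setX; exact: segment_compact)
    ltac:(by apply: cwi_sub cf'; apply: setSX => // x /=; rewrite !in_itv/=; lra).
  by exists M => // r y hr hy; apply: HM; split; rewrite /= in_itv.
have Ir (r : R) : `]r0 - d / 2, r0 + d / 2[%classic r -> r0 - d < r < r0 + d.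
  by rewrite /= in_itv/=; lra.
have Ir0 : `]r0 - d / 2, r0 + d / 2[%classic r0 by rewrite /= in_itv/=; lra.
have mB : measurable (`[a, b]%classic : set (measurableTypeR R)) by [].
have intf r : `]r0 - d / 2, r0 + d / 2[%classic r -> mu.-integrable `[a, b] (EFin \o (fun y => f (r, y))).
  by move=> /Ir/cf/cwi_itv_integrable.
have derf r y : `]r0 - d / 2, r0 + d / 2[%classic r -> `[a, b]%classic y -> derivable (fun s => f (s, y)) r 1.
  by move=> /Ir rI; rewrite /= in_itv/= => /(df _ _ rI) H; exact: ex_derive.
have val r y : `]r0 - d / 2, r0 + d / 2[%classic r -> `[a, b]%classic y ->
    partial1of2 (fun r y => f (r, y)) r y = f' (r, y).
  move=> /Ir rI; rewrite /= in_itv/= => /(df _ _ rI) H.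
  by rewrite partial1of2E; exact: derive_val.
have bound r y : `]r0 - d / 2, r0 + d / 2[%classic r -> `[a, b]%classic y ->
    `|partial1of2 (fun r y => f (r, y)) r y| <= M.
  move=> rI yI; rewrite val//; apply: HM; move: rI yI; rewrite /= !in_itv/=; lra.
have intM : mu.-integrable `[a, b]%classic (EFin \o (fun=> M)).
  by apply: cwi_itv_integrable; exact: cwi_cst.
have D := derivable_under_integral mB Ir0 intf derf (fun=> M0) intM bound.
have V := differentiation_under_integral mB Ir0 intf derf (fun=> M0) intM bound.
split; first exact: D.
rewrite -derive1E V; apply: eq_Rintegral => y; rewrite inE => yab.
exact: val.
Qed.

Definition has_partials2 (D : set (R * R)) (f f1 f2 : R * R -> R) :=
  forall z, D z -> is_derive z (1, 0) f (f1 z) /\ is_derive z (0, 1) f (f2 z).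

(** The case of [chain_rule3] in which the function ignores the third coordinate. *)
Lemma chain_rule2 (D : set (R * R)) f f1 f2 (c1 c2 : R -> R) (r d1 d2 : R) :
  open D -> has_partials2 D f f1 f2 -> cwi D f1 -> cwi D f2 ->
  D (c1 r, c2 r) -> is_derive r 1 c1 d1 -> is_derive r 1 c2 d2 ->
  is_derive r 1 (fun s => f (c1 s, c2 s)) (f1 (c1 r, c2 r) * d1 + f2 (c1 r, c2 r) * d2).
Proof.
move=> oD pf cf1 cf2 Dz h1 h2.
pose lift (g : R * R -> R) (z : R * R * R) := g z.1.
have oD' : open (D `*` setT : set (R * R * R)).
  have -> : (D `*` setT : set (R * R * R)) = fst @^-1` D by apply/seteqP; split => z //= [].
  by apply: open_comp => // z _; exact: cvg_fst.
have cl g : cwi D g -> cwi (D `*` setT : set (R * R * R)) (lift g).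
  by move=> cg; apply: (cwi_comp cg); [exact: cwi_fst|move=> z []].
have pl : has_partials (D `*` setT) (lift f) (lift f1) (lift f2) (fun=> 0).
  move=> z [/pf [p1 p2] _]; split.
  - by apply: is_derive_quotient p1.
  - by apply: is_derive_quotient p2.
  - have := is_derive_cst (0 : R) z dir_t; apply: is_derive_quotient => h.
    rewrite /lift (_ : (h *: dir_t + z).1 = z.1) ?subrr//.
    rewrite [RHS]surjective_pairing; transitivity (h * 0 + z.1.1, h * 0 + z.1.2) => //.
    by rewrite mulr0 !add0r.
have c0 : cwi (D `*` setT : set (R * R * R)) (fun=> 0 : R) by exact: cwi_cst.
have := @chain_rule3 R _ _ _ _ _ c1 c2 id r d1 d2 1 oD' pl (cl _ cf1) (cl _ cf2) c0 (conj Dz I) h1 h2 (is_derive_id r (1 : R)).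
by rewrite mul0r addr0.
Qed.

End ParamDerive.

(** * The divergence theorem above a graph *)

Section EpigraphDivergence.
Context {R : realType}.
Local Notation mu := (@lebesgue_measure R).
Local Notation plane := (@plane R).
Local Notation mu2 := (mu \x mu)%E.

Lemma patch_bounded_support (K D : set (R * R)) f : compact K ->
  measurable (D : set plane) -> D `<=` K -> cwi K f ->
  exists L M, [/\ 0 <= L, 0 <= M & bounded_support L M (f \_ D)].
Proof.
move=> cK mD DK cf; have [M M0 HM] := cwi_bounded cK cf.
have [L L0 HL] := compact_in_square cK; exists L, M; split => //; split.
- apply/(measurable_restrictT _ _).1 => //.
  by apply: cwi_measurable_plane => //; exact: cwi_sub cf.
- by move=> z; rewrite patchE; case: ifPn => [/[!inE]/DK/HM//|_]; rewrite normr0.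
- by move=> z Sz; rewrite patchE; case: ifPn => // /[!inE] /DK/HL.
Qed.

Context (phi phi' : R -> R) (x0 y0 r : R).
Context (dphi : forall x : R, is_derive x 1 phi (phi' x)) (cphi' : continuous phi') (r0 : 0 < r).
Local Notation a := (x0 - r).
Local Notation b := (x0 + r).

Definition epigraph : set (R * R) := [set z | phi z.1 < z.2].
Definition closed_epigraph : set (R * R) := [set z | phi z.1 <= z.2].

(** The edge of the box is included, so that the fundamental theorem on the box meets zero values at
    the end points. *)
Definition box_supported (F : R * R -> R) :=
  forall z, r <= `|z.1 - x0| \/ r <= `|z.2 - y0| -> F z = 0.

Let cphi : continuous phi.
Proof. by move=> x; exact: is_derive_continuous (dphi x). Qed.

Let cwiphi : cwi setT phi. Proof. exact: continuous_cwi. Qed.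

Let cwiphi' : cwi setT phi'. Proof. exact: continuous_cwi. Qed.

Let cheight : continuous (fun z : R * R => z.2 - phi z.1).
Proof.
apply: cwi_setT; apply: cwiB; first exact: cwi_snd.
by apply: (cwi_comp cwiphi) => //; exact: cwi_fst.
Qed.

Lemma open_epigraph : open epigraph.
Proof.
have -> : epigraph = (fun z : R * R => z.2 - phi z.1) @^-1` [set y | 0 < y].
  by apply/seteqP; split => z; rewrite /epigraph/= subr_gt0.
by apply: open_comp; [move=> z _; exact: cheight|exact: open_gt].
Qed.

Lemma closed_closed_epigraph : closed closed_epigraph.
Proof.
have -> : closed_epigraph = (fun z : R * R => z.2 - phi z.1) @^-1` [set y | 0 <= y].
  by apply/seteqP; split => z; rewrite /closed_epigraph/= subr_ge0.
by apply: closed_comp; [move=> z _; exact: cheight|exact: closed_ge].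
Qed.

Let Lbox := `|x0| + `|y0| + r.

Let box_out F z : box_supported F -> ~ square Lbox z -> F z = 0.
Proof.
move=> bF nz; apply: bF; apply: contrapT => /not_orP[/negP + /negP]; rewrite -!ltNge => h1 h2.
apply: nz; rewrite /square/= /Lbox; move: h1 h2; rewrite !ltr_distl !ler_norml.
by have := ler_norm x0; have := ler_norm y0; have := ler_norm (- x0); have := ler_norm (- y0);
  rewrite !normrN; have := normr_ge0 x0; have := normr_ge0 y0; split; lra.
Qed.

Lemma epigraph_bounded_support F : box_supported F -> cwi closed_epigraph F ->
  exists L M, [/\ 0 <= L, 0 <= M & bounded_support L M (F \_ epigraph)].
Proof.
move=> bF cF; have -> : F \_ epigraph = F \_ (epigraph `&` square Lbox).
  apply/funext => z; rewrite !patchE in_setI; case: (boolP (z \in epigraph)) => //= _.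
  by case: ifPn => // /negP nz; apply: box_out => //; apply: contra_not nz => ?; rewrite inE.
apply: (@patch_bounded_support (closed_epigraph `&` square Lbox)).
- rewrite setIC; apply: compact_closedI; [exact: compact_square|exact: closed_closed_epigraph].
- apply: measurableI; first by apply: open_plane_measurable; exact: open_epigraph.
  by apply: compact_plane_measurable; exact: compact_square.
- by apply: setSI => z; exact: ltW.
- by apply: cwi_sub cF => z [].
Qed.

(** A height above the graph from which every box-supported function vanishes: it is at least the
    distance from the graph up to the top of the box. *)
Let Z := `|y0| + r + xget 0 [set m : R | 0 <= m /\ forall x, a <= x <= b -> `|phi x| <= m].

Let phi_bound : exists m, [/\ 0 <= m, forall x, a <= x <= b -> `|phi x| <= m & Z = `|y0| + r + m].
Proof.
have [m m0 Hm] := cwi_bounded (@segment_compact _ a b) (cwi_sub (@subsetT _ _) cwiphi).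
have [|k0 kb] := @xgetPex _ 0 [set m : R | 0 <= m /\ forall x, a <= x <= b -> `|phi x| <= m].
  by exists m; split => // x xab; apply: Hm; rewrite /= in_itv.
by rewrite /Z; set k := xget _ _ in k0 kb *; exists k.
Qed.

Let Z0 : 0 < Z.
Proof. have [m [m0 _ E]] := phi_bound; have := normr_ge0 y0; have := r0; rewrite E; lra. Qed.

Let top F x z : box_supported F -> a <= x <= b -> Z <= z -> F (x, phi x + z) = 0.
Proof.
move=> bF xab zZ; have [m [m0 pm E]] := phi_bound; have {pm}pm := pm _ xab.
rewrite E in zZ.
apply: bF; right => /=; rewrite ler_normr; apply/orP; left.
have := ler_norm y0; have := ler_norm (- phi x); rewrite normrN; move: pm zZ; lra.
Qed.

(** The coordinates that shear the graph onto the horizontal axis. *)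
Let flat (F : R * R -> R) (z : R * R) : R := F (z.1, phi z.1 + z.2).

Let cflat F : cwi closed_epigraph F -> cwi [set z : R * R | 0 <= z.2] (flat F).
Proof.
move=> cF; apply: (cwi_comp cF); last by move=> z; rewrite /closed_epigraph/= lerDl.
apply: cwi_pair; first exact: cwi_fst.
apply: cwiD; last exact: cwi_snd.
by apply: (cwi_comp cwiphi) => //; exact: cwi_fst.
Qed.

Let flat_itv F x (c d : R) : 0 <= c -> cwi closed_epigraph F -> cwi `[c, d]%classic (fun z => flat F (x, z)).
Proof.
move=> c0 cF; apply: (cwi_comp (cflat cF)).
  by apply: cwi_pair; [exact: cwi_cst|exact: cwi_id].
by move=> z /=; rewrite in_itv/= => /andP[/(le_trans c0)].
Qed.

(** Fubini, and then a shift by [phi x] in the inner integral. *)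
Lemma epigraph_iterated F : box_supported F -> cwi closed_epigraph F ->
  \int[mu2]_z (F \_ epigraph) z =
  \int[mu]_(x in `[a, b]) \int[mu]_(z in `[0, Z]) flat F (x, z).
Proof.
move=> bF cF; have [L [M [L0 M0 bs]]] := epigraph_bounded_support bF cF.
rewrite (bounded_support_iterated bs) [RHS]Rintegral_mkcond.
apply: eq_Rintegral => x _; rewrite patchE mem_setE in_itv/=; case: ifPn => [xab|xab]; last first.
  rewrite (_ : (fun y => _) = cst 0) ?Rintegral_cst ?mul0r//; apply/funext => y.
  rewrite patchE; case: ifPn => // _; apply: bF; left => /=.
  by apply: contraNT xab; rewrite -ltNge ltr_distl; lra.
have mF : measurable_fun setT (fun y => (F \_ epigraph) (x, y)).
  have [mF _ _] := bs.
  exact: (@measurable_fun_pair2 _ _ _ (measurableTypeR R) (measurableTypeR R) (measurableTypeR R) _ x mF).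
have E : (fun z => (F \_ epigraph) (x, z + phi x)) = (fun z => flat F (x, z)) \_ `]0, Z].
  apply/funext => z; rewrite !patchE.
  have -> : (z \in `]0, Z]%classic) = (0 < z <= Z) by rewrite mem_setE in_itv.
  have -> : ((x, z + phi x) \in epigraph) = (0 < z).
    by apply/idP/idP; rewrite inE /epigraph/= ltrDr.
  case: ltP => //= z0; rewrite /flat/= [z + _]addrC.
  by case: leP => // /ltW zZ; exact: top.
have cfl := @flat_itv F x 0 Z (lexx 0) cF.
have ifl := cwi_itv_integrable cfl.
have ifl' : mu.-integrable `]0, Z] (EFin \o (fun z => flat F (x, z))).
  by apply: integrableS ifl => //; apply: subset_itv; rewrite bnd_simp.
rewrite -(Rintegral_shift (c := phi x) mF); last first.
  by rewrite E -restrict_EFin; apply/integrable_restrict => //; rewrite setTI.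
by rewrite E -Rintegral_mkcond Rintegral_itv_obnd_cbnd.
Qed.

Context (F F1 F2 : R * R -> R).
Context (bF : box_supported F) (bF1 : box_supported F1) (bF2 : box_supported F2).
Context (cF : cwi closed_epigraph F) (cF1 : cwi closed_epigraph F1) (cF2 : cwi closed_epigraph F2).
Context (pF : has_partials2 epigraph F F1 F2).

Let sub_epi : epigraph `<=` closed_epigraph.
Proof. by move=> z; exact: ltW. Qed.

Let vertical x : a <= x <= b -> \int[mu]_(z in `[0, Z]) flat F2 (x, z) = - F (x, phi x).
Proof.
move=> xab; transitivity (flat F (x, Z) - flat F (x, 0)); last first.
  by rewrite /flat/= top// sub0r addr0.
apply: (@Rintegral_FTC _ _ (fun z => flat F (x, z))); [exact: ltW|exact: flat_itv|exact: flat_itv|].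
move=> z /andP[z0 _].
have := @chain_rule2 R epigraph F F1 F2 (fun=> x) (fun s => phi x + s) z 0 1 open_epigraph pF
  (cwi_sub sub_epi cF1) (cwi_sub sub_epi cF2).
rewrite mulr0 add0r mulr1; apply; first by rewrite /epigraph/= ltrDl.
by apply: is_derive_eq (add0r _).
Qed.

Lemma epigraph_divergence2 :
  \int[mu2]_z (F2 \_ epigraph) z = - \int[mu]_(x in `[a, b]) F (x, phi x).
Proof.
rewrite epigraph_iterated//.
transitivity (\int[mu]_(x in `[a, b]) (-1 * F (x, phi x))).
  by apply: eq_Rintegral => x; rewrite inE/= in_itv/= => /vertical ->; rewrite mulN1r.
rewrite RintegralZl// ?mulN1r//.
apply: cwi_itv_integrable; apply: (cwi_comp cF) => //.
  by apply: cwi_pair; [exact: cwi_id|exact: cwi_sub cwiphi].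
by move=> x _; rewrite /closed_epigraph/=.
Qed.

(** In the sheared coordinates the integral of an [x]-derivative over a horizontal line is 0 by the
    support condition. By the chain rule this derivative is [F1 + phi' * F2], so [F1] may be
    replaced by [- phi' * F2], which is integrated vertically. *)
Lemma epigraph_divergence1 :
  \int[mu2]_z (F1 \_ epigraph) z = \int[mu]_(x in `[a, b]) (phi' x * F (x, phi x)).
Proof.
rewrite epigraph_iterated//.
pose D (z : R * R) := flat F1 z + phi' z.1 * flat F2 z.
have cD : cwi [set z : R * R | 0 <= z.2] D.
  apply: cwiD; first exact: cflat; apply: cwiM; last exact: cflat.
  by apply: (cwi_comp cwiphi') => //; exact: cwi_fst.
have cDab : cwi (`[a, b]%classic `*` `[0, Z]%classic) D.
  by apply: cwi_sub cD => z [_ /=]; rewrite in_itv/= => /andP[].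
have D0 z : 0 < z -> \int[mu]_(x in `[a, b]) D (x, z) = 0.
  move=> z0; transitivity (flat F (b, z) - flat F (a, z)); last first.
    by rewrite /flat/= !bF ?subrr//; left => /=;
      rewrite ler_normr; apply/orP; [right|left]; lra.
  apply: (@Rintegral_FTC _ _ (fun x => flat F (x, z))); first by have := r0; lra.
  - apply: (cwi_comp cD); last by move=> x _ /=; exact: ltW.
    by apply: cwi_pair; [exact: cwi_id|exact: cwi_cst].
  - apply: (cwi_comp (cflat cF)); last by move=> x _ /=; exact: ltW.
    by apply: cwi_pair; [exact: cwi_id|exact: cwi_cst].
  - move=> x _.
    have := @chain_rule2 R epigraph F F1 F2 id (fun s => phi s + z) x 1 (phi' x) open_epigraph pF
      (cwi_sub sub_epi cF1) (cwi_sub sub_epi cF2).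
    rewrite mulr1 [_ * phi' x]mulrC; apply; first by rewrite /epigraph/= ltrDl.
    by apply: is_derive_eq (addr0 _).
have ID : \int[mu]_(x in `[a, b]) \int[mu]_(z in `[0, Z]) D (x, z) = 0.
  rewrite rectangle_Fubini//.
  have cJ : cwi `[0, Z]%classic (fun z => \int[mu]_(x in `[a, b]) D (x, z)).
    apply: (@cwi_param _ _ _ a b (fun w => D (w.2, w.1))).
    apply: (cwi_comp cDab); first by apply: cwi_pair; [exact: cwi_snd|exact: cwi_fst].
    by move=> w [].
  (* [D0] needs [0 < z], because [F] is differentiable in the open epigraph only; the end point 0 is
     removed. *)
  rewrite -Rintegral_itv_obnd_cbnd; last first.
    by apply: integrableS (cwi_itv_integrable cJ) => //; apply: subset_itv; rewrite bnd_simp.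
  transitivity (\int[mu]_(x in `]0, Z]) 0 : R); last by rewrite Rintegral_cst// mul0r.
  by apply: eq_Rintegral => z; rewrite inE/= in_itv/= => /andP[/D0].
have cDx x : cwi `[0, Z]%classic (fun z => D (x, z)).
  apply: (cwi_comp cD); first by apply: cwi_pair; [exact: cwi_cst|exact: cwi_id].
  by move=> z /=; rewrite in_itv/= => /andP[].
rewrite -[LHS]subr0 -[X in _ - X = _]ID -RintegralB//; last 2 first.
- apply: cwi_itv_integrable; apply: cwi_param; apply: cwi_sub (cflat cF1) => z [_ /=].
  by rewrite in_itv/= => /andP[].
- by apply: cwi_itv_integrable; apply: cwi_param; exact: cDab.
apply: eq_Rintegral => x; rewrite inE/= in_itv/= => xab.
rewrite -RintegralB//; last 2 first.
- by apply: cwi_itv_integrable; exact: flat_itv.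
- exact: cwi_itv_integrable.
transitivity (\int[mu]_(z in `[0, Z]) (- phi' x * flat F2 (x, z))).
  by apply: eq_Rintegral => z _; rewrite /D/=; ring.
rewrite RintegralZl//; last by apply: cwi_itv_integrable; exact: flat_itv.
by rewrite vertical// mulrNN.
Qed.

End EpigraphDivergence.

(** * Smooth functions and turned axes *)

Section Smooth.
Context {R : realType}.
Implicit Types f g : R -> R.

Lemma smooth_derivable f (x : R) : smooth f -> derivable f x 1.
Proof. by move=> /(_ 0%N x). Qed.

Lemma smooth_is_derive f (x : R) : smooth f -> is_derive x 1 f (derive1 f x).
Proof. by move=> sf; rewrite derive1E; apply: derivableP; exact: smooth_derivable. Qed.

Lemma smooth_derive f : smooth f -> smooth (derive1 f).
Proof. by move=> sf k x; have := sf k.+1 x; rewrite derive1Sn. Qed.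

Lemma smooth_continuous f : smooth f -> continuous f.
Proof. by move=> sf x; apply: is_derive_continuous; exact: smooth_is_derive. Qed.

Lemma smooth_cst (c : R) : smooth (fun=> c).
Proof.
move=> k; elim: k c => [|k IH] c x; first exact: derivable_cst.
rewrite derive1Sn (_ : derive1 (fun=> c) = fun=> 0); first exact: IH.
by apply/funext => y; rewrite derive1_cst.
Qed.

Lemma smooth_id : smooth (id : R -> R).
Proof.
case=> [|k] x; first exact: derivable_id.
rewrite derive1Sn (_ : derive1 id = fun=> 1); first exact: smooth_cst.
by apply/funext => y; rewrite derive1_id.
Qed.

Lemma smoothD f g : smooth f -> smooth g -> smooth (fun x => f x + g x).
Proof.
move=> sf sg k; elim: k f g sf sg => [|k IH] f g sf sg x.
  by apply: derivableD; exact: smooth_derivable.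
rewrite derive1Sn (_ : derive1 (fun x => f x + g x) = fun x => derive1 f x + derive1 g x).
  by apply: IH; exact: smooth_derive.
apply/funext => y; rewrite !derive1E deriveD//; exact: smooth_derivable.
Qed.

Lemma smoothZ (c : R) f : smooth f -> smooth (fun x => c * f x).
Proof.
move=> sf k; elim: k f sf => [|k IH] f sf x.
  by apply: derivableZ; exact: smooth_derivable.
rewrite derive1Sn (_ : derive1 (fun x => c * f x) = fun x => c * derive1 f x).
  by apply: IH; exact: smooth_derive.
apply/funext => y; rewrite !derive1E deriveZ//; exact: smooth_derivable.
Qed.

Lemma smooth_shift (c : R) f : smooth f -> smooth (fun x => f (c + x)).
Proof.
have shift g (x : R) : smooth g -> is_derive x 1 (fun y => g (c + y)) (derive1 g (c + x)).
  move=> sg; have := smooth_is_derive (c + x) sg; apply: is_derive_quotient => h.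
  by rewrite addrCA.
move=> sf k; elim: k f sf => [|k IH] f sf x.
  by have [] := shift _ x sf.
rewrite derive1Sn (_ : derive1 (fun x => f (c + x)) = fun x => derive1 f (c + x)).
  by apply: IH; exact: smooth_derive.
by apply/funext => y; rewrite derive1E (derive_val (is_derive := shift _ y sf)).
Qed.

End Smooth.

Section Rotation.
Context {R : realType}.
Implicit Types (al : R) (p q n : R * R).

Lemma rotate_axes_continuous al : continuous (@rotate_axes R al).
Proof.
apply: cwi_setT; apply: cwi_pair; apply: cwiD; apply: cwiM; try exact: cwi_cst.
- exact: cwi_fst.
- exact: cwi_snd.
- by apply: cwiN; exact: cwi_fst.
- exact: cwi_snd.
Qed.

Lemma rotate_axesD al p q : rotate_axes al (p + q) = rotate_axes al p + rotate_axes al q.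
Proof. by rewrite /rotate_axes; congr pair => /=; ring. Qed.

Lemma rotate_axesB al p q : rotate_axes al (p - q) = rotate_axes al p - rotate_axes al q.
Proof. by rewrite /rotate_axes; congr pair => /=; ring. Qed.

Lemma rotate_axesZ al (c : R) q : rotate_axes al (c *: q) = c *: rotate_axes al q.
Proof. by rewrite /rotate_axes; congr pair => /=; rewrite /GRing.scale/=; ring. Qed.

Lemma dot_rotate al p q : dot (rotate_axes al p) (rotate_axes al q) = dot p q.
Proof.
rewrite /dot/rotate_axes/= -[RHS]mulr1 -(cos2Dsin2 al); ring.
Qed.

Lemma enorm_dot p : enorm p = Num.sqrt (dot p p).
Proof. by rewrite /enorm /dot !expr2. Qed.

Lemma enorm_rotate al p : enorm (rotate_axes al p) = enorm p.
Proof. by rewrite !enorm_dot dot_rotate. Qed.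

End Rotation.

(** * Boundary charts *)

Section Charts.
Context {R : realType}.

(* In axes turned by [c_al], the box with centre [(c_x, c_y)] and half-side [c_R]
   meets the domain in the part above the graph of [c_phi]; [c_r] is the half-side
   of the smaller box that carries the cut-off function. *)
Record chart := Chart {
  c_al : R; c_phi : R -> R; c_x : R; c_y : R; c_R : R; c_r : R }.

Implicit Types (ch : chart) (q : R * R).

Definition chart_coord ch q : R * R := rotate_axes (c_al ch) q.

Definition in_box ch (rho : R) q :=
  `|(chart_coord ch q).1 - c_x ch| < rho /\ `|(chart_coord ch q).2 - c_y ch| < rho.

Lemma chart_coord_continuous ch : continuous (chart_coord ch).
Proof. exact: rotate_axes_continuous. Qed.

Lemma open_in_box ch rho : open (in_box ch rho).
Proof.
have H (f : R * R -> R) c : cwi setT f -> open [set q | `|f q - c| < rho].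
  move=> cf; have -> : [set q | `|f q - c| < rho] = (fun q => `|f q - c|) @^-1` [set y | y < rho] by [].
  apply: open_comp; last exact: open_lt.
  move=> q _; apply: cvg_norm; apply: cvgB; last exact: cvg_cst.
  exact: (cwi_setT cf).
have cc : cwi setT (chart_coord ch) by apply: continuous_cwi; exact: chart_coord_continuous.
apply: openI; apply: H.
  by apply: (cwi_comp (cwi_fst (A := setT)) cc).
by apply: (cwi_comp (cwi_snd (A := setT)) cc).
Qed.

Lemma in_box_le ch rho rho' q : rho <= rho' -> in_box ch rho q -> in_box ch rho' q.
Proof. by move=> h [h1 h2]; split; exact: lt_le_trans h. Qed.

Context (Omega : set (R * R)).
Context (oO : open Omega).

Definition graph_chart ch := smooth (c_phi ch) /\
  forall q, in_box ch (c_R ch) q ->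
    (Omega q <-> c_phi ch (chart_coord ch q).1 < (chart_coord ch q).2).

(* Second alternative: the graph runs below the box, so the chart misses the
   boundary. *)
Definition valid_chart ch := [/\ graph_chart ch, 0 < c_r ch < c_R ch &
  (forall x, `|x - c_x ch| <= c_r ch -> `|c_phi ch x - c_y ch| < c_R ch) \/
  (forall x, c_phi ch x <= c_y ch - c_R ch)].

Lemma closure_boundary q : closure Omega q <-> Omega q \/ boundary Omega q.
Proof.
rewrite /boundary (interior_id _).1//; split=> [cq|].
  by have [?|?] := pselect (Omega q); [left|right].
by case=> [|[]//]; exact: subset_closure.
Qed.

(** A point on or above the graph is approached from straight above through points of [Omega]; the
    part of the box below the graph is open and misses [Omega]. *)
Lemma chart_closure ch q : graph_chart ch -> in_box ch (c_R ch) q ->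
  (closure Omega q <-> c_phi ch (chart_coord ch q).1 <= (chart_coord ch q).2).
Proof.
move=> [sp vO] bq; set gap := fun q => (chart_coord ch q).2 - c_phi ch (chart_coord ch q).1.
have cgap : continuous gap.
  have cc : cwi setT (chart_coord ch) by apply: continuous_cwi; exact: chart_coord_continuous.
  have cp : cwi setT (c_phi ch) by apply: continuous_cwi; exact: smooth_continuous.
  apply: cwi_setT; apply: cwiB; first exact: (cwi_comp (cwi_snd (A := setT)) cc).
  by apply: (cwi_comp cp); [exact: (cwi_comp (cwi_fst (A := setT)) cc)|].
split=> [cO|le].
  rewrite leNgt; apply/negP => lt.
  have n1 : nbhs q (in_box ch (c_R ch)) by apply: open_nbhs_nbhs; split => //; exact: open_in_box.
  have n2 : nbhs q [set q' | gap q' < 0].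
    apply: open_nbhs_nbhs; split; last by rewrite /= /gap subr_lt0.
    have -> : [set q' | gap q' < 0] = gap @^-1` [set y | y < 0] by [].
    by apply: open_comp; [move=> z _; exact: cgap|exact: open_lt].
  have [q' [Oq' [b' g']]] := cO _ (filterI n1 n2).
  move: Oq' => /(vO _ b') lt1; move: g'; rewrite /= /gap subr_lt0 => /(lt_trans lt1).
  by rewrite ltxx.
move=> B nB.
pose ray (e : R) := rotate_axes (- c_al ch) (chart_coord ch q + (0, e)).
have rayE e : chart_coord ch (ray e) = chart_coord ch q + (0, e) by rewrite /chart_coord rotate_axesNK.
have cray : ray e @[e --> 0^'+] --> q.
  have -> : q = ray 0.
    rewrite /ray (_ : (0, 0) = 0)// addr0 /chart_coord.
    by rewrite rotate_axesK.
  apply: cvg_at_right_filter; suff: continuous ray by exact.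
  have cr : cwi setT (@rotate_axes R (- c_al ch)) by apply: continuous_cwi; exact: rotate_axes_continuous.
  apply: cwi_setT; apply: (cwi_comp cr) => // e _.
  by apply: cvgD; [exact: cvg_cst|apply: cvg2; [exact: cvg_cst|exact: cvg_within]].
have n1 : nbhs q (in_box ch (c_R ch)) by apply: open_nbhs_nbhs; split => //; exact: open_in_box.
near (0 : R)^'+ => e.
have e0 : 0 < e by near: e; exact: nbhs_right_gt.
have Be : B (ray e) by near: e; exact: (cray _ nB).
have be : in_box ch (c_R ch) (ray e) by near: e; exact: (cray _ n1).
exists (ray e); split => //; apply/(vO _ be); rewrite rayE.
change (c_phi ch ((chart_coord ch q).1 + 0) < (chart_coord ch q).2 + e); rewrite addr0.
by rewrite (le_lt_trans le)// ltrDl.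
Unshelve. all: by end_near.
Qed.

Lemma chart_boundary ch q : graph_chart ch -> in_box ch (c_R ch) q ->
  (boundary Omega q <-> c_phi ch (chart_coord ch q).1 = (chart_coord ch q).2).
Proof.
move=> vch bq; have [_ /(_ _ bq) vO] := vch.
rewrite /boundary (interior_id _).1//; split.
  move=> [/(chart_closure vch bq) le nO]; apply/eqP; rewrite eq_le le leNgt/=.
  by apply/negP => /vO.
by move=> E; split; [apply/(chart_closure vch bq); rewrite E|move/vO; rewrite E ltxx].
Qed.

Context (sO : smooth_boundary Omega).

(** An interior point gets a constant graph at the bottom of a square inside [Omega], so that one
    kind of chart covers the whole closure. *)
Lemma exists_chart q : closure Omega q -> exists2 ch, valid_chart ch & in_box ch (c_r ch) q.
Proof.
move=> /closure_boundary[Oq|bq].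
  have /nbhs_ballP[d /= d0 qO] : nbhs q Omega by exact: open_nbhs_nbhs.
  exists (Chart 0 (fun=> q.2 - d) q.1 q.2 d (d / 2)); last first.
    by rewrite /in_box/chart_coord/rotate_axes/= cos0 sin0 !mulr1 !mulr0 addr0 add0r !subrr normr0; split; lra.
  split => /=; [split; first exact: smooth_cst|by lra|by right].
  move=> q'; rewrite /in_box/chart_coord/rotate_axes/= cos0 sin0 !mulr1 !mulr0 addr0 add0r => -[h1 h2].
  split=> _; first by move: h2; rewrite ltr_distl; lra.
  by apply: qO; split; rewrite /ball/= distrC.
have [al [phi [sp nq]]] := sO bq.
have /nbhs_ballP[d /= d0 qO] := nq.
set x0 := (rotate_axes al q).1; set y0 := (rotate_axes al q).2.
pose ch0 r := Chart al phi x0 y0 (d / 2) r.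
(* A turned square of half-side [d / 2] lies in the sup-norm ball of radius [d], since the sine and
   the cosine are at most 1 in absolute value. *)
have chO r q' : in_box (ch0 r) (d / 2) q' -> Omega q' <-> phi (rotate_axes al q').1 < (rotate_axes al q').2.
  move=> [/= h1 h2]; apply: qO.
  have e : q - q' = rotate_axes (- al) (rotate_axes al q - rotate_axes al q').
    by rewrite -rotate_axesB rotate_axesK.
  have eX : q.1 - q'.1 = (q - q').1 by [].
  have eY : q.2 - q'.2 = (q - q').2 by [].
  move: h1 h2; rewrite /chart_coord/= -/x0 -/y0.
  set X := (rotate_axes al q').1; set Y := (rotate_axes al q').2 => h1 h2.
  have tri (k l a b : R) : `|k| <= 1 -> `|l| <= 1 -> `|a| < d / 2 -> `|b| < d / 2 -> `|k * a + l * b| < d.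
    move=> k1 l1 a1 b1; apply: le_lt_trans (ler_normD _ _) _; rewrite !normrM.
    have := ler_wpM2r (normr_ge0 a) k1; have := ler_wpM2r (normr_ge0 b) l1; lra.
  have c1 : `|cos al| <= 1 by rewrite ler_norml cos_geN1 cos_le1.
  have s1 : `|sin al| <= 1 by rewrite ler_norml sin_geN1 sin_le1.
  rewrite distrC in h1; rewrite distrC in h2.
  split; rewrite /ball/=.
    rewrite eX e rotate_axesNE/= -mulNr; apply: tri => //; by rewrite normrN.
  by rewrite eY e rotate_axesNE/=; apply: tri.
have gch r : graph_chart (ch0 r) by split=> // q' bq'; exact: chO bq'.
have bx r rho : 0 < rho -> in_box (ch0 r) rho q.
  by move=> rho0; rewrite /in_box/= -/x0 -/y0 !subrr normr0.
have px0 : phi x0 = y0 by apply/(chart_boundary (gch 0) (bx _ _ _)) => //; rewrite divr_gt0.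
have /cvgrPdist_lt/(_ (d / 2)) : phi x @[x --> x0] --> y0.
  by rewrite -px0; exact: smooth_continuous.
rewrite divr_gt0// => /(_ isT)/nbhs_ballP[e /= e0 He].
(* The choice of [e] keeps the graph inside the box over [|x - x0| <= r]; the bound [d / 4] keeps
   [r] below the half-side [d / 2]. *)
pose r := Num.min (e / 2) (d / 4).
have r0 : 0 < r by rewrite lt_min !divr_gt0.
have re : r <= e / 2 by rewrite ge_min lexx.
have rd : r <= d / 4 by rewrite ge_min lexx orbT.
exists (ch0 r); last exact: bx.
split => //=; first by rewrite r0/=; lra.
left => x xr; rewrite distrC; apply: He; rewrite /ball/= distrC; lra.
Qed.

End Charts.

(** * The outward normal in a chart *)

Section ChartNormal.
Context {R : realType}.
Context (Omega : set (R * R)) (oO : open Omega).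
Implicit Types (ch : chart (R := R)) (q n : R * R).

Lemma curve_coord_derive al (gamma : R -> R * R) (s : R) : smooth_curve gamma ->
  is_derive s 1 (fun r => (rotate_axes al (gamma r)).1) (rotate_axes al (velocity gamma s)).1 /\
  is_derive s 1 (fun r => (rotate_axes al (gamma r)).2) (rotate_axes al (velocity gamma s)).2.
Proof.
move=> [/(smooth_is_derive s) d1 /(smooth_is_derive s) d2]; rewrite /rotate_axes /velocity/=.
split.
  by apply: is_derive_eq; rewrite /GRing.scale/= !mulr0 !add0r mulrC [sin al * _]mulrC.
by apply: is_derive_eq; rewrite /GRing.scale/= !mulr0 !add0r !(mulrC (cos al)) !(mulrC (sin al)); ring.
Qed.

Lemma curve_continuous (gamma : R -> R * R) : smooth_curve gamma -> continuous gamma.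
Proof.
move=> [s1 s2]; apply: cwi_setT.
have -> : gamma = (fun s => ((gamma s).1, (gamma s).2)) by apply/funext => s; rewrite -surjective_pairing.
by apply: cwi_pair; apply: continuous_cwi; exact: smooth_continuous.
Qed.

Definition chart_curve ch (x : R) : R * R := rotate_axes (- c_al ch) (x, c_phi ch x).
Definition chart_slope ch (x : R) : R := derive1 (c_phi ch) x.
Definition chart_speed ch (x : R) : R := Num.sqrt (1 + chart_slope ch x ^+ 2).
(** The downward unit normal of the graph, which points outward because the domain lies above. *)
Definition chart_normal ch (x : R) : R * R :=
  rotate_axes (- c_al ch) (chart_slope ch x / chart_speed ch x, - (chart_speed ch x)^-1).

Lemma chart_speed_sqr ch x : chart_speed ch x ^+ 2 = 1 + chart_slope ch x ^+ 2.
Proof. by rewrite sqr_sqrtr// addr_ge0// sqr_ge0. Qed.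

Lemma chart_speed_gt0 ch x : 0 < chart_speed ch x.
Proof. by rewrite sqrtr_gt0 ltr_pwDl// sqr_ge0. Qed.

Lemma chart_curveK ch x : chart_coord ch (chart_curve ch x) = (x, c_phi ch x).
Proof. by rewrite /chart_coord rotate_axesNK. Qed.

Lemma chart_curve_coord ch q : c_phi ch (chart_coord ch q).1 = (chart_coord ch q).2 ->
  chart_curve ch (chart_coord ch q).1 = q.
Proof. by rewrite /chart_curve => ->; rewrite -surjective_pairing rotate_axesK. Qed.

(** The shift by [c] brings a chosen boundary point to the parameter 0, as [is_outward_normal] asks
    of its test curves. *)
Lemma chart_curve_smooth ch (c : R) : smooth (c_phi ch) ->
  smooth_curve (fun s => chart_curve ch (c + s)).
Proof.
move=> sp; have sc := smoothD (@smooth_cst R c) (@smooth_id R).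
have sps := @smooth_shift R c _ sp; rewrite /smooth_curve /chart_curve.
have E s : rotate_axes (- c_al ch) (c + s, c_phi ch (c + s)) =
    (cos (c_al ch) * (c + s) + (- sin (c_al ch)) * c_phi ch (c + s),
     sin (c_al ch) * (c + s) + cos (c_al ch) * c_phi ch (c + s)).
  by rewrite rotate_axesNE mulNr.
by split; under eq_fun do rewrite E/=; apply: smoothD; apply: smoothZ.
Qed.

Lemma chart_curve_velocity ch (c s : R) : smooth (c_phi ch) ->
  rotate_axes (c_al ch) (velocity (fun s => chart_curve ch (c + s)) s) = (1, chart_slope ch (c + s)).
Proof.
move=> sp; have [d1 d2] := curve_coord_derive (c_al ch) s (chart_curve_smooth c sp).
have E r : rotate_axes (c_al ch) (chart_curve ch (c + r)) = (c + r, c_phi ch (c + r)).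
  exact: (chart_curveK ch (c + r)).
have e1 : is_derive s 1 (fun r => (rotate_axes (c_al ch) (chart_curve ch (c + r))).1) 1.
  under eq_fun do rewrite E/=; exact: is_derive_eq (add0r _).
have e2 : is_derive s 1 (fun r => (rotate_axes (c_al ch) (chart_curve ch (c + r))).2) (chart_slope ch (c + s)).
  under eq_fun do rewrite E/=; have := smooth_is_derive (c + s) sp.
  by apply: is_derive_quotient => h; rewrite addrCA.
rewrite [LHS]surjective_pairing; congr pair.
  by rewrite -(derive_val (is_derive := d1)) (derive_val (is_derive := e1)).
by rewrite -(derive_val (is_derive := d2)) (derive_val (is_derive := e2)).
Qed.

(** Unit length and orthogonality to the graph leave two opposite vectors. They cannot both be
    outward normals: the same short segment would lie in [Omega] and outside its closure. *)
Lemma is_outward_normal_unique ch q n n' : graph_chart Omega ch -> in_box ch (c_R ch) q ->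
  boundary Omega q -> is_outward_normal Omega q n -> is_outward_normal Omega q n' -> n = n'.
Proof.
move=> gch bq bdq; have [sp vO] := gch.
have /(chart_boundary oO gch bq) E := bdq.
set x := (chart_coord ch q).1 in E.
set k := chart_slope ch x.
have curve m : is_outward_normal Omega q m -> (rotate_axes (c_al ch) m).1 = - (k * (rotate_axes (c_al ch) m).2).
  move=> [_ om _].
  have cg := chart_curve_smooth x sp.
  have g0 : chart_curve ch (x + 0) = q by rewrite addr0 chart_curve_coord.
  have := om _ cg g0; rewrite -(dot_rotate (c_al ch)) chart_curve_velocity// /dot/= mul1r addr0.
  move=> H; apply/eqP; rewrite -addr_eq0 -/k; apply/eqP; apply: H.
  have : chart_curve ch (x + s) @[s --> 0] --> q.
    by rewrite -[X in _ --> X]g0; exact: (curve_continuous cg).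
  have nq : nbhs q (in_box ch (c_R ch)) by apply: open_nbhs_nbhs; split => //; exact: open_in_box.
  move=> /(_ _ nq) nb.
  have {}nb : nbhs (0 : R) (fun s => in_box ch (c_R ch) (chart_curve ch (x + s))) := nb.
  by apply: filterS nb => s bs; apply/(chart_boundary oO gch bs); rewrite chart_curveK.
have unit m : is_outward_normal Omega q m -> (1 + k ^+ 2) * (rotate_axes (c_al ch) m).2 ^+ 2 = 1.
  move=> om; have := curve _ om; have [em _ _] := om.
  have : dot (rotate_axes (c_al ch) m) (rotate_axes (c_al ch) m) = 1.
    rewrite dot_rotate; have := congr1 (fun x => x ^+ 2) em; rewrite enorm_dot sqr_sqrtr ?expr1n//.
    by rewrite /dot -!expr2 addr_ge0// sqr_ge0.
  by rewrite /dot => H1 c; rewrite -[RHS]H1 c; ring.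
move=> on on'.
have c1 := curve _ on; have c1' := curve _ on'.
have : (rotate_axes (c_al ch) n).2 ^+ 2 == (rotate_axes (c_al ch) n').2 ^+ 2.
  have k0 : 1 + k ^+ 2 != 0 by rewrite gt_eqF// ltr_pwDl// sqr_ge0.
  by apply/eqP/(mulfI k0); rewrite unit// unit.
have eqn m m' : rotate_axes (c_al ch) m = rotate_axes (c_al ch) m' -> m = m'.
  by move=> /(congr1 (rotate_axes (- c_al ch))); rewrite !rotate_axesK.
rewrite eqf_sqr => /orP[/eqP e2|/eqP e2].
  by apply: eqn; rewrite [LHS]surjective_pairing [RHS]surjective_pairing c1 c1' e2.
have nn' : n = - n'.
  apply: eqn; rewrite -[- n']add0r rotate_axesB.
  rewrite [LHS]surjective_pairing c1 e2; transitivity (- (rotate_axes (c_al ch) n').1, - (rotate_axes (c_al ch) n').2).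
    by rewrite c1'; congr pair; ring.
  by congr pair => /=; rewrite !mul0r ?oppr0 ?mul0r !addr0 !add0r.
have [_ _ h] := on; have [_ _ h'] := on'.
have [e [[_ ne] [Oe' _]]] := filter_ex (filterI h h').
by case: ne; apply: subset_closure; rewrite nn' scalerN.
Qed.

Lemma chart_normal_outward ch q : graph_chart Omega ch -> in_box ch (c_R ch) q ->
  boundary Omega q -> is_outward_normal Omega q (chart_normal ch (chart_coord ch q).1).
Proof.
move=> gch bq bdq; have [sp vO] := gch.
have /(chart_boundary oO gch bq) E := bdq.
set x := (chart_coord ch q).1 in E *; set y := (chart_coord ch q).2 in E *.
set k := chart_slope ch x; set v := chart_speed ch x.
have v0 : 0 < v by exact: chart_speed_gt0.
have v2 : v ^+ 2 = 1 + k ^+ 2 by exact: chart_speed_sqr.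
have nbx : nbhs q (in_box ch (c_R ch)) by apply: open_nbhs_nbhs; split => //; exact: open_in_box.
split.
- rewrite /chart_normal enorm_rotate /enorm/= -/k -/v sqrrN.
  rewrite (_ : _ + _ = 1) ?sqrtr1//; apply: (mulfI (lt0r_neq0 (exprn_gt0 2 v0))).
  rewrite [in RHS]v2 mulr1; rewrite mulrDr expr_div_n; field.
  exact: lt0r_neq0.
- move=> g sg g0 gb; have cg := curve_continuous sg.
  have [d1 d2] := curve_coord_derive (c_al ch) 0 sg.
  (* A test curve satisfies the equation of the graph near 0; differentiating this equation makes
     its velocity tangent to the graph. *)
  have near_eq : \forall s \near (0 : R), (rotate_axes (c_al ch) (g s)).2 = c_phi ch (rotate_axes (c_al ch) (g s)).1.
    have /(_ (in_box ch (c_R ch))) H := cg 0; rewrite g0 in H.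
    apply: filterS2 gb (H nbx) => s bs Bs.
    by have /(chart_boundary oO gch Bs) := bs.
  have dx := smooth_is_derive x sp.
  have d2' : is_derive (0 : R) 1 (fun s => c_phi ch (rotate_axes (c_al ch) (g s)).1)
      (k * (rotate_axes (c_al ch) (velocity g 0)).1).
    have dx' : is_derive (rotate_axes (c_al ch) (g 0)).1 1 (c_phi ch) k by rewrite g0.
    exact: is_derive1_comp.
  have := is_derive_near near_eq d2 => d2''.
  have E2 : (rotate_axes (c_al ch) (velocity g 0)).2 = k * (rotate_axes (c_al ch) (velocity g 0)).1.
    by rewrite -(derive_val (is_derive := d2'')) (derive_val (is_derive := d2')).
  rewrite -(dot_rotate (c_al ch)) /chart_normal rotate_axesNK /dot E2; set w := (rotate_axes _ (velocity _ _)).1; rewrite /= -/k -/v.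
  by field; exact: lt0r_neq0.
- pose n := chart_normal ch x.
  have cn (e : R) : chart_coord ch (q - e *: n) = (x - e * (k / v), y + e / v).
    rewrite /chart_coord rotate_axesB rotate_axesZ /n/chart_normal rotate_axesNK.
    rewrite [rotate_axes _ q]surjective_pairing; congr pair.
    by change (y - e * (- v^-1) = y + e / v); rewrite mulrN opprK.
  (* The height of [q - e *: n] above the graph. It vanishes at 0 with derivative [v > 0], so near 0
     it has the sign of [e]. *)
  pose gap (e : R) := y + e / v - c_phi ch (x - e * (k / v)).
  have dgap : is_derive (0 : R) 1 gap v.
    have dx : is_derive (x - 0 * (k / v)) 1 (c_phi ch) k.
      by rewrite mul0r subr0; exact: smooth_is_derive.
    have dl : is_derive (0 : R) 1 (fun e => x - e * (k / v)) (- (k / v)).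
      by apply: is_derive_eq; rewrite /GRing.scale/=; ring.
    have dc : is_derive (0 : R) 1 (fun e => c_phi ch (x - e * (k / v))) (k * - (k / v)).
      exact: is_derive1_comp.
    have dy : is_derive (0 : R) 1 (fun e => y + e / v) v^-1.
      by apply: is_derive_eq; rewrite /GRing.scale/=; ring.
    apply: is_derive_eq; apply: (mulfI (lt0r_neq0 v0)); rewrite -expr2 v2; field.
    exact: lt0r_neq0.
  have gap0 : gap 0 = 0 by rewrite /gap mul0r addr0 mul0r subr0 E subrr.
  have pos : \forall e \near (0 : R)^', 0 < e^-1 * gap e.
    have := is_derive_cvg dgap; under eq_fun do rewrite add0r gap0 subr0.
    by move=> /cvgr_gt; exact.
  have nray (s : R) : \forall e \near (0 : R)^'+, in_box ch (c_R ch) (q - (s * e) *: n).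
    have cray : continuous (fun e => q - (s * e) *: n).
      apply: cwi_setT.
      have -> : (fun e => q - (s * e) *: n) = (fun e => (q.1 - s * e * n.1, q.2 - s * e * n.2)).
        by apply/funext => e; rewrite [LHS]surjective_pairing.
      by apply: cwi_pair; apply: cwiB; (try exact: cwi_cst); apply: cwiM; (try exact: cwi_cst);
        apply: cwiM; (try exact: cwi_cst); exact: cwi_id.
    have := cray 0; rewrite /continuous_at mulr0 scale0r subr0 => /cvg_at_right_filter.
    by move=> /(_ _ nbx).
  have dleft : nbhs (0 : R) (fun e => e != 0 -> 0 < e^-1 * gap e) := pos.
  have dright : nbhs (0 : R) (fun e => - e != 0 -> 0 < (- e)^-1 * gap (- e)).
    have : - e @[e --> (0 : R)] --> - 0 by apply: cvgN; exact: cvg_id.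
    by rewrite oppr0 => /(_ _ dleft).
  have at_right_of (P : R -> Prop) : nbhs (0 : R) P -> \forall e \near (0 : R)^'+, P e.
    by move=> nP; suff H : nbhs (0 : R) (fun e => 0 < e -> P e) by []; apply: filterS nP.
  have pos1 : \forall e \near (0 : R)^'+, 0 < gap e.
    near=> e; have e0 : 0 < e by near: e; exact: nbhs_right_gt.
    have : e != 0 -> 0 < e^-1 * gap e by near: e; exact: at_right_of.
    rewrite gt_eqF// => /(_ isT).
    by rewrite pmulr_rgt0// invr_gt0.
  have pos2 : \forall e \near (0 : R)^'+, gap (- e) < 0.
    near=> e; have e0 : 0 < e by near: e; exact: nbhs_right_gt.
    have : - e != 0 -> 0 < (- e)^-1 * gap (- e) by near: e; exact: at_right_of.
    rewrite oppr_eq0 gt_eqF// => /(_ isT).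
    by rewrite invrN mulNr -mulrN pmulr_rgt0 ?invr_gt0// oppr_gt0.
  near=> e.
  have b1 : in_box ch (c_R ch) (q - e *: n).
    by rewrite -[e]mul1r; near: e; exact: nray.
  have b2 : in_box ch (c_R ch) (q - (- e) *: n).
    by rewrite -[- e]mulN1r; near: e; exact: nray.
  split.
    apply/(vO _ b1); rewrite cn/= -subr_gt0; near: e; exact: pos1.
  rewrite (_ : q + _ = q - (- e) *: n); last by rewrite scaleNr opprK.
  move=> /(chart_closure gch b2); rewrite cn/= -subr_ge0 leNgt => /negP; apply.
  by near: e; exact: pos2.
Unshelve. all: by end_near.
Qed.

Lemma outward_normalE ch q : graph_chart Omega ch -> in_box ch (c_R ch) q ->
  boundary Omega q -> outward_normal Omega q = chart_normal ch (chart_coord ch q).1.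
Proof.
move=> gch bq bdq; have H := chart_normal_outward gch bq bdq.
apply: (is_outward_normal_unique gch bq bdq) => //.
by rewrite /outward_normal; apply: xgetPex; exists (chart_normal ch (chart_coord ch q).1).
Qed.

End ChartNormal.

(** * Cut-off functions *)

Section Cutoff.
Context {R : realType}.
Local Notation mu := (@lebesgue_measure R).
Local Notation plane := (@plane R).
Local Notation mu2 := (mu \x mu)%E.

Lemma cwi_local {T U : topologicalType} (A : set T) (f : T -> U) :
  (forall x, A x -> exists V, [/\ open V, V x & cwi (A `&` V) f]) -> cwi A f.
Proof.
move=> H x Ax; have [V [oV Vx cV]] := H x Ax.
move=> P /(cV x (conj Ax Vx)) nP.
have {}nP : nbhs x (fun y => (A `&` V) y -> P (f y)) := nP.
change (nbhs x (fun y => A y -> P (f y))).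
have nV : nbhs x V by exact: open_nbhs_nbhs.
by apply: filterS2 nP nV => y Py Vy Ay; apply: Py.
Qed.

Lemma is_derive_of_line {V : normedModType R} (f : V -> R) z e d :
  is_derive (0 : R) 1 (fun s : R => f (z + s *: e)) d -> is_derive z e f d.
Proof.
apply: is_derive_quotient => h.
by rewrite [h *: 1]mulr1 addr0 scale0r addr0 [h *: e + z]addrC.
Qed.

Lemma is_derive_line0 {V : normedModType R} (f : V -> R) z e d :
  is_derive z e f d -> is_derive (0 : R) 1 (fun s : R => f (z + s *: e)) d.
Proof. by move=> H; apply: is_derive_line; rewrite scale0r addr0. Qed.

Lemma is_derive_locally {V : normedModType R} (f g : V -> R) (z e : V) (d : R) :
  (\forall y \near z, f y = g y) -> is_derive z e f d -> is_derive z e g d.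
Proof.
move=> fg /is_derive_line0 H; apply: is_derive_of_line; apply: is_derive_near H.
have : z + s *: e @[s --> (0 : R)] --> z + 0 *: e.
  by apply: cvgD; [exact: cvg_cst|apply: cvgZ; [exact: cvg_id|exact: cvg_cst]].
by rewrite scale0r addr0 => /(_ _ fg).
Qed.

(** The squared positive part is of class C^1 also at 0, which is enough regularity for cut-offs in
    the divergence theorem; the ramp is built from it as well. *)
Definition sqpos (v : R) : R := Num.max 0 v ^+ 2.
Definition dsqpos (v : R) : R := 2 * Num.max 0 v.

Lemma maxr0_continuous : continuous (fun v : R => Num.max 0 v).
Proof. by move=> v; apply: continuous_max; [exact: cvg_cst|exact: cvg_id]. Qed.

Lemma sqpos_continuous : continuous sqpos.
Proof.
apply: cwi_setT; rewrite /sqpos; under eq_fun do rewrite expr2.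
by apply: cwiM; apply: continuous_cwi; exact: maxr0_continuous.
Qed.

Lemma dsqpos_continuous : continuous dsqpos.
Proof.
apply: cwi_setT; apply: cwiM; first exact: cwi_cst.
by apply: continuous_cwi; exact: maxr0_continuous.
Qed.

Lemma sqpos_ge0 v : 0 <= sqpos v. Proof. exact: sqr_ge0. Qed.

Lemma sqpos_gt0 v : (0 < sqpos v) = (0 < v).
Proof.
rewrite /sqpos; case: (ltP 0 v) => v0; first by rewrite exprn_gt0.
by rewrite expr0n ltxx.
Qed.

Lemma sqpos0 v : v <= 0 -> sqpos v = 0.
Proof. by move=> v0; rewrite /sqpos max_l// expr0n. Qed.

Lemma dsqpos0 v : v <= 0 -> dsqpos v = 0.
Proof. by move=> v0; rewrite /dsqpos max_l// mulr0. Qed.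

Lemma sqpos_derive (v : R) : is_derive v 1 sqpos (dsqpos v).
Proof.
have [v0|v0|<-] := ltgtP 0 v.
- apply: (@is_derive_near _ (fun x => x ^+ 2)); last first.
    by apply: is_derive_eq; rewrite /dsqpos max_r 1?ltW// /GRing.scale/=; ring.
  near=> y; rewrite /sqpos max_r// ltW//; near: y; exact: lt_nbhsr.
- apply: (@is_derive_near _ (fun=> 0)); last first.
    by apply: is_derive_eq; rewrite dsqpos0// ltW.
  near=> y; rewrite sqpos0// ltW//; near: y; exact: lt_nbhsl.
- rewrite dsqpos0//; apply: cvg_is_derive.
  apply: norm_cvg0; apply: (@squeeze_cvgr _ _ _ _ (fun=> 0) (fun h => `|h|)).
  + apply: nearW => h; rewrite normr_ge0/= add0r (sqpos0 (lexx 0)) subr0.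
    have [->|h0] := eqVneq h 0; first by rewrite invr0 mul0r.
    rewrite normrM normfV mulrC ler_pdivrMr ?normr_gt0// -expr2 normrX /sqpos.
    by rewrite lerXn2r ?nnegrE// ger0_norm ?le_max ?lexx// ge_max normr_ge0 ler_norm.
  + exact: cvg_cst.
  + rewrite -[X in _ --> X](@normr0 _ R); apply: cvg_norm; apply: cvg_within_filter.
    exact: cvg_id.
Unshelve. all: by end_near.
Qed.

Implicit Types (ch : chart (R := R)) (q : R * R).

Definition profile (c r x : R) : R := sqpos (1 - ((x - c) / r) ^+ 2).
Definition dprofile (c r x : R) : R :=
  dsqpos (1 - ((x - c) / r) ^+ 2) * (- (2 * (x - c) / r ^+ 2)).

Lemma profile_derive (c r x : R) : is_derive x 1 (profile c r) (dprofile c r x).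
Proof.
have d := sqpos_derive (1 - ((x - c) / r) ^+ 2).
have d2 : is_derive x 1 (fun x => 1 - ((x - c) / r) ^+ 2) (- (2 * (x - c) / r ^+ 2)).
  have [->|r0] := eqVneq r 0.
    under eq_fun do rewrite invr0 mulr0 expr0n subr0.
    by apply: is_derive_eq; rewrite expr0n invr0 mulr0 oppr0.
  by apply: is_derive_eq; rewrite /GRing.scale/=; field.
exact: is_derive1_comp.
Qed.

Lemma inner_continuous (c r : R) : cwi setT (fun x : R => 1 - ((x - c) / r) ^+ 2).
Proof.
under eq_fun do rewrite expr2.
apply: cwiB; first exact: cwi_cst.
by apply: cwiM; (apply: cwiM; last exact: cwi_cst);
  apply: cwiB; (try exact: cwi_cst); exact: cwi_id.
Qed.

Lemma profile_continuous (c r : R) : continuous (profile c r).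
Proof.
apply: cwi_setT; have s : cwi setT sqpos by apply: continuous_cwi; exact: sqpos_continuous.
by apply: (cwi_comp s) => //; exact: inner_continuous.
Qed.

Lemma dprofile_continuous (c r : R) : continuous (dprofile c r).
Proof.
apply: cwi_setT; have s : cwi setT dsqpos by apply: continuous_cwi; exact: dsqpos_continuous.
apply: cwiM; first by apply: (cwi_comp s) => //; exact: inner_continuous.
apply: cwiN; apply: cwiM; last exact: cwi_cst.
apply: cwiM; first exact: cwi_cst.
by apply: cwiB; [exact: cwi_id|exact: cwi_cst].
Qed.

Lemma profile_arg (c r x : R) : 0 < r -> (0 < 1 - ((x - c) / r) ^+ 2) = (`|x - c| < r).
Proof.
move=> r0; rewrite subr_gt0 -[X in _ < X](expr1n _ 2) -[((x - c) / r) ^+ 2]real_normK ?num_real//.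
by rewrite ltr_pXn2r ?nnegrE// normrM normfV (gtr0_norm r0) ltr_pdivrMr// mul1r.
Qed.

Lemma profile_ge0 c r x : 0 <= profile c r x.
Proof. exact: sqpos_ge0. Qed.

Lemma profile_gt0 (c r x : R) : 0 < r -> (0 < profile c r x) = (`|x - c| < r).
Proof. by move=> r0; rewrite /profile sqpos_gt0 profile_arg. Qed.

Lemma profile0 (c r x : R) : 0 < r -> r <= `|x - c| -> profile c r x = 0.
Proof. by move=> r0 rx; apply: sqpos0; rewrite leNgt profile_arg// -leNgt. Qed.

Lemma dprofile0 (c r x : R) : 0 < r -> r <= `|x - c| -> dprofile c r x = 0.
Proof. by move=> r0 rx; rewrite /dprofile dsqpos0 ?mul0r// leNgt profile_arg// -leNgt. Qed.

Definition cutoff_coord ch (z : R * R) :=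
  profile (c_x ch) (c_r ch) z.1 * profile (c_y ch) (c_r ch) z.2.
Definition cutoff_coord1 ch (z : R * R) :=
  dprofile (c_x ch) (c_r ch) z.1 * profile (c_y ch) (c_r ch) z.2.
Definition cutoff_coord2 ch (z : R * R) :=
  profile (c_x ch) (c_r ch) z.1 * dprofile (c_y ch) (c_r ch) z.2.

Lemma cutoff_coord_partials ch : has_partials2 setT (cutoff_coord ch) (cutoff_coord1 ch) (cutoff_coord2 ch).
Proof.
move=> z _; split.
  have d : is_derive z.1 1 (fun x => profile (c_y ch) (c_r ch) z.2 * profile (c_x ch) (c_r ch) x)
     (profile (c_y ch) (c_r ch) z.2 * dprofile (c_x ch) (c_r ch) z.1).
    by apply: is_deriveZ; exact: profile_derive.
  rewrite /cutoff_coord1 mulrC; move: d; apply: is_derive_quotient => h.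
  have -> : (h *: (1, 0) + z) = (h *: 1 + z.1, z.2).
    by rewrite [LHS]surjective_pairing; congr pair; rewrite -[RHS]add0r; congr (_ + _); exact: mulr0.
  by rewrite /cutoff_coord /= ![profile (c_y ch) _ _ * _]mulrC.
have d : is_derive z.2 1 (fun x => profile (c_x ch) (c_r ch) z.1 * profile (c_y ch) (c_r ch) x)
   (profile (c_x ch) (c_r ch) z.1 * dprofile (c_y ch) (c_r ch) z.2).
  by apply: is_deriveZ; exact: profile_derive.
move: d; apply: is_derive_quotient => h.
have -> : (h *: (0, 1) + z) = (z.1, h *: 1 + z.2).
  by rewrite [LHS]surjective_pairing; congr pair; rewrite -[RHS]add0r; congr (_ + _); exact: mulr0.
by [].
Qed.

Lemma cutoff_coord_continuous ch : [/\ continuous (cutoff_coord ch),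
  continuous (cutoff_coord1 ch) & continuous (cutoff_coord2 ch)].
Proof.
have c1 (f : R -> R) : continuous f -> cwi setT (fun z : R * R => f z.1).
  by move=> cf; apply: (cwi_comp (A := setT)) => //; [exact: continuous_cwi|exact: cwi_fst].
have c2 (f : R -> R) : continuous f -> cwi setT (fun z : R * R => f z.2).
  by move=> cf; apply: (cwi_comp (A := setT)) => //; [exact: continuous_cwi|exact: cwi_snd].
by split; apply: cwi_setT; apply: cwiM; [apply: c1|apply: c2|apply: c1|apply: c2|apply: c1|apply: c2];
  try exact: profile_continuous; exact: dprofile_continuous.
Qed.

Lemma cutoff_coord0 ch (z : R * R) : 0 < c_r ch ->
  c_r ch <= `|z.1 - c_x ch| \/ c_r ch <= `|z.2 - c_y ch| ->
  [/\ cutoff_coord ch z = 0, cutoff_coord1 ch z = 0 & cutoff_coord2 ch z = 0].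
Proof.
move=> r0 h; rewrite /cutoff_coord /cutoff_coord1 /cutoff_coord2.
by case: h => h; rewrite (profile0 r0 h) (dprofile0 r0 h) ?mul0r ?mulr0.
Qed.

Definition cutoff ch q := cutoff_coord ch (chart_coord ch q).
Definition cutoffx ch q := cos (c_al ch) * cutoff_coord1 ch (chart_coord ch q)
  - sin (c_al ch) * cutoff_coord2 ch (chart_coord ch q).
Definition cutoffy ch q := sin (c_al ch) * cutoff_coord1 ch (chart_coord ch q)
  + cos (c_al ch) * cutoff_coord2 ch (chart_coord ch q).

Lemma cutoff_ge0 ch q : 0 <= cutoff ch q.
Proof. by rewrite /cutoff/cutoff_coord mulr_ge0// profile_ge0. Qed.

Lemma cutoff_gt0 ch q : 0 < c_r ch -> in_box ch (c_r ch) q -> 0 < cutoff ch q.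
Proof. by move=> r0 [h1 h2]; rewrite /cutoff/cutoff_coord mulr_gt0// profile_gt0. Qed.

Lemma cutoff0 ch q : 0 < c_r ch -> ~ in_box ch (c_r ch) q -> cutoff ch q = 0.
Proof.
move=> r0 nb; have [|b0 _ _] := @cutoff_coord0 ch (chart_coord ch q) r0; last exact: b0.
have [h1|h1] := ltP `|(chart_coord ch q).1 - c_x ch| (c_r ch); last by left.
by right; rewrite leNgt; apply/negP => h2; apply: nb.
Qed.

Lemma cutoff_continuous ch : [/\ continuous (cutoff ch), continuous (cutoffx ch) & continuous (cutoffy ch)].
Proof.
have [c0 c1 c2] := cutoff_coord_continuous ch.
have cc (f : R * R -> R) : continuous f -> cwi setT (fun q => f (chart_coord ch q)).
  move=> cf; apply: (cwi_comp (A := setT)) => //; first exact: continuous_cwi.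
  by apply: continuous_cwi; exact: chart_coord_continuous.
split; apply: cwi_setT; first exact: cc.
  by apply: cwiB; apply: cwiM; (try exact: cwi_cst); exact: cc.
by apply: cwiD; apply: cwiM; (try exact: cwi_cst); exact: cc.
Qed.

Lemma derive_direction (D : set (R * R)) f f1 f2 (z e : R * R) : open D ->
  has_partials2 D f f1 f2 -> cwi D f1 -> cwi D f2 -> D z ->
  is_derive z e f (f1 z * e.1 + f2 z * e.2).
Proof.
move=> oD pf cf1 cf2 Dz; apply: is_derive_of_line.
have l (a b : R) : is_derive (0 : R) 1 (fun s => a + s * b) b.
  by apply: is_derive_eq; rewrite /GRing.scale/=; ring.
have := @chain_rule2 R D f f1 f2 (fun s => z.1 + s * e.1) (fun s => z.2 + s * e.2) 0 e.1 e.2 oD pf cf1 cf2.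
by rewrite !mul0r !addr0 -surjective_pairing; apply.
Qed.

Lemma rotate_line al (q e : R * R) (s : R) :
  rotate_axes al (q + s *: e) = rotate_axes al q + s *: rotate_axes al e.
Proof. by rewrite rotate_axesD rotate_axesZ. Qed.

Lemma cutoff_partials ch : has_partials2 setT (cutoff ch) (cutoffx ch) (cutoffy ch).
Proof.
have [_ c1 c2] := cutoff_coord_continuous ch.
have dir e q : is_derive q e (cutoff ch)
    (cutoff_coord1 ch (chart_coord ch q) * (rotate_axes (c_al ch) e).1 +
     cutoff_coord2 ch (chart_coord ch q) * (rotate_axes (c_al ch) e).2).
  apply: is_derive_of_line; under eq_fun do rewrite /cutoff /chart_coord rotate_line.
  apply: is_derive_line0; apply: derive_direction (@cutoff_coord_partials ch) _ _ I; first exact: openT.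
    exact: continuous_cwi.
  exact: continuous_cwi.
move=> q _; split; apply: is_derive_eq (dir _ _) _.
  by rewrite /cutoffx /rotate_axes/=; ring.
by rewrite /cutoffy /rotate_axes/=; ring.
Qed.

End Cutoff.

(** * The divergence theorem in one chart *)

Section LocalDivergence.
Context {R : realType}.
Local Notation mu := (@lebesgue_measure R).
Local Notation plane := (@plane R).
Local Notation mu2 := (mu \x mu)%E.

(** The derivatives are carried as data, because on the boundary they are continuous extensions and
    not derivatives. *)
Definition C1bar (Omega : set (R * R)) (g gx gy : R * R -> R) :=
  [/\ cwi (closure Omega) g, cwi (closure Omega) gx, cwi (closure Omega) gy &
      has_partials2 Omega g gx gy].

Lemma compact_closure_bounded (Omega : set (R * R)) : bounded_set Omega -> compact (closure Omega).
Proof.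
move=> [M [_ HM]]; have sub : Omega `<=` square (`|M| + 1).
  move=> z Oz; have := HM (`|M| + 1) ltac:(by rewrite ltr_pwDr// ler_norm) z Oz.
  by rewrite /= prod_normE ge_max => /andP[].
have cs : closed (@square R (`|M| + 1)).
  by apply: compact_closed; [exact: norm_hausdorff|exact: compact_square].
apply: (subclosed_compact _ (@compact_square R (`|M| + 1))); first exact: closed_closure.
by have := closure_subset sub; rewrite -((closure_id _).1 cs).
Qed.

Context (Omega : set (R * R)) (oO : open Omega) (kO : compact (closure Omega)).

Lemma cwi_domain_integrable f : cwi (closure Omega) f -> mu2.-integrable Omega (EFin \o f).
Proof.
move=> cf; have [L L0 HL] := compact_in_square kO.
apply: (@integrableS _ _ _ mu2 (closure Omega)).
- exact: compact_plane_measurable.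
- exact: open_plane_measurable.
- exact: subset_closure.
- apply: cwi_integrable_plane => //; apply: le_lt_trans (square_lty L).
  apply: le_measure => //; rewrite inE; apply: compact_plane_measurable => //.
  exact: compact_square.
Qed.

Lemma domain_bounded_support f : cwi (closure Omega) f ->
  exists L M, [/\ 0 <= L, 0 <= M & bounded_support L M (f \_ Omega)].
Proof.
move=> cf; apply: (patch_bounded_support kO) => //; first exact: open_plane_measurable.
exact: subset_closure.
Qed.

Context (ch : chart (R := R)) (vch : valid_chart Omega ch).
Context (g gx gy : R * R -> R) (Cg : C1bar Omega g gx gy).

Local Notation al := (c_al ch).
Local Notation x0 := (c_x ch).
Local Notation y0 := (c_y ch).
Local Notation r := (c_r ch).
Local Notation rinv := (rotate_axes (- al)).

Let gch : graph_chart Omega ch. Proof. by case: vch. Qed.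
Let sp : smooth (c_phi ch). Proof. by case: gch. Qed.
Let r0 : 0 < r. Proof. by case: vch => _ /andP[]. Qed.
Let rR : r < c_R ch. Proof. by case: vch => _ /andP[]. Qed.

Let box (rho : R) : set (R * R) := [set z | `|z.1 - x0| < rho /\ `|z.2 - y0| < rho].

Let boxP rho z : in_box ch rho (rinv z) <-> box rho z.
Proof. by rewrite /in_box /chart_coord rotate_axesNK. Qed.

Let open_box rho : open (box rho).
Proof.
have -> : box rho = rinv @^-1` (in_box ch rho) by apply/seteqP; split => z /boxP.
by apply: open_comp; [move=> z _; exact: rotate_axes_continuous|exact: open_in_box].
Qed.

(** Since [r < c_R], this open set and the box of half-side [c_R] cover the plane. In the box
    [Omega] is the epigraph; here the cut-off vanishes. Continuity and derivatives are checked on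
    the two pieces. *)
Let outside : set (R * R) := [set z | r < `|z.1 - x0| \/ r < `|z.2 - y0|].

Let open_outside : open outside.
Proof.
have H (f : R * R -> R) c : cwi setT f -> open [set q | r < `|f q - c|].
  move=> cf; have -> : [set q | r < `|f q - c|] = (fun q => `|f q - c|) @^-1` [set y | r < y] by [].
  apply: open_comp; last exact: open_gt.
  move=> q _; apply: cvg_norm; apply: cvgB; last exact: cvg_cst.
  exact: (cwi_setT cf).
by apply: openU; apply: H; [exact: cwi_fst|exact: cwi_snd].
Qed.

Let box_cases z : box (c_R ch) z \/ outside z.
Proof.
have [h1|h1] := ltP `|z.1 - x0| (c_R ch); last by right; left; exact: lt_le_trans h1.
by have [h2|h2] := ltP `|z.2 - y0| (c_R ch); [left|right; right; exact: lt_le_trans h2].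
Qed.

Let outside_cutoff z : outside z -> [/\ cutoff_coord ch z = 0, cutoff_coord1 ch z = 0 & cutoff_coord2 ch z = 0].
Proof. by move=> [h|h]; apply: cutoff_coord0 => //; [left|right]; exact: ltW. Qed.

Let epi := epigraph (c_phi ch).
Let cepi := closed_epigraph (c_phi ch).

Let box_epi z : box (c_R ch) z -> (Omega (rinv z) <-> epi z).
Proof.
move=> /boxP bz; have [_ vO] := gch; rewrite (vO _ bz) /chart_coord rotate_axesNK.
by [].
Qed.

Let box_cepi z : box (c_R ch) z -> cepi z -> closure Omega (rinv z).
Proof.
move=> /boxP bz; rewrite (chart_closure gch bz) /chart_coord rotate_axesNK.
by [].
Qed.

Let cut_continuous (b G : R * R -> R) : continuous b ->
  (forall z, outside z -> b z = 0) -> cwi (closure Omega) G ->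
  cwi cepi (fun z => b z * G (rinv z)).
Proof.
move=> cb b0 cG; apply: cwi_local => z cz; have [bz|oz] := box_cases z.
  exists (box (c_R ch)); split; [exact: (@open_box (c_R ch))|exact: bz|].
  apply: cwiM; first exact: continuous_cwi.
  apply: (cwi_comp cG); first by apply: continuous_cwi; exact: rotate_axes_continuous.
  by move=> w [cw bw]; exact: box_cepi.
exists outside; split; [exact: open_outside|exact: oz|].
by apply: (@cwi_eq _ _ _ (fun=> 0)); [move=> w [_ /b0 ->]; rewrite mul0r|exact: cwi_cst].
Qed.

Let F z := cutoff_coord ch z * g (rinv z).
Let F1 z := cutoff_coord1 ch z * g (rinv z) + cutoff_coord ch z * (cos al * gx (rinv z) + sin al * gy (rinv z)).
Let F2 z := cutoff_coord2 ch z * g (rinv z) + cutoff_coord ch z * (- sin al * gx (rinv z) + cos al * gy (rinv z)).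

Let cF : [/\ cwi cepi F, cwi cepi F1 & cwi cepi F2].
Proof.
have [cg cgx cgy _] := Cg; have [cb cb1 cb2] := cutoff_coord_continuous ch.
have o1 z : outside z -> cutoff_coord ch z = 0 by case/outside_cutoff.
have o2 z : outside z -> cutoff_coord1 ch z = 0 by case/outside_cutoff.
have o3 z : outside z -> cutoff_coord2 ch z = 0 by case/outside_cutoff.
split; [exact: cut_continuous|apply: cwiD; first exact: cut_continuous|apply: cwiD; first exact: cut_continuous].
- apply: (@cut_continuous _ (fun q => cos al * gx q + sin al * gy q)) => //.
  by apply: cwiD; apply: cwiM => //; exact: cwi_cst.
- apply: (@cut_continuous _ (fun q => - sin al * gx q + cos al * gy q)) => //.
  by apply: cwiD; apply: cwiM => //; exact: cwi_cst.
Qed.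

Let bF : [/\ box_supported x0 y0 r F, box_supported x0 y0 r F1 & box_supported x0 y0 r F2].
Proof.
by split=> z /(cutoff_coord0 r0)[b0 b1 b2]; rewrite /F/F1/F2 ?b0 ?b1 ?b2 !mul0r ?addr0.
Qed.

Let pF : has_partials2 epi F F1 F2.
Proof.
move=> z ez; have [cg cgx cgy pg] := Cg.
have [bz|oz] := box_cases z; last first.
  have F0 : \forall w \near z, 0 = F w.
    have : nbhs z outside by apply: open_nbhs_nbhs; split => //; exact: open_outside.
    by apply: filterS => w /outside_cutoff[b0 _ _]; rewrite /F b0 mul0r.
  have [b0 b1 b2] := outside_cutoff oz.
  rewrite /F1 /F2 b0 b1 b2 !mul0r addr0.
  by split; apply: (is_derive_locally F0); exact: is_derive_cst.
have Oz : Omega (rinv z) by apply/(box_epi bz).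
have cgx' : cwi Omega gx by apply: cwi_sub cgx; exact: subset_closure.
have cgy' : cwi Omega gy by apply: cwi_sub cgy; exact: subset_closure.
have dg e : is_derive z e (fun w => g (rinv w)) (gx (rinv z) * (rinv e).1 + gy (rinv z) * (rinv e).2).
  apply: is_derive_of_line; under eq_fun do rewrite rotate_line.
  by apply: is_derive_line0; apply: derive_direction oO pg _ _ Oz.
have [db1 db2] := @cutoff_coord_partials R ch z I.
have dg1 := dg (1, 0); have dg2 := dg (0, 1).
split.
  have H : is_derive z (1, 0) (fun w => cutoff_coord ch w * g (rinv w)) _ := is_deriveM db1 dg1.
  by apply: is_derive_eq H _; rewrite /F1 [rotate_axes _ (1, 0)]rotate_axesNE /GRing.scale/=; ring.
have H : is_derive z (0, 1) (fun w => cutoff_coord ch w * g (rinv w)) _ := is_deriveM db2 dg2.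
by apply: is_derive_eq H _; rewrite /F2 [rotate_axes _ (0, 1)]rotate_axesNE /GRing.scale/=; ring.
Qed.

Let dphi (x : R) : is_derive x 1 (c_phi ch) (chart_slope ch x).
Proof. exact: smooth_is_derive. Qed.

Let cslope : continuous (chart_slope ch).
Proof. by apply: smooth_continuous; exact: smooth_derive. Qed.

Let hx q := cutoffx ch q * g q + cutoff ch q * gx q.
Let hy q := cutoffy ch q * g q + cutoff ch q * gy q.

Let ch_hxy : cwi (closure Omega) hx /\ cwi (closure Omega) hy.
Proof.
have [cg cgx cgy _] := Cg; have [cb cb1 cb2] := cutoff_continuous ch.
by split; apply: cwiD; apply: cwiM => //; exact: continuous_cwi.
Qed.

Let patch_epi (a b : R) h : (forall z, h (rinv z) = a * F1 z + b * F2 z) ->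
  forall z, (h \_ Omega) (rinv z) = a * (F1 \_ epi) z + b * (F2 \_ epi) z.
Proof.
move=> hE z; have [bz|oz] := box_cases z.
  rewrite !patchE; have -> : (rinv z \in Omega) = (z \in epi).
    by apply/idP/idP; rewrite !inE; apply box_epi.
  by case: ifP => // _; rewrite !mulr0 addr0.
have [b0 b1 b2] := outside_cutoff oz.
have e1 : F1 z = 0 by rewrite /F1 b0 b1 !mul0r addr0.
have e2 : F2 z = 0 by rewrite /F2 b0 b2 !mul0r addr0.
by rewrite !patchE hE e1 e2 !mulr0 addr0 !if_same !mulr0 addr0.
Qed.

(** Turning the axes preserves measure and replaces [Omega] by the epigraph, where both epigraph
    formulas apply. The coefficients [a] and [b] express a partial derivative in the original axes
    through those in the chart axes. *)
Let integral_patch (a b : R) h : cwi (closure Omega) h ->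
  (forall z, h (rinv z) = a * F1 z + b * F2 z) ->
  \int[mu2]_(q in Omega) h q =
  \int[mu]_(x in `[x0 - r, x0 + r]) (cutoff ch (chart_curve ch x) * g (chart_curve ch x) *
     (a * chart_slope ch x - b)).
Proof.
move=> chh hE; have [L [M [_ _ bs]]] := domain_bounded_support chh.
have [cF0 cF1 cF2] := cF; have [bF0 bF1 bF2] := bF.
rewrite Rintegral_mkcond -(Rintegral_measure_preserving (measure_preserving_rigid 0 al)); last 2 first.
- by case: bs.
- exact: bounded_support_integrable bs.
rewrite /rigid_motion; under eq_Rintegral do rewrite add0r (patch_epi hE).
have [L1 [M1 [_ _ bs1]]] := epigraph_bounded_support dphi bF1 cF1.
have [L2 [M2 [_ _ bs2]]] := epigraph_bounded_support dphi bF2 cF2.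
have i1 := bounded_support_integrable bs1; have i2 := bounded_support_integrable bs2.
rewrite RintegralD//; last 2 first.
- exact: (integrableZl measurableT a i1).
- exact: (integrableZl measurableT b i2).
rewrite !RintegralZl//.
rewrite (epigraph_divergence1 dphi cslope r0 bF0 bF1 cF0 cF1 cF2 pF).
rewrite (epigraph_divergence2 dphi r0 bF0 bF2 cF0 cF1 cF2 pF).
have cFp : cwi setT (fun x => F (x, c_phi ch x)).
  apply: (cwi_comp cF0); last by move=> x _; rewrite /cepi/closed_epigraph/=.
  by apply: cwi_pair; [exact: cwi_id|apply: continuous_cwi; exact: smooth_continuous].
have cI (k : R -> R) : cwi setT k -> mu.-integrable `[x0 - r, x0 + r] (EFin \o k).
  by move=> ck; apply: cwi_itv_integrable; exact: cwi_sub ck.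
have csl : cwi setT (chart_slope ch) by exact: continuous_cwi.
have csF : cwi setT (fun x => chart_slope ch x * F (x, c_phi ch x)) by exact: cwiM.
rewrite mulrN -!RintegralZl//; try exact: cI.
rewrite -RintegralB//; last 2 first.
- by apply: cI; apply: cwiM => //; exact: cwi_cst.
- by apply: cI; apply: cwiM => //; exact: cwi_cst.
apply: eq_Rintegral => x _; rewrite /F /cutoff chart_curveK /chart_curve; ring.
Qed.

Lemma local_divergence :
  \int[mu2]_(q in Omega) (cutoffx ch q * g q + cutoff ch q * gx q) =
  \int[mu]_(x in `[x0 - r, x0 + r]) (cutoff ch (chart_curve ch x) * g (chart_curve ch x) *
     ((chart_normal ch x).1 * chart_speed ch x)) /\
  \int[mu2]_(q in Omega) (cutoffy ch q * g q + cutoff ch q * gy q) =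
  \int[mu]_(x in `[x0 - r, x0 + r]) (cutoff ch (chart_curve ch x) * g (chart_curve ch x) *
     ((chart_normal ch x).2 * chart_speed ch x)).
Proof.
have [chx chy] := ch_hxy.
have cs1 := cos2Dsin2 al.
have v0 x : chart_speed ch x != 0 by rewrite gt_eqF// chart_speed_gt0.
split.
  rewrite (@integral_patch (cos al) (- sin al) hx)//.
    apply: eq_Rintegral => x _; congr (_ * _); rewrite /chart_normal rotate_axesNE/=; field.
    exact: v0.
  move=> z; rewrite /hx /cutoffx /cutoff /F1 /F2 /chart_coord rotate_axesNK.
  rewrite -[X in _ + _ * X = _]mul1r -cs1; ring.
rewrite (@integral_patch (sin al) (cos al) hy)//.
  apply: eq_Rintegral => x _; congr (_ * _); rewrite /chart_normal rotate_axesNE/=; field.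
  exact: v0.
move=> z; rewrite /hy /cutoffy /cutoff /F1 /F2 /chart_coord rotate_axesNK.
rewrite -[X in _ + _ * X = _]mul1r -cs1; ring.
Qed.

End LocalDivergence.

(** * A finite atlas *)

Section Atlas.
Context {R : realType}.
Context (Omega : set (R * R)) (oO : open Omega) (kO : compact (closure Omega)).
Context (sO : smooth_boundary Omega) (neO : Omega !=set0).

Definition cutoff_sum (s : seq (R * R)) (c : R * R -> chart (R := R)) (q : R * R) : R :=
  \sum_(i <- s) cutoff (c i) q.

Lemma exists_atlas : exists (s : seq (R * R)) (c : R * R -> chart (R := R)),
  (forall i, valid_chart Omega (c i)) /\ forall q, closure Omega q -> 0 < cutoff_sum s c q.
Proof.
have [q0 Oq0] := neO.
have ex q : exists ch, valid_chart Omega ch /\ (closure Omega q -> in_box ch (c_r ch) q).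
  have [cq|ncq] := pselect (closure Omega q).
    by have [ch vch bq] := exists_chart oO sO cq; exists ch.
  (* A point outside the closure receives some valid chart, so that the choice of charts is
     total. *)
  have [ch vch _] := exists_chart oO sO (subset_closure Oq0).
  by exists ch.
have [c Hc] := choice ex.
have r0 i : 0 < c_r (c i) by have [[_ /andP[]]] := Hc i.
(* The filter generated by the supersets of each finite list: compactness in near-covering form then
   yields one list that works for every point, that is, a finite subcover. *)
pose F := filter_from setT (fun D : seq (R * R) => [set D' : seq (R * R) | {subset D <= D'}]).
have FF : Filter F.
  apply: filter_fromT_filter; first by exists [::].
  move=> D1 D2; exists (D1 ++ D2) => D' sD; split => i iD; apply: sD; rewrite mem_cat iD ?orbT//.
have /compact_near_coveringP/(_ _ F (fun D q => exists2 i, i \in D & in_box (c i) (c_r (c i)) q) FF) := kO.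
case=> [q cq|D _ HD].
  exists (in_box (c q) (c_r (c q)), [set D' : seq (R * R) | {subset [:: q] <= D'}]) => /=.
    split; last by exists [:: q].
    by apply: open_nbhs_nbhs; split; [exact: open_in_box|exact: (Hc q).2].
  by move=> [q' D'] /= [bq' sD]; exists q => //; apply: sD; rewrite mem_head.
exists (undup D), c; split=> [i|q cq]; first exact: (Hc i).1.
have [i iD bi] := HD D (fun i => id) q cq.
rewrite /cutoff_sum (bigD1_seq i)/= ?mem_undup ?undup_uniq//.
by rewrite ltr_pwDl ?cutoff_gt0// sumr_ge0// => j _; exact: cutoff_ge0.
Qed.

Lemma cutoff_sum_continuous s c : continuous (cutoff_sum s c).
Proof.
apply: cwi_setT; apply: cwi_sum => i; apply: continuous_cwi.
by have [] := @cutoff_continuous R (c i).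
Qed.

Lemma compact_boundary : compact (boundary Omega).
Proof.
apply: (subclosed_compact _ kO); last by move=> q [].
rewrite /boundary setDE; apply: closedI; first exact: closed_closure.
by apply: open_closedC; exact: open_interior.
Qed.

End Atlas.

(** The common end point is taken out of the second arc to get disjoint unions, on which measures
    are additive; it returns at no cost because its measure is 0. *)
Lemma arc_split {R : realType} (gamma : R -> R * R) (x y z : R) : x <= y -> y <= z ->
  (forall s r, x <= s <= z -> x <= r <= z -> gamma s = gamma r -> s = r) ->
  [/\ gamma @` `[x, z]%classic = gamma @` `[x, y]%classic `|` (gamma @` `[y, z]%classic `\ gamma y),
      gamma @` `[y, z]%classic = [set gamma y] `|` (gamma @` `[y, z]%classic `\ gamma y),
      [disjoint gamma @` `[x, y]%classic & gamma @` `[y, z]%classic `\ gamma y] &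
      [disjoint [set gamma y] & gamma @` `[y, z]%classic `\ gamma y]].
Proof.
move=> xy yz injg; split.
- apply/seteqP; split=> q.
    move=> [s /= /[!in_itv]/= /andP[xs sz] <-].
    have [sy|ys] := leP s y; first by left; exists s => //=; rewrite in_itv/= xs.
    right; split; first by exists s => //=; rewrite in_itv/= sz ltW.
    move=> /= gs; have E : s = y by apply: injg => //; rewrite ?xs ?xy.
    by rewrite E ltxx in ys.
  case=> [[s /= /[!in_itv]/= /andP[xs sy] <-]|[[s /= /[!in_itv]/= /andP[ys sz] <-] _]].
    by exists s => //=; rewrite in_itv/= xs (le_trans sy).
  by exists s => //=; rewrite in_itv/= sz (le_trans xy).
- apply/seteqP; split=> q.
    by move=> yq; have [p|np] := pselect (q = gamma y); [left|right].
  by case=> [->|[]//]; exists y => //=; rewrite in_itv/= lexx.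
- apply/disj_setPS => q [[s /= /[!in_itv]/= /andP[xs sy] <-]].
  move=> [[r /= /[!in_itv]/= /andP[yr rz] E] np]; apply: np; rewrite /= -E; congr gamma.
  apply/eqP; rewrite eq_le yr andbT.
  have -> : r = s by apply: injg => //; rewrite ?(le_trans xy yr)// xs (le_trans sy).
  exact: sy.
- by apply/disj_setPS => q [pq [_ npq]].
Qed.

(** * Arc length *)

Section ArcIntegral.
Context {R : realType}.
Local Notation mu := (@lebesgue_measure R).
Local Notation plane := (@plane R).
Context (A : set (R * R)) (cA : compact A) (sigma : {measure set plane -> \bar R}).
Context (sA : is_arc_length A sigma).
Context (gamma : R -> R * R) (a b : R) (ab : a <= b) (rg : regular_arc A gamma a b).

Local Notation v := (fun s => enorm (velocity gamma s)).

Lemma speed_continuous (g : R -> R * R) : smooth_curve g -> continuous (fun s => enorm (velocity g s)).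
Proof.
move=> [s1 s2]; have d1 := smooth_continuous (smooth_derive s1).
have d2 := smooth_continuous (smooth_derive s2).
have cs : cwi setT (@Num.sqrt R) by apply: continuous_cwi; exact: sqrt_continuous.
apply: cwi_setT; apply: (cwi_comp cs) => //.
by apply: cwiD; under eq_fun do rewrite expr2; apply: cwiM; exact: continuous_cwi.
Qed.

Let sg : smooth_curve gamma. Proof. by case: rg. Qed.
Let cg : continuous gamma. Proof. exact: curve_continuous. Qed.
Let cv : cwi setT v. Proof. by apply: continuous_cwi; exact: speed_continuous. Qed.

Local Notation arc c d := (gamma @` `[c, d]%classic).

Let v_ge0 s : 0 <= v s. Proof. exact: sqrtr_ge0. Qed.

Let cwiv c d : cwi `[c, d]%classic v. Proof. exact: cwi_sub cv. Qed.

Lemma EFin_Rintegral (c d : R) (f : R -> R) : cwi `[c, d]%classic f ->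
  (\int[mu]_(s in `[c, d]) (f s)%:E = (\int[mu]_(s in `[c, d]) f s)%:E)%E.
Proof.
move=> cf; rewrite /Rintegral fineK//; apply: integrable_fin_num => //.
exact: cwi_itv_integrable.
Qed.

Let inab c d s : a <= c -> c <= s -> s <= d -> d <= b -> a <= s <= b.
Proof. by move=> ac cs sd db; rewrite (le_trans ac cs) (le_trans sd db). Qed.

Lemma sub_arc_length c d : a <= c -> c <= d -> d <= b ->
  sigma (arc c d) = (\int[mu]_(s in `[c, d]) v s)%:E.
Proof.
move=> ac cd db; have [_ injg Ag] := rg.
rewrite -EFin_Rintegral// -sA.2//; split=> //.
- move=> s r /andP[cs sd] /andP[cr rd]; apply: injg; apply/andP; split.
  + exact: le_trans cs.
  + exact: le_trans db.
  + exact: le_trans cr.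
  + exact: le_trans db.
- move=> s /andP[cs sd]; apply: Ag; apply/andP; split; first exact: le_trans cs.
  exact: le_trans db.
Qed.

Lemma compact_arc c d : compact (arc c d).
Proof.
by apply: continuous_compact; [exact: continuous_subspaceT|exact: segment_compact].
Qed.

Let marc c d : measurable (arc c d : set plane).
Proof. by apply: compact_plane_measurable; exact: compact_arc. Qed.

Let arcA c d : a <= c -> d <= b -> arc c d `<=` A.
Proof.
move=> ac db _ [s /= /[!in_itv]/= /andP[cs sd] <-]; have [_ _ Ag] := rg.
by apply: (Ag s _).1; rewrite (le_trans ac cs) (le_trans sd db).
Qed.

Context (k : R * R -> R) (ck : cwi A k).

Let k_integrable c d : a <= c -> c <= d -> d <= b -> sigma.-integrable (arc c d) (EFin \o k).
Proof.
move=> ac cd db; apply: cwi_integrable_plane; first exact: compact_arc.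
  by rewrite sub_arc_length// ltry.
by apply: cwi_sub ck; exact: arcA.
Qed.

Let kg c d : a <= c -> d <= b -> cwi `[c, d]%classic (fun s => k (gamma s)).
Proof.
move=> ac db; apply: (cwi_comp ck); first exact: continuous_cwi.
by move=> s cs; apply: (arcA ac db); exists s.
Qed.

Let arc_cat x y z : a <= x -> x <= y -> y <= z -> z <= b ->
  \int[sigma]_(q in arc x z) k q = \int[sigma]_(q in arc x y) k q + \int[sigma]_(q in arc y z) k q.
Proof.
move=> ax xy yz zb; have [_ injg _] := rg.
have ay := le_trans ax xy; have yb := le_trans yz zb.
have [E2 E1 dj1 dj2] := @arc_split _ gamma x y z xy yz (fun s r hs hr =>
  injg s r (inab ax (andP hs).1 (andP hs).2 zb) (inab ax (andP hr).1 (andP hr).2 zb)).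
have pt_arc : [set gamma y] = arc y y by rewrite set_itv1 image_set1.
have mpt : measurable ([set gamma y] : set plane) by rewrite pt_arc; exact: marc.
have mD : measurable (arc y z `\ gamma y : set plane) by apply: measurableD => //; exact: marc.
have i1 := k_integrable ax (le_trans xy yz) zb.
have i2 := k_integrable ay yz zb.
rewrite E2 in i1 |- *; rewrite E1 in i2.
rewrite Rintegral_setU//.
rewrite [in RHS]E1 [in RHS]Rintegral_setU//.
suff -> : \int[sigma]_(q in [set gamma y]) k q = 0 by rewrite add0r.
apply/eqP; rewrite -normr_le0; have [M _ HM] := cwi_bounded cA ck.
have s0 : sigma [set gamma y] = 0%E by rewrite pt_arc sub_arc_length// set_itv1 Rintegral_set1.
have -> : 0 = M * fine (sigma [set gamma y]) by rewrite s0 mulr0.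
apply: Rintegral_bound; [exact: mpt|by rewrite s0 ltry|by rewrite pt_arc; exact: k_integrable|].
by rewrite pt_arc => q /(arcA ay yb) Aq; exact: HM.
Qed.

(** On a short arc [k] is nearly constant, and both sides are close to its value times the length.
    The error is at most [e'] times the length, a bound that adds up along [interval_chain]. *)
Lemma arc_integral :
  \int[sigma]_(q in arc a b) k q = \int[mu]_(s in `[a, b]) (k (gamma s) * v s).
Proof.
have ckv c d : a <= c -> d <= b -> cwi `[c, d]%classic (fun s => k (gamma s) * v s).
  by move=> ac db; apply: cwiM; [exact: kg|exact: cwiv].
apply/eqP; rewrite -subr_eq0 -normr_le0; apply/ler_addgt0Pl => e e0.
pose V := \int[mu]_(s in `[a, b]) v s.
have V0 : 0 <= V by apply: Rintegral_ge0 => s _.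
(* The total error is then at most [e * V / (V + 1) <= e]; the summand 1 covers the case of length
   0. *)
pose e' := e / (V + 1).
have V1 : 0 < V + 1 by rewrite ltr_wpDl.
have e'0 : 0 < e' by rewrite divr_gt0.
pose P c d := `|\int[sigma]_(q in arc c d) k q - \int[mu]_(s in `[c, d]) (k (gamma s) * v s)|
   <= e' * \int[mu]_(s in `[c, d]) v s.
suff : P a b.
  move=> /le_trans; apply; rewrite addr0 -/V.
  rewrite (_ : e' * V = e * V / (V + 1)); last by rewrite /e' mulrAC.
  by rewrite ler_pdivrMr// ler_pM2l// lerDl.
apply: (@interval_chain R P a b ab).
  move=> x y z ax xy yz zb; rewrite /P.
  have ay := le_trans ax xy; have yb := le_trans yz zb.
  rewrite (arc_cat ax xy yz zb) (Rintegral_itv_cat xy yz (ckv _ _ ax zb)) (Rintegral_itv_cat xy yz (@cwiv x z)).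
  rewrite mulrDr => h1 h2; apply: le_trans (lerD h1 h2).
  by apply: le_trans (ler_normD _ _); rewrite le_eqVlt; apply/orP; left; apply/eqP; congr Num.norm; ring.
move=> x /andP[ax xb].
have hx : `[a, b]%classic x by rewrite /= in_itv/= ax xb.
have /cvgrPdist_le/(_ (e' / 2)) := @kg a b (lexx a) (lexx b) x hx.
rewrite divr_gt0// => /(_ isT) nk.
have {}nk : nbhs x (fun s => `[a, b]%classic s -> `|k (gamma x) - k (gamma s)| <= e' / 2) := nk.
have /nbhs_ballP[d /= d0 Hd] := nk.
exists d => // c f ac cx xf fb xc fx; rewrite /P.
have cf := le_trans cx xf.
have close s : c <= s <= f -> `|k (gamma s) - k (gamma x)| <= e' / 2.
  move=> /andP[cs sf]; rewrite distrC; apply: Hd.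
    by rewrite /ball/= ltr_distl; apply/andP; split; lra.
  by rewrite /= in_itv/= (le_trans ac cs) (le_trans sf fb).
set k0 := k (gamma x); set W := \int[mu]_(s in `[c, f]) v s.
have sW : fine (sigma (arc c f)) = W by rewrite sub_arc_length.
have e1 : `|\int[sigma]_(q in arc c f) k q - k0 * W| <= e' / 2 * W.
  have ic : sigma.-integrable (arc c f) (EFin \o (fun=> k0)).
    apply: cwi_integrable_plane; [exact: compact_arc|by rewrite sub_arc_length// ltry|exact: cwi_cst].
  rewrite -sW -(Rintegral_cst sigma (marc c f)) -RintegralB//; last exact: k_integrable.
  apply: Rintegral_bound; [exact: marc|by rewrite sub_arc_length// ltry| |].
    have := integrableB (marc c f) (k_integrable ac cf fb) ic.
    by apply: eq_integrable => // q _; rewrite /= EFinB.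
  by move=> _ [s /= /[!in_itv]/= cs <-]; exact: close.
have e2 : `|\int[mu]_(s in `[c, f]) (k (gamma s) * v s) - k0 * W| <= e' / 2 * W.
  rewrite /W -!RintegralZl//; [|exact: cwi_itv_integrable|exact: cwi_itv_integrable].
  have i1 : mu.-integrable `[c, f] (EFin \o (fun s => k (gamma s) * v s)).
    by apply: cwi_itv_integrable; exact: ckv.
  have i2 : mu.-integrable `[c, f] (EFin \o (fun s => k0 * v s)).
    by apply: cwi_itv_integrable; apply: cwiM; [exact: cwi_cst|exact: cwiv].
  have ckd : cwi `[c, f]%classic (fun s => k (gamma s) * v s - k0 * v s).
    by apply: cwiB; [exact: ckv|apply: cwiM; [exact: cwi_cst|exact: cwiv]].
  rewrite -RintegralB//; apply: le_trans (le_normr_Rintegral _ (cwi_itv_integrable ckd)) _ => //.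
  apply: le_Rintegral => //.
  - exact: (integrable_norm (cwi_itv_integrable ckd)).
  - by apply: cwi_itv_integrable; apply: cwiM; [exact: cwi_cst|exact: cwiv].
  - move=> s /=; rewrite in_itv/= => /close h.
    by rewrite -mulrBl normrM (ger0_norm (v_ge0 s)) ler_wpM2r.
rewrite (_ : _ - _ = (\int[sigma]_(q in arc c f) k q - k0 * W) -
   (\int[mu]_(s in `[c, f]) (k (gamma s) * v s) - k0 * W)); last by ring.
apply: le_trans (ler_normB _ _) _.
by rewrite (_ : e' * W = e' / 2 * W + e' / 2 * W); [exact: lerD|field].
Qed.

End ArcIntegral.

(** * Change of parameter *)

Section Substitution.
Context {R : realType}.
Local Notation mu := (@lebesgue_measure R).
Implicit Types (xi : R -> R) (a b c d : R).

(** A regular arc lies on the boundary only for parameters in [[a, b]], so at an end point its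
    equations hold on one side only; a one-sided limit of difference quotients still determines the
    derivative. *)
Lemma derive_agree (f g : R -> R) (f' g' a b s e : R) : a < b -> a <= s <= b -> 0 < e ->
  is_derive s 1 f f' -> is_derive s 1 g g' ->
  (forall r, a <= r <= b -> `|r - s| < e -> f r = g r) -> f' = g'.
Proof.
move=> ab /andP[sa sb] e0 df dg fg.
have dh : is_derive s 1 (fun r => f r - g r) (f' - g') by apply: is_deriveB.
have /is_derive_cvg := dh.
have fgs : f s = g s by apply: fg; rewrite ?sa ?sb// subrr normr0.
under eq_fun do rewrite fgs subrr subr0.
move=> lim; apply/eqP; rewrite -subr_eq0; apply/eqP.
suff [F [FF nF F0]] : exists F : set_system R, [/\ ProperFilter F, F `=>` (0 : R)^' &
    \forall h \near F, h^-1 * (f (s + h) - g (s + h)) = 0].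
  have limF : h^-1 * (f (s + h) - g (s + h)) @[h --> F] --> f' - g'.
    by apply: cvg_trans lim; apply: cvg_app.
  have lim0 : h^-1 * (f (s + h) - g (s + h)) @[h --> F] --> 0.
    apply: (@cvg_trans _ ((fun=> 0 : R) @ F)); last exact: cvg_cst.
    by apply: near_eq_cvg; apply: filterS F0 => h ->.
  exact: (cvg_unique _ limF lim0).
have [sb'|bs] := ltP s b.
  exists ((0 : R)^'+); split.
  - exact: at_right_proper_filter.
  - move=> P nP; have {}nP : nbhs (0 : R) (fun h => h != 0 -> P h) := nP.
    suff : nbhs (0 : R) (fun h => 0 < h -> P h) by [].
    by apply: filterS nP => h H h0; apply: H; rewrite gt_eqF.
  near=> h; have h0 : 0 < h by near: h; exact: nbhs_right_gt.
  rewrite fg ?subrr ?mulr0//.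
    apply/andP; split; first by rewrite (le_trans sa)// lerDl ltW.
    rewrite -lerBrDl; near: h; apply: nbhs_right_le; by rewrite subr_gt0.
  by rewrite addrAC subrr add0r gtr0_norm//; near: h; exact: nbhs_right_lt.
exists ((0 : R)^'-); split.
- exact: at_left_proper_filter.
- move=> P nP; have {}nP : nbhs (0 : R) (fun h => h != 0 -> P h) := nP.
  suff : nbhs (0 : R) (fun h => h < 0 -> P h) by [].
  by apply: filterS nP => h H h0; apply: H; rewrite lt_eqF.
near=> h; have h0 : h < 0 by near: h; exact: nbhs_left_lt.
rewrite fg ?subrr ?mulr0//.
  apply/andP; split; last by rewrite (le_trans _ sb)// gerDl ltW.
  rewrite -lerBlDl; near: h; apply: nbhs_left_ge; rewrite subr_lt0.
  exact: lt_le_trans bs.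
rewrite addrAC subrr add0r ltr0_norm// ltrNl; near: h; apply: nbhs_left_gt.
by rewrite oppr_lt0.
Unshelve. all: by end_near.
Qed.

Lemma image_monotone xi (xi' : R -> R) c d : c <= d -> (forall s : R, is_derive s 1 xi (xi' s)) ->
  (forall s, c <= s <= d -> 0 < xi' s) -> xi @` `[c, d]%classic = `[xi c, xi d]%classic /\
  {in `[c, d] &, {homo xi : x y / x < y}}.
Proof.
move=> cd dxi pos.
have cxi : continuous xi by move=> s; exact: is_derive_continuous (dxi s).
have incr : {in `[c, d] &, {homo xi : x y / x < y}}.
  move=> x y; rewrite !in_itv/= => /andP[cx xd] /andP[cy yd] xy.
  have [|s] := @MVT_segment R xi xi' x y (ltW xy) (fun s _ => dxi s).
    exact: continuous_subspaceT.
  rewrite in_itv/= => /andP[xs sy] E; rewrite -subr_gt0 E mulr_gt0 ?subr_gt0//.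
  by apply: pos; rewrite (le_trans cx xs) (le_trans sy yd).
have mono x y : c <= x -> x <= y -> y <= d -> xi x <= xi y.
  move=> cx; rewrite le_eqVlt => /predU1P[->//|xy] yd; apply/ltW/incr => //.
    by rewrite in_itv/= cx (le_trans (ltW xy)).
  by rewrite in_itv/= yd (le_trans cx (ltW xy)).
split => //; apply/seteqP; split=> x /=.
  move=> [s /[!in_itv]/= /andP[cs sd] <-]; rewrite /= ?in_itv/=; apply/andP; split; exact: mono.
rewrite in_itv/= => /andP[h1 h2].
have [|s scd E] := @IVT R xi c d x cd (continuous_subspaceT cxi).
  by rewrite ge_min le_max h1 h2 orbT.
by exists s.
Qed.

Lemma substitution_increasing xi (xi' : R -> R) c d (G : R -> R) : c <= d ->
  (forall s : R, is_derive s 1 xi (xi' s)) -> continuous xi' ->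
  (forall s, c <= s <= d -> 0 < xi' s) -> cwi (xi @` `[c, d]%classic) G ->
  (\int[mu]_(x in xi @` `[c, d]%classic) (G x)%:E =
   \int[mu]_(s in `[c, d]) (G (xi s) * xi' s)%:E)%E.
Proof.
move=> cd dxi cxi' pos; have [E incr] := image_monotone cd dxi pos; rewrite E => cG.
have d1 : xi^`()%classic = xi' by apply/funext => s; rewrite derive1E (derive_val (is_derive := dxi s)).
rewrite (@integration_by_substitution_increasing R xi G c d cd incr); first by rewrite d1.
- by rewrite d1 => s _; exact: cxi'.
- by rewrite d1; apply/cvg_ex; exists (xi' c); apply: cvg_at_right_filter; exact: cxi'.
- by rewrite d1; apply/cvg_ex; exists (xi' d); apply: cvg_at_left_filter; exact: cxi'.
- have cxi : continuous xi by move=> s; exact: is_derive_continuous (dxi s).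
  split; [by move=> s _; have [] := dxi s|apply: cvg_at_right_filter|apply: cvg_at_left_filter]; exact: cxi.
- exact/cwiP.
Qed.

Lemma lebesgue_integral_opp (A : set R) (G : R -> R) : measurable A -> cwi A G -> compact A ->
  (\int[mu]_(x in A) (G x)%:E = \int[mu]_(x in [set x | A (- x)%R]) (G (- x)%R)%:E)%E.
Proof.
move=> mA cG kA.
pose phi : measurableTypeR R -> measurableTypeR R := -%R.
have mphi : measurable_fun setT phi by exact: oppr_measurable.
have iG : mu.-integrable A (EFin \o G) by apply: continuous_compact_integrable => //; exact/cwiP.
have mGA : measurable_fun setT (EFin \o (G \_ A)).
  apply/measurable_EFinP; apply/(measurable_restrictT _ _).1 => //.
  by apply/measurable_EFinP; exact: (measurable_int mu).
rewrite integral_mkcond restrict_EFin [RHS]integral_mkcond restrict_EFin.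
have -> : (fun x => G (- x)) \_ [set x | A (- x)] = (G \_ A) \o -%R.
  by apply/funext => x; rewrite /= !patchE; congr (if _ then _ else _); apply/idP/idP; rewrite !inE.
have iGT : mu.-integrable setT (EFin \o (G \_ A)).
  by rewrite -restrict_EFin; apply/integrable_restrict => //; rewrite setTI.
transitivity (\int[pushforward mu phi]_x (EFin \o (G \_ A)) x)%E.
  by apply: eq_measure_integral => B mB _; exact/esym/lebesgue_measureN.
rewrite (integral_pushforward mphi mGA)//.
apply/integrableP; split; first exact: (measurableT_comp mGA mphi).
have /integrableP[_] := iGT; congr (_ < _)%E.
transitivity (\int[pushforward mu phi]_x `|(EFin \o (G \_ A)) x|)%E.
  by apply: eq_measure_integral => B mB _; exact/esym/lebesgue_measureN.
rewrite (ge0_integral_pushforward mphi)//.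
exact: measurableT_comp.
Qed.

(** The decreasing case is the increasing one for [- xi], after a reflection of the integral. *)
Lemma substitution_monotone xi (xi' : R -> R) c d (G : R -> R) : c <= d ->
  (forall s : R, is_derive s 1 xi (xi' s)) -> continuous xi' ->
  (forall s, c <= s <= d -> 0 < xi' s) \/ (forall s, c <= s <= d -> xi' s < 0) ->
  cwi (xi @` `[c, d]%classic) G ->
  (\int[mu]_(x in xi @` `[c, d]%classic) (G x)%:E =
   \int[mu]_(s in `[c, d]) (G (xi s) * `|xi' s|)%:E)%E.
Proof.
move=> cd dxi cxi' [pos|neg] cG.
  rewrite (substitution_increasing cd dxi)//; apply: eq_integral => s.
  by rewrite inE/= in_itv/= => /pos h; rewrite gtr0_norm.
have cxi : continuous xi by move=> s; exact: is_derive_continuous (dxi s).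
have kim : compact (xi @` `[c, d]%classic).
  by apply: continuous_compact; [exact: continuous_subspaceT|exact: segment_compact].
rewrite lebesgue_integral_opp//; last exact: compact_measurable.
have opp_im : [set x | (xi @` `[c, d]%classic) (- x)] = (fun s => - xi s) @` `[c, d]%classic.
  apply/seteqP; split=> x /= [s scd E]; exists s => //; first by rewrite E opprK.
  by rewrite -E opprK.
rewrite opp_im (@substitution_increasing (fun s => - xi s) (fun s => - xi' s) c d (fun x => G (- x)))//.
- apply: eq_integral => s; rewrite inE/= in_itv/= => /neg h.
  by rewrite opprK ltr0_norm.
- by move=> s; apply: cvgN; exact: cxi'.
- by move=> s /neg; rewrite oppr_gt0.
- apply: (cwi_comp cG); first by apply: cwiN; exact: cwi_id.
  by move=> _ [s scd <-]; exists s => //; rewrite opprK.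
Qed.

End Substitution.

(** * Boundary integrals in one chart *)

Section BoundaryIntegral.
Context {R : realType}.
Local Notation mu := (@lebesgue_measure R).
Local Notation plane := (@plane R).
Context (Omega : set (R * R)) (oO : open Omega) (kO : compact (closure Omega)).

Lemma chart_velocity_norm (ch : chart (R := R)) x : smooth (c_phi ch) ->
  enorm (velocity (chart_curve ch) x) = chart_speed ch x.
Proof.
move=> sp; rewrite -(enorm_rotate (c_al ch)).
have := @chart_curve_velocity R ch 0 x sp; under eq_fun do rewrite add0r.
by move=> ->; rewrite add0r /enorm/= expr1n.
Qed.

Lemma chart_curve_is_smooth (ch : chart (R := R)) : smooth (c_phi ch) -> smooth_curve (chart_curve ch).
Proof. by move=> sp; have := @chart_curve_smooth R ch 0 sp; under eq_fun do rewrite add0r. Qed.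

Lemma chart_speed_continuous (ch : chart (R := R)) : smooth (c_phi ch) -> continuous (chart_speed ch).
Proof.
move=> sp; have -> : chart_speed ch = fun x => enorm (velocity (chart_curve ch) x).
  by apply/funext => x; rewrite chart_velocity_norm.
by apply: speed_continuous; exact: chart_curve_is_smooth.
Qed.

Section OneChart.
Context (ch : chart (R := R)) (vch : valid_chart Omega ch).
Local Notation a := (c_x ch - c_r ch).
Local Notation b := (c_x ch + c_r ch).

Let gch : graph_chart Omega ch. Proof. by case: vch. Qed.
Let sp : smooth (c_phi ch). Proof. by case: gch. Qed.
Let r0 : 0 < c_r ch. Proof. by case: vch => _ /andP[]. Qed.
Let rR : c_r ch < c_R ch. Proof. by case: vch => _ /andP[]. Qed.

Definition boundary_chart := forall x, a <= x <= b -> boundary Omega (chart_curve ch x).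

Lemma chart_curve_boundary x : in_box ch (c_R ch) (chart_curve ch x) -> boundary Omega (chart_curve ch x).
Proof. by move=> bx; apply/(chart_boundary oO gch bx); rewrite chart_curveK. Qed.

(** The two kinds of valid chart. In the second the graph stays below the box, and the chart
    contributes 0 to every boundary integral. *)
Lemma valid_chart_cases : boundary_chart \/
  (forall x, cutoff ch (chart_curve ch x) = 0) /\ (forall q, boundary Omega q -> cutoff ch q = 0).
Proof.
have [_ _ [h|h]] := vch; [left=> x xab|right].
  have xr : `|x - c_x ch| <= c_r ch by rewrite ler_distl.
  apply: chart_curve_boundary; rewrite /in_box chart_curveK /=; split; last exact: h.
  exact: le_lt_trans rR.
split=> [x|q bq]; apply: cutoff0 => // -[].
  rewrite chart_curveK/= => _; rewrite ltr_distl => /andP[h1 _].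
  have := h x; move: rR h1; lra.
move=> h1 h2; have bx : in_box ch (c_R ch) q by split; exact: lt_trans rR.
have /(chart_boundary oO gch bx) E := bq; move: h2; rewrite -E ltr_distl => /andP[h3 _].
have := h (chart_coord ch q).1; move: rR h3; lra.
Qed.

Lemma boundary_chart_regular : boundary_chart -> regular_arc (boundary Omega) (chart_curve ch) a b.
Proof.
move=> bch; split; first exact: chart_curve_is_smooth.
  by move=> s r _ _ /(congr1 (chart_coord ch)); rewrite !chart_curveK => -[].
move=> s sab; split; first exact: bch.
apply/negP => /eqP v0; have := chart_velocity_norm s sp; rewrite v0 /enorm/= expr0n addr0 sqrtr0.
by move=> E; have := chart_speed_gt0 ch s; rewrite -E ltxx.
Qed.

Lemma cutoff_boundary q : boundary Omega q -> cutoff ch q != 0 ->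
  exists2 x, a <= x <= b & chart_curve ch x = q.
Proof.
move=> bq nz; have [h1 h2] : in_box ch (c_r ch) q.
  by apply: contrapT => /(cutoff0 r0) E; rewrite E eqxx in nz.
have bx : in_box ch (c_R ch) q by split; exact: lt_trans rR.
have /(chart_boundary oO gch bx) E := bq.
exists (chart_coord ch q).1; last exact: chart_curve_coord.
by rewrite -ler_distl ltW.
Qed.

Lemma cutoff_curve_support x : ~ (a <= x <= b) -> cutoff ch (chart_curve ch x) = 0.
Proof.
move=> nx; apply: cutoff0 => // -[]; rewrite chart_curveK/= => h _; apply: nx.
by rewrite -ler_distl ltW.
Qed.

Lemma chart_boundary_integral (sigma : {measure set plane -> \bar R}) f :
  is_arc_length (boundary Omega) sigma -> cwi (boundary Omega) f ->
  \int[sigma]_(q in boundary Omega) (cutoff ch q * f q) =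
  \int[mu]_(x in `[a, b]) (cutoff ch (chart_curve ch x) * f (chart_curve ch x) * chart_speed ch x).
Proof.
move=> sA cf; have [bch|[h1 h2]] := valid_chart_cases; last first.
  transitivity (\int[sigma]_(q in boundary Omega) (fun=> 0 : R) q).
    by apply: eq_Rintegral => q; rewrite inE => /h2 ->; rewrite mul0r.
  rewrite Rintegral_cst ?mul0r; last by apply: compact_plane_measurable; exact: compact_boundary.
  transitivity (\int[mu]_(x in `[a, b]) (fun=> 0 : R) x); first by rewrite Rintegral_cst ?mul0r.
  by apply: eq_Rintegral => x _; rewrite h1 !mul0r.
have ab : a <= b by move: r0; lra.
have cc : continuous (cutoff ch) by case: (@cutoff_continuous R ch).
have ck : cwi (boundary Omega) (fun q => cutoff ch q * f q).
  by apply: cwiM => //; exact: continuous_cwi.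
have := @arc_integral R _ (compact_boundary kO) sigma sA (chart_curve ch) a b ab
  (boundary_chart_regular bch) _ ck.
move=> E; transitivity (\int[sigma]_(q in chart_curve ch @` `[a, b]) (cutoff ch q * f q)).
  rewrite Rintegral_mkcond [RHS]Rintegral_mkcond; apply: eq_Rintegral => q _.
  rewrite !patchE; have [qa|nqa] := pselect ((chart_curve ch @` `[a, b]%classic) q).
    rewrite [in RHS]mem_set// mem_set//; case: qa => x /= + <-.
    by rewrite in_itv/=; exact: bch.
  rewrite [in RHS]memNset//; case: ifPn => //; rewrite inE => bq.
  have [->|nz] := eqVneq (cutoff ch q) 0; first by rewrite mul0r.
  by case: nqa; have [x xab <-] := cutoff_boundary bq nz; exists x => //=; rewrite in_itv.
rewrite E; apply: eq_Rintegral => x _; by rewrite chart_velocity_norm.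
Qed.

End OneChart.

End BoundaryIntegral.

(** * Existence of the arc length measure *)

Section ExistsArcLength.
Context {R : realType}.
Local Notation mu := (@lebesgue_measure R).
Local Notation plane := (@plane R).

(** The image under [g] of the measure of density [m] on the line; countable additivity is that of
    the integral over disjoint preimages. *)
Lemma exists_curve_measure (g : R -> R * R) (m : R -> R) : continuous g ->
  (forall x, 0 <= m x) -> mu.-integrable setT (EFin \o m) ->
  exists M : {measure set plane -> \bar R}, forall E, M E = (\int[mu]_(x in g @^-1` E) (m x)%:E)%E.
Proof.
move=> cg m0 im; pose nu (E : set plane) : \bar R := (\int[mu]_(x in g @^-1` E) (m x)%:E)%E.
have mg : measurable_fun setT (g : measurableTypeR R -> plane).
  have -> : g = (fun x => ((g x).1, (g x).2)) by apply/funext => x; rewrite -surjective_pairing.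
  have cg' : cwi setT g by exact: continuous_cwi.
  by apply: measurable_fun_pair; apply: continuous_measurable_fun; apply: cwi_setT;
    [apply: (cwi_comp (cwi_fst (A := setT)) cg')|apply: (cwi_comp (cwi_snd (A := setT)) cg')].
have nu0 : nu set0 = 0%E by rewrite /nu preimage_set0 integral_set0.
have nu_ge0 E : (0 <= nu E)%E by apply: integral_ge0 => x _; rewrite lee_fin.
have nu_sa : semi_sigma_additive nu.
  move=> F mF tF mUF; rewrite /nu preimage_bigcup.
  have mgF i : measurable (g @^-1` F i).
    by rewrite -[X in measurable X]setTI; exact: mg.
  rewrite integral_bigcup//; last 2 first.
  - apply/trivIsetP => i j _ _ ij; rewrite -preimage_setI.
    by move/trivIsetP : tF => /(_ i j I I ij) ->; rewrite preimage_set0.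
  - by apply: integrableS im => //; exact: bigcupT_measurable.
  apply: is_cvg_ereal_nneg_natsum_cond => n _ _.
  by apply: integral_ge0 => x _; rewrite lee_fin.
pose mixin := isMeasure.Build _ plane R nu nu0 nu_ge0 nu_sa.
pose M : {measure set plane -> \bar R} := HB.pack nu mixin.
by exists M.
Qed.

End ExistsArcLength.

Section ExistsArcLength.
Context {R : realType}.
Local Notation mu := (@lebesgue_measure R).
Local Notation plane := (@plane R).
Context (Omega : set (R * R)) (oO : open Omega) (kO : compact (closure Omega)).
Context (s : seq (R * R)) (c : R * R -> chart (R := R)) (vc : forall i, valid_chart Omega (c i)).
Context (tot : forall q, closure Omega q -> 0 < cutoff_sum s c q).

Local Notation bd := (boundary Omega).

(** A partition of unity on the closure, where [cutoff_sum] is positive. *)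
Definition weight i q : R := cutoff (c i) q / cutoff_sum s c q.
Definition arc_density i x : R := weight i (chart_curve (c i) x) * chart_speed (c i) x.

Let bdtot q : bd q -> 0 < cutoff_sum s c q.
Proof. by move=> [/tot]. Qed.

Lemma weight_ge0 i q : 0 <= weight i q.
Proof. by rewrite divr_ge0 ?cutoff_ge0// sumr_ge0// => j _; exact: cutoff_ge0. Qed.

Lemma arc_density_ge0 i x : 0 <= arc_density i x.
Proof. by rewrite mulr_ge0 ?weight_ge0// ltW// chart_speed_gt0. Qed.

Lemma weight_continuous i : cwi bd (weight i).
Proof.
apply: cwiM; first by apply: continuous_cwi; case: (@cutoff_continuous R (c i)).
apply: cwiV; first by move=> q /bdtot; exact: lt0r_neq0.
by apply: continuous_cwi; exact: cutoff_sum_continuous.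
Qed.

Lemma weight_sum q : bd q -> \sum_(i <- s) weight i q = 1.
Proof. by move=> bq; rewrite /weight -mulr_suml divff// lt0r_neq0// bdtot. Qed.

Lemma arc_density_support i x : arc_density i x != 0 -> bd (chart_curve (c i) x).
Proof.
move=> nz; have [bch|[h _]] := valid_chart_cases oO (vc i); last first.
  by rewrite /arc_density /weight h !mul0r eqxx in nz.
apply: bch; apply: contrapT => nx; move: nz.
by rewrite /arc_density /weight (cutoff_curve_support (vc i))// !mul0r eqxx.
Qed.

Lemma arc_density_continuous i (A : set R) : (forall x, A x -> bd (chart_curve (c i) x)) ->
  cwi A (arc_density i).
Proof.
have [gch _ _] := vc i; have [sp _] := gch.
move=> Abd.
have cg : cwi A (chart_curve (c i)).
  by apply: continuous_cwi; apply: curve_continuous; exact: chart_curve_is_smooth.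
have cs : cwi A (chart_speed (c i)) by apply: continuous_cwi; exact: chart_speed_continuous.
exact: (cwiM (cwi_comp (@weight_continuous i) cg Abd) cs).
Qed.

Lemma arc_density_integrable i : mu.-integrable setT (EFin \o arc_density i).
Proof.
have [bch|[h _]] := valid_chart_cases oO (vc i); last first.
  have -> : EFin \o arc_density i = cst 0%E; last exact: integrable0.
  by apply/funext => x /=; rewrite /arc_density /weight h !mul0r.
pose I : set R := `[c_x (c i) - c_r (c i), c_x (c i) + c_r (c i)]%classic.
have -> : EFin \o arc_density i = (EFin \o arc_density i) \_ I.
  apply/funext => x /=; rewrite patchE; case: ifPn => //; rewrite notin_setE => nx.
  rewrite /arc_density /weight (cutoff_curve_support (vc i)) ?mul0r//.
have mI : measurable (I : set (measurableTypeR R)) by exact: measurable_itv.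
apply/integrable_restrict => //; rewrite setTI; apply: cwi_itv_integrable.
by apply: arc_density_continuous => x; rewrite /= in_itv/=; exact: bch.
Qed.

Context (gamma : R -> R * R) (a b : R) (ab : a < b) (rg : regular_arc bd gamma a b).
Local Notation v := (fun r => enorm (velocity gamma r)).
Local Notation arc x y := (gamma @` `[x, y]%classic).

Let sg : smooth_curve gamma. Proof. by case: rg. Qed.
Let cg : continuous gamma. Proof. exact: curve_continuous. Qed.
Let gbd r : a <= r <= b -> bd (gamma r).
Proof. by move=> rab; have [_ _ H] := rg; case: (H r rab). Qed.

(** If [gamma s0] is in the box, then near [s0] the curve follows the graph and the chart abscissa
    [X] is a monotone change of parameter from [gamma] to [chart_curve]. If not, the cut-off
    vanishes along the curve near [s0] and both sides are 0. *)
Lemma arc_density_local i s0 : a <= s0 <= b ->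
  exists2 d, 0 < d & forall x y, a <= x -> x <= s0 -> s0 <= y -> y <= b -> s0 - d < x -> y < s0 + d ->
    (\int[mu]_(r in chart_curve (c i) @^-1` arc x y) (arc_density i r)%:E)%E =
    (\int[mu]_(r in `[x, y]) (weight i (gamma r) * v r)%:E)%E.
Proof.
move=> s0ab; set ch := c i.
have [gch /andP[r0 rR] _] := vc i; have [sp _] := gch.
pose X r := (chart_coord ch (gamma r)).1.
pose X' r := (rotate_axes (c_al ch) (velocity gamma r)).1.
have dX (r : R) : is_derive r 1 X (X' r) by have [] := curve_coord_derive (c_al ch) r sg.
have near_d (P : R -> Prop) : nbhs s0 P -> exists2 d, 0 < d & forall r, s0 - d < r < s0 + d -> P r.
  move=> /nbhs_ballP[d /= d0 Hd]; exists d => // r rd; apply: Hd.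
  by rewrite /ball/= distrC ltr_distl.
have cont_near (V : set (R * R)) : open V -> V (gamma s0) -> nbhs s0 (fun r => V (gamma r)).
  by move=> oV Vs; apply: cg; exact: open_nbhs_nbhs.
have [Rb|nRb] := pselect (in_box ch (c_R ch) (gamma s0)); last first.
  (* Outside the box some chart coordinate is at least [c_R] from its centre, hence farther than
     [c_r], and this persists near [s0]. *)
  have [d d0 Hd] : exists2 d, 0 < d & forall r, s0 - d < r < s0 + d -> cutoff ch (gamma r) = 0.
    apply: near_d.
    have H (f : R * R -> R) w : cwi setT f -> open [set q | c_r ch < `|f q - w|].
      move=> cf; have -> : [set q | c_r ch < `|f q - w|] = (fun q => `|f q - w|) @^-1` [set y | c_r ch < y] by [].
      apply: open_comp; last exact: open_gt.
      move=> q _; apply: cvg_norm; apply: cvgB; last exact: cvg_cst.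
      exact: (cwi_setT cf).
    have cc : cwi setT (chart_coord ch) by apply: continuous_cwi; exact: chart_coord_continuous.
    have o1 := H _ (c_x ch) (cwi_comp (cwi_fst (A := setT)) cc (fun _ _ => I)).
    have o2 := H _ (c_y ch) (cwi_comp (cwi_snd (A := setT)) cc (fun _ _ => I)).
    have : nbhs s0 (fun r => [set q | c_r ch < `|(chart_coord ch q).1 - c_x ch|] (gamma r) \/
         [set q | c_r ch < `|(chart_coord ch q).2 - c_y ch|] (gamma r)).
      apply: (cont_near ([set q | c_r ch < `|(chart_coord ch q).1 - c_x ch|] `|`
        [set q | c_r ch < `|(chart_coord ch q).2 - c_y ch|])); first exact: openU.
      have [h1|h1] := ltP `|(chart_coord ch (gamma s0)).1 - c_x ch| (c_R ch).
        right; apply: lt_le_trans rR _; rewrite leNgt; apply/negP => h2; exact: nRb.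
      by left; exact: lt_le_trans rR h1.
    apply: filterS => r h; apply: cutoff0 => // -[b1 b2].
    by case: h => /=; rewrite ltNge => /negP; apply; exact: ltW.
  exists d; [exact: d0|move=> x y ax xs sy yb xd yd].
  have z r : x <= r <= y -> cutoff ch (gamma r) = 0.
    by move=> /andP[xr ry]; apply: Hd; rewrite (lt_le_trans xd xr) (le_lt_trans ry yd).
  rewrite [LHS]integral0_eq; last first.
    move=> r [r' /= /[!in_itv]/= r'xy E]; rewrite /arc_density /weight -/ch -E z// !mul0r.
    by [].
  rewrite [RHS]integral0_eq// => r /=; rewrite in_itv/= => rxy.
  by rewrite /weight -/ch z// !mul0r.
(* The derivative of the ordinate is the slope times [X']; if [X'] vanished, so would the velocity,
   against regularity. *)
have X'0 : X' s0 != 0.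
  have [d d0 Hd] := near_d _ (cont_near _ (@open_in_box R ch (c_R ch)) Rb).
  apply/negP => /eqP X0.
  have [_ dY] := curve_coord_derive (c_al ch) s0 sg.
  have dphi : is_derive s0 1 (fun r => c_phi ch (X r)) (chart_slope ch (X s0) * X' s0).
    have dp := smooth_is_derive (X s0) sp; have dXs := dX s0.
    exact: is_derive1_comp.
  have Y0 := derive_agree ab s0ab d0 dY dphi.
  have : (rotate_axes (c_al ch) (velocity gamma s0)).2 = chart_slope ch (X s0) * X' s0.
    apply: Y0 => r rab rd; apply/esym.
    have bxr : in_box ch (c_R ch) (gamma r) by apply: Hd; move: rd; rewrite ltr_distl.
    by have /(chart_boundary oO gch bxr) := gbd rab.
  rewrite X0 mulr0 => Y'0.
  have [_ _ /(_ _ s0ab)[_ /negP]] := rg; apply.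
  rewrite -[velocity gamma s0](rotate_axesK (c_al ch)) [rotate_axes (c_al ch) _]surjective_pairing.
  by rewrite -/(X' s0) X0 Y'0 rotate_axesNE/= !mulr0 subr0 addr0.
have cX' : continuous X'.
  have [s1 s2] := sg; have c1 := smooth_continuous (smooth_derive s1).
  have c2 := smooth_continuous (smooth_derive s2).
  by apply: cwi_setT; apply: cwiD; apply: cwiM; (try exact: cwi_cst); exact: continuous_cwi.
have [d d0 Hd] : exists2 d, 0 < d & forall r, s0 - d < r < s0 + d ->
    in_box ch (c_R ch) (gamma r) /\ 0 < X' s0 * X' r.
  apply: near_d; apply: filterI; first by apply: cont_near => //; exact: open_in_box.
  have : X' s0 * X' r @[r --> s0] --> X' s0 * X' s0 by apply: cvgM; [exact: cvg_cst|exact: cX'].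
  by move=> /cvgr_gt; apply; rewrite -expr2 exprn_even_gt0.
exists d; [exact: d0|move=> x y ax xs sy yb xd yd].
have xy := le_trans xs sy.
have inD r : x <= r <= y -> in_box ch (c_R ch) (gamma r) /\ 0 < X' s0 * X' r.
  by move=> /andP[xr ry]; apply: Hd; rewrite (lt_le_trans xd xr) (le_lt_trans ry yd).
have inab r : x <= r <= y -> a <= r <= b.
  by move=> /andP[xr ry]; rewrite (le_trans ax xr) (le_trans ry yb).
have gE r : x <= r <= y -> chart_curve ch (X r) = gamma r.
  move=> rxy; have [bxr _] := inD r rxy.
  by apply: chart_curve_coord; apply/(chart_boundary oO gch bxr); exact/gbd/inab.
have -> : chart_curve ch @^-1` arc x y = X @` `[x, y]%classic.
  apply/seteqP; split=> z /= [r /[!in_itv]/= rxy E].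
    by exists r => //; rewrite /X E chart_curveK.
  by exists r => //; rewrite -E gE.
rewrite (@substitution_monotone R X X' x y (arc_density i) xy dX cX'); last 2 first.
- have [p|n|z] := ltgtP (X' s0) 0; last by rewrite z eqxx in X'0.
    by right=> r /inD[_]; rewrite nmulr_rgt0.
  by left=> r /inD[_]; rewrite pmulr_rgt0.
- apply: arc_density_continuous => _ [r /= /[!in_itv]/= rxy <-].
  by rewrite -/ch gE//; exact/gbd/inab.
have slope_near r : x <= r <= y ->
    (rotate_axes (c_al ch) (velocity gamma r)).2 = chart_slope ch (X r) * X' r.
  move=> rxy; have [_ dY] := curve_coord_derive (c_al ch) r sg.
  have dphi : is_derive r 1 (fun r => c_phi ch (X r)) (chart_slope ch (X r) * X' r).
    have dp := smooth_is_derive (X r) sp; have dXs := dX r.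
    exact: is_derive1_comp.
  have [e e0 He] : exists2 e, 0 < e & forall w, `|w - r| < e -> s0 - d < w < s0 + d.
    have : nbhs r `]s0 - d, s0 + d[%classic.
      apply: open_nbhs_nbhs; split; first exact: interval_open.
      by case/andP: rxy => xr ry; rewrite /= in_itv/= (lt_le_trans xd xr) (le_lt_trans ry yd).
    move=> /nbhs_ballP[e /= e0 He]; exists e => // w wr.
    by have := He w; rewrite /ball/= distrC in_itv/=; apply.
  apply: (derive_agree ab (inab r rxy) e0 dY dphi) => w wab /He /Hd[bxw _].
  by apply/esym; have /(chart_boundary oO gch bxw) := gbd wab.
apply: eq_integral => r; rewrite inE/= in_itv/= => rxy; congr EFin.
rewrite /arc_density -/ch gE// -mulrA; congr (_ * _).
(* In chart axes the squared speed of the curve is [(1 + slope ^ 2) * X' ^ 2]. *)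
rewrite -(enorm_rotate (c_al ch)) /enorm slope_near// -/(X' r) exprMn.
rewrite -[X in X + _]mul1r -mulrDl sqrtrM ?addr_ge0// ?sqr_ge0//.
by rewrite sqrtr_sqr.
Qed.

End ExistsArcLength.

Lemma Rintegral_sum_seq {R : realType} d (T : measurableType d) (nu : {measure set T -> \bar R})
    (D : set T) (I : Type) (r : seq I) (F : I -> T -> R) : measurable D ->
  (forall i, nu.-integrable D (EFin \o F i)) ->
  \int[nu]_(x in D) (\sum_(i <- r) F i x) = \sum_(i <- r) \int[nu]_(x in D) F i x /\
  nu.-integrable D (EFin \o (fun x => \sum_(i <- r) F i x)).
Proof.
move=> mD iF; elim: r => [|i r [IH1 IH2]].
  under eq_fun do rewrite big_nil.
  split; last by have := integrable0 nu D.
  by rewrite big_nil Rintegral_cst// mul0r.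
have E : (fun x => \sum_(j <- i :: r) F j x) = (fun x => F i x + \sum_(j <- r) F j x).
  by apply/funext => x; rewrite big_cons.
rewrite E big_cons; split; first by rewrite RintegralD// IH1.
have := integrableD mD (iF i) IH2; apply: eq_integrable => // x _.
Qed.

Section ArcLength.
Context {R : realType}.
Local Notation mu := (@lebesgue_measure R).
Local Notation plane := (@plane R).
Context (Omega : set (R * R)) (oO : open Omega) (kO : compact (closure Omega)).
Context (sO : smooth_boundary Omega) (neO : Omega !=set0).
Local Notation bd := (boundary Omega).

Lemma common_radius (I : eqType) (r : seq I) (P : I -> R -> Prop) :
  (forall i d d', d' <= d -> P i d -> P i d') -> (forall i, exists2 d, 0 < d & P i d) ->
  exists2 d, 0 < d & forall i, i \in r -> P i d.
Proof.
move=> mono ex; elim: r => [|i r [d d0 IH]]; first by exists 1.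
have [e e0 Pe] := ex i; exists (Num.min d e); first by rewrite lt_min d0.
move=> j; rewrite inE => /predU1P[->|/IH]; first by apply: mono Pe; rewrite ge_min lexx orbT.
by apply: mono; rewrite ge_min lexx.
Qed.

(** The measure is the sum over the atlas of the images of the weighted length densities of the
    charts. Points have measure 0 because chart curves are injective; on a short arc the weights sum
    to 1 by [arc_density_local], and [interval_chain] reaches all arcs. *)
Lemma exists_arc_length : exists sigma : {measure set plane -> \bar R}, is_arc_length bd sigma.
Proof.
have [s [c [vc tot]]] := exists_atlas oO kO sO neO.
have ccurve i : continuous (chart_curve (c i)).
  have [[sp _] _ _] := vc i.
  by apply: curve_continuous; exact: chart_curve_is_smooth.
have [M HM] := choice (fun i => exists_curve_measure (ccurve i) (@arc_density_ge0 _ s c i)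
  (arc_density_integrable oO vc tot i)).
pose sigma : {measure set plane -> \bar R} := msum (fun n => M (nth (0, 0) s n)) (size s).
have sigmaE E : sigma E = (\sum_(i <- s) M i E)%E.
  by rewrite (big_nth (0, 0)) big_mkord.
have mpt (q : R * R) : measurable ([set q] : set plane).
  by apply: compact_plane_measurable; exact: compact_set1.
have sigma_pt q : sigma [set q] = 0%E.
  rewrite sigmaE big1// => i _; rewrite HM; apply/eqP; rewrite eq_le; apply/andP; split; last first.
    by apply: integral_ge0 => x _; rewrite lee_fin arc_density_ge0.
  have sub : chart_curve (c i) @^-1` [set q] `<=` [set (chart_coord (c i) q).1].
    by move=> x E; change (x = (chart_coord (c i) q).1); rewrite -(E : chart_curve (c i) x = q) chart_curveK.
  apply: (@le_trans _ _ (\int[mu]_(x in [set (chart_coord (c i) q).1]) (arc_density s c i x)%:E)%E).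
    apply: ge0_subset_integral => //=.
    - rewrite -[X in measurable X]setTI; have : measurable_fun setT (chart_curve (c i) : measurableTypeR R -> plane).
        have -> : chart_curve (c i) = (fun x => ((chart_curve (c i) x).1, (chart_curve (c i) x).2)).
          by apply/funext => x; rewrite -surjective_pairing.
        have cg' : cwi setT (chart_curve (c i)) by exact: continuous_cwi.
        by apply: measurable_fun_pair; apply: continuous_measurable_fun; apply: cwi_setT;
          [apply: (cwi_comp (cwi_fst (A := setT)) cg')|apply: (cwi_comp (cwi_snd (A := setT)) cg')].
      by apply => //; exact: mpt.
    - apply: measurable_funTS; apply/measurable_EFinP.
      have /measurable_int := arc_density_integrable oO vc tot i.
      by move/measurable_EFinP.
    - by move=> x _; rewrite lee_fin arc_density_ge0.
  by rewrite integral_set1.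
exists sigma; split.
  rewrite sigmaE big1// => i _; rewrite HM; apply: integral0_eq => x /= nbx.
  congr EFin; apply/eqP; apply: contrapT => /negP nz; apply: nbx.
  exact: (arc_density_support oO vc nz).
move=> gamma a b; rewrite le_eqVlt => /predU1P[<- _|ab rg].
  by rewrite set_itv1 image_set1 sigma_pt integral_set1.
have [sg injg gv] := rg.
have cg : continuous gamma by exact: curve_continuous.
have cv : cwi setT (fun r => enorm (velocity gamma r)) by apply: continuous_cwi; exact: speed_continuous.
have cvI x y : cwi `[x, y]%classic (fun r => enorm (velocity gamma r)) by exact: cwi_sub cv.
rewrite EFin_Rintegral//.
pose P x y := sigma (gamma @` `[x, y]%classic) = (\int[mu]_(r in `[x, y]) enorm (velocity gamma r))%:E.
have marc x y : measurable (gamma @` `[x, y]%classic : set plane).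
  apply: compact_plane_measurable; apply: continuous_compact; last exact: segment_compact.
  exact: continuous_subspaceT.
apply: (@interval_chain R P a b (ltW ab)).
  move=> x y z ax xy yz zb Pxy Pyz.
  have [|E2 E1 d1 d2] := @arc_split _ gamma x y z xy yz.
    move=> p q /andP[xp pz] /andP[xq qz]; apply: injg.
      by rewrite (le_trans ax xp) (le_trans pz zb).
    by rewrite (le_trans ax xq) (le_trans qz zb).
  have mD : measurable (gamma @` `[y, z]%classic `\ gamma y : set plane).
    by apply: measurableD => //; exact: marc.
  have dj1 := eqP d1; have dj2 := eqP d2.
  have EU : sigma (gamma @` `[x, z]%classic) = (sigma (gamma @` `[x, y]%classic) + sigma (gamma @` `[y, z]%classic `\ gamma y))%E.
    by rewrite E2; exact: (measureU sigma (marc _ _) mD dj1).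
  rewrite /P EU.
  have : sigma (gamma @` `[y, z]%classic `\ gamma y) = sigma (gamma @` `[y, z]%classic).
    have E : sigma (gamma @` `[y, z]%classic) = (sigma [set gamma y] + sigma (gamma @` `[y, z]%classic `\ gamma y))%E.
      by rewrite {1}E1; exact: (measureU sigma (mpt _) mD dj2).
    by rewrite E sigma_pt add0e.
  by move=> ->; rewrite Pxy Pyz -EFinD (Rintegral_itv_cat xy yz (@cvI x z)).
move=> s0 s0ab.
pose Q i d := forall x y, a <= x -> x <= s0 -> s0 <= y -> y <= b -> s0 - d < x -> y < s0 + d ->
    (\int[mu]_(r in chart_curve (c i) @^-1` (gamma @` `[x, y]%classic)) (arc_density s c i r)%:E)%E =
    (\int[mu]_(r in `[x, y]) (weight s c i (gamma r) * enorm (velocity gamma r))%:E)%E.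
have [|i|d d0 Hd] := @common_radius _ s Q.
- move=> i d d' dd' H x y h1 h2 h3 h4 h5 h6; apply: H => //; lra.
- exact: (arc_density_local oO vc tot ab rg i s0ab).
exists d => // x y ax xs sy yb xd yd.
have inab r : `[x, y]%classic r -> bd (gamma r).
  rewrite /= in_itv/= => /andP[xr ry].
  by have [|] := gv r; first by rewrite (le_trans ax xr) (le_trans ry yb).
have cw i : cwi `[x, y]%classic (fun r => weight s c i (gamma r) * enorm (velocity gamma r)).
  apply: cwiM => //; apply: (cwi_comp (weight_continuous tot (i := i))) => //.
  exact: continuous_cwi.
have iw i := cwi_itv_integrable (cw i).
rewrite /P sigmaE.
transitivity (\sum_(i <- s) (\int[mu]_(r in `[x, y]) (weight s c i (gamma r) * enorm (velocity gamma r)))%:E)%E.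
  by apply: eq_big_seq => i /Hd Qi; rewrite HM Qi// EFin_Rintegral.
rewrite sumEFin; congr EFin.
have [<- _] := @Rintegral_sum_seq R _ _ mu `[x, y]%classic _ s _ (measurable_itv _) iw.
apply: eq_Rintegral => r.
rewrite inE => /inab bg.
by rewrite -mulr_suml (weight_sum tot bg) mul1r.
Qed.

Lemma arc_lengthP : is_arc_length bd (arc_length bd).
Proof.
rewrite /arc_length; case: pselect => [H|nH]; first exact: (projT2 (cid H)).
by case: nH; exact: exists_arc_length.
Qed.

End ArcLength.

(** * The divergence theorem *)

Section DivergenceTheorem.
Context {R : realType}.
Local Notation mu := (@lebesgue_measure R).
Local Notation plane := (@plane R).
Local Notation mu2 := (mu \x mu)%E.
Context (Omega : set (R * R)) (oO : open Omega) (kO : compact (closure Omega)).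
Context (sO : smooth_boundary Omega) (neO : Omega !=set0).
Local Notation bd := (boundary Omega).
Local Notation sigma := (arc_length bd).

Let sA : is_arc_length bd sigma. Proof. exact: arc_lengthP. Qed.
Let kbd : compact bd. Proof. exact: compact_boundary. Qed.
Let mbd : measurable (bd : set plane). Proof. exact: compact_plane_measurable. Qed.

Lemma outward_normal_continuous : cwi bd (outward_normal Omega).
Proof.
apply: cwi_local => q bq; have [cq _] := bq.
have [ch [gch /andP[r0 rR] _] bxq] := exists_chart oO sO cq.
have [sp _] := gch.
exists (in_box ch (c_R ch)); split; [exact: open_in_box|exact: in_box_le (ltW rR) bxq|].
apply: (@cwi_eq _ _ _ (fun q' => chart_normal ch (chart_coord ch q').1)).
  by move=> q' [bq' bx']; rewrite (outward_normalE oO gch bx' bq').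
have cs : continuous (chart_speed ch) by exact: chart_speed_continuous.
have cX : cwi (bd `&` in_box ch (c_R ch)) (fun q => (chart_coord ch q).1).
  apply: (cwi_comp (cwi_fst (A := setT))) => //; apply: continuous_cwi.
  exact: chart_coord_continuous.
have cn : cwi setT (chart_normal ch).
  have cV : cwi setT (fun x => (chart_speed ch x)^-1).
    by apply: cwiV; [move=> x _; rewrite gt_eqF// chart_speed_gt0|exact: continuous_cwi].
  have cr : cwi setT (@rotate_axes R (- c_al ch)) by apply: continuous_cwi; exact: rotate_axes_continuous.
  apply: (cwi_comp cr) => //; apply: cwi_pair; last exact: cwiN.
  apply: cwiM => //; apply: continuous_cwi; apply: smooth_continuous; exact: smooth_derive.
exact: (cwi_comp cn cX).
Qed.

(** Finiteness of the total length is only derived later; here the cut-off confines the integrand to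
    one arc, whose length is finite. *)
Lemma cutoff_integrable ch f : valid_chart Omega ch -> cwi bd f ->
  sigma.-integrable bd (EFin \o (fun q => cutoff ch q * f q)).
Proof.
move=> vch cf; have [_ /andP[r0 _] _] := vch; have [bch|[_ h2]] := valid_chart_cases oO vch; last first.
  have := integrable0 sigma bd; apply: eq_integrable => // q; rewrite inE => /h2 /= ->.
  by rewrite mul0r.
set a := c_x ch - c_r ch; set b := c_x ch + c_r ch.
have ab : a <= b by rewrite /a /b; lra.
have rg := boundary_chart_regular vch bch.
have cc : continuous (cutoff ch) by case: (@cutoff_continuous R ch).
have ck : cwi bd (fun q => cutoff ch q * f q) by apply: cwiM => //; exact: continuous_cwi.
pose G : set (R * R) := chart_curve ch @` `[a, b]%classic.
have Gbd : G `<=` bd by move=> _ [x /= /[!in_itv]/= xab <-]; exact: bch.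
have kG : compact G by exact: (compact_arc rg).
have mG : measurable (G : set plane) by exact: compact_plane_measurable.
have sG : (sigma G < +oo)%E by rewrite (sub_arc_length sA rg)// ltry.
have iG : sigma.-integrable G (EFin \o (fun q => cutoff ch q * f q)).
  by apply: cwi_integrable_plane => //; exact: cwi_sub ck.
have := iG; rewrite (integrable_mkcond _ mG) => iG'.
rewrite (integrable_mkcond _ mbd); move: iG'; apply: eq_integrable => // q _.
rewrite !patchE; have [qG|nqG] := boolP (q \in G).
  by rewrite mem_set//; apply: Gbd; rewrite -inE.
case: ifPn => //; rewrite inE => bq /=.
have [->|nz] := eqVneq (cutoff ch q) 0; first by rewrite mul0r.
have [x xab E] := cutoff_boundary oO vch bq nz.
by move: nqG; rewrite notin_setE; case; exists x => //=; rewrite in_itv.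
Qed.

(** [f] is split as the sum of [cutoff * (f / cutoff_sum)], which turns a boundary integral into
    finitely many integrals over intervals. Integrability, finite length and Fubini on the boundary
    all pass through this form. *)
Lemma boundary_integral_atlas (s : seq (R * R)) (c : R * R -> chart (R := R)) f :
  (forall i, valid_chart Omega (c i)) -> (forall q, closure Omega q -> 0 < cutoff_sum s c q) ->
  cwi bd f ->
  \int[sigma]_(q in bd) f q = \sum_(i <- s) \int[mu]_(x in `[c_x (c i) - c_r (c i), c_x (c i) + c_r (c i)])
    (f (chart_curve (c i) x) * arc_density s c i x) /\
  sigma.-integrable bd (EFin \o f).
Proof.
move=> vc tot cf.
have cg : cwi bd (fun q => f q / cutoff_sum s c q).
  apply: cwiM => //; apply: cwiV; first by move=> q [/tot h _]; rewrite gt_eqF.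
  by apply: continuous_cwi; exact: cutoff_sum_continuous.
have fE q : bd q -> f q = \sum_(i <- s) (cutoff (c i) q * (f q / cutoff_sum s c q)).
  by move=> [/tot h _]; rewrite -mulr_suml -/(cutoff_sum s c q) mulrCA divff ?mulr1// gt_eqF.
have [S1 S2] := Rintegral_sum_seq s mbd (fun i => cutoff_integrable (vc i) cg).
split; last by apply: eq_integrable S2 => // q; rewrite inE /= => /fE <-.
transitivity (\int[sigma]_(q in bd) \sum_(i <- s) (cutoff (c i) q * (f q / cutoff_sum s c q))).
  by apply: eq_Rintegral => q; rewrite inE => /fE.
rewrite S1; apply: eq_bigr => i _.
rewrite (chart_boundary_integral oO kO (vc i) sA cg); apply: eq_Rintegral => x _.
by rewrite /arc_density /weight; ring.
Qed.

Lemma boundary_integrable f : cwi bd f -> sigma.-integrable bd (EFin \o f).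
Proof.
have [s [c [vc tot]]] := exists_atlas oO kO sO neO.
by move=> cf; have [] := boundary_integral_atlas vc tot cf.
Qed.

Lemma boundary_length_lty : (sigma bd < +oo)%E.
Proof.
have /integrableP[_] := boundary_integrable (@cwi_cst _ _ bd (1 : R)).
by under eq_integral do rewrite /= normr1; rewrite integral_cst// mul1e.
Qed.

(** The theorem in one chart is applied to [h = g / S], where [S] is the sum of the cut-offs, so
    that the products [cutoff * h] sum to [g]. *)
Lemma divergence_theorem g gx gy : C1bar Omega g gx gy ->
  \int[mu2]_(q in Omega) gx q = \int[sigma]_(q in bd) (g q * (outward_normal Omega q).1) /\
  \int[mu2]_(q in Omega) gy q = \int[sigma]_(q in bd) (g q * (outward_normal Omega q).2).
Proof.
move=> [cg cgx cgy pg].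
have [s [c [vc tot]]] := exists_atlas oO kO sO neO.
have mO : measurable (Omega : set plane) by exact: open_plane_measurable.
pose S := cutoff_sum s c.
pose Sx q := \sum_(i <- s) cutoffx (c i) q; pose Sy q := \sum_(i <- s) cutoffy (c i) q.
have S0 q : closure Omega q -> S q != 0 by move=> /tot; exact: lt0r_neq0.
have subc : Omega `<=` closure Omega by exact: subset_closure.
have cS : cwi (closure Omega) S by apply: continuous_cwi; exact: cutoff_sum_continuous.
have cSx : cwi (closure Omega) Sx.
  by apply: cwi_sum => i; apply: continuous_cwi; case: (@cutoff_continuous R (c i)).
have cSy : cwi (closure Omega) Sy.
  by apply: cwi_sum => i; apply: continuous_cwi; case: (@cutoff_continuous R (c i)).
have cV : cwi (closure Omega) (fun q => (S q)^-1) by exact: cwiV.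
have dS e (fx : R * R -> R * R -> R) (q : R * R) :
    (forall i, is_derive q e (cutoff (c i)) (fx i q)) ->
    is_derive q e S (\sum_(i <- s) fx i q).
  move=> H; rewrite /S /cutoff_sum; elim: (s) => [|i r IH].
    under eq_fun do rewrite big_nil; rewrite big_nil; exact: is_derive_cst.
  under eq_fun do rewrite big_cons; rewrite big_cons; exact: is_deriveD.
pose h q := g q / S q.
(* The quotient rule for [h], arranged so that [Sx * h + S * hx] is visibly [gx]. *)
pose hx q := (gx q - h q * Sx q) / S q; pose hy q := (gy q - h q * Sy q) / S q.
have ch : cwi (closure Omega) h by exact: cwiM.
have Ch : C1bar Omega h hx hy.
  split => //; [by apply: cwiM => //; apply: cwiB => //; exact: cwiM|by apply: cwiM => //; apply: cwiB => //; exact: cwiM|].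
  have quot (q e : R * R) (dg ds : R) : Omega q -> is_derive q e g dg -> is_derive q e S ds ->
      is_derive q e h ((dg - h q * ds) / S q).
    move=> Oq d1 d2; apply: is_derive_of_line.
    have l1 := is_derive_line0 d1; have l2 := is_derive_line0 d2.
    have nz : (fun r : R => S (q + r *: e)) 0 != 0 by rewrite /= scale0r addr0 S0//; exact: subc.
    have l3 : is_derive (0 : R) 1 (fun r : R => (S (q + r *: e))^-1) _ := is_deriveV nz l2.
    have l4 : is_derive (0 : R) 1 (fun r : R => g (q + r *: e) * (S (q + r *: e))^-1) _ := is_deriveM l1 l3.
    apply: is_derive_eq l4 _; rewrite /= scale0r addr0 /GRing.scale/= /h; field.
    by apply: S0; exact: subc.
  move=> q Oq; have [d1 d2] := pg q Oq; split.
    apply: quot => //; apply: (dS (1, 0) (fun i => cutoffx (c i))) => i.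
    by have [] := @cutoff_partials R (c i) q I.
  apply: quot => //; apply: (dS (0, 1) (fun i => cutoffy (c i))) => i.
  by have [] := @cutoff_partials R (c i) q I.
have cn := outward_normal_continuous.
have cn1 : cwi bd (fun q => (outward_normal Omega q).1) by apply: (cwi_comp (cwi_fst (A := setT)) cn).
have cn2 : cwi bd (fun q => (outward_normal Omega q).2) by apply: (cwi_comp (cwi_snd (A := setT)) cn).
have bdc : bd `<=` closure Omega by move=> q [].
have chb : cwi bd h by exact: cwi_sub ch.
(* The summation over charts, common to both components: [cx] stands for the derivative of a
   cut-off, [nn] for a component of the normal and [nc] for its expression in a chart. *)
have core (hxx Sxx gxx : R * R -> R) (cx : R * R -> R * R -> R) (nn : R * R -> R)
    (nc : R * R -> R -> R) :
    cwi (closure Omega) hxx -> (forall i, continuous (cx i)) ->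
    cwi bd nn -> (forall q, Omega q -> gxx q = \sum_(i <- s) (cx i q * h q + cutoff (c i) q * hxx q)) ->
    (forall i x, cutoff (c i) (chart_curve (c i) x) != 0 -> nn (chart_curve (c i) x) = nc i x) ->
    (forall i, \int[mu2]_(q in Omega) (cx i q * h q + cutoff (c i) q * hxx q) =
       \int[mu]_(x in `[c_x (c i) - c_r (c i), c_x (c i) + c_r (c i)])
         (cutoff (c i) (chart_curve (c i) x) * h (chart_curve (c i) x) * (nc i x * chart_speed (c i) x))) ->
    \int[mu2]_(q in Omega) gxx q = \int[sigma]_(q in bd) (g q * nn q).
  move=> chx ccx cnn gE nE loc.
  have [S1 _] := @Rintegral_sum_seq R _ _ mu2 Omega _ s (fun i q => cx i q * h q + cutoff (c i) q * hxx q) mO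
    (fun i => cwi_domain_integrable oO kO (cwiD (cwiM (continuous_cwi (ccx i)) ch)
      (cwiM (continuous_cwi (let: And3 cc _ _ := @cutoff_continuous R (c i) in cc)) chx))).
  have cgn : cwi bd (fun q => g q * nn q) by apply: cwiM => //; exact: cwi_sub cg.
  have [-> _] := boundary_integral_atlas vc tot cgn.
  transitivity (\int[mu2]_(q in Omega) \sum_(i <- s) (cx i q * h q + cutoff (c i) q * hxx q)).
    by apply: eq_Rintegral => q; rewrite inE => /gE.
  rewrite S1; apply: eq_bigr => i _; rewrite loc; apply: eq_Rintegral => x _.
  have [z|nz] := eqVneq (cutoff (c i) (chart_curve (c i) x)) 0.
    by rewrite /arc_density /weight z !mul0r mulr0.
  by rewrite nE// /arc_density /weight /h /S; ring.
have nE i x : cutoff (c i) (chart_curve (c i) x) != 0 ->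
    outward_normal Omega (chart_curve (c i) x) = chart_normal (c i) x.
  move=> nz; have [gch /andP[r0 rR] _] := vc i.
  have bx : in_box (c i) (c_R (c i)) (chart_curve (c i) x).
    apply: (in_box_le (ltW rR)); apply: contrapT => /(cutoff0 r0) E.
    by rewrite E eqxx in nz.
  by rewrite (outward_normalE oO gch bx (chart_curve_boundary oO (vc i) bx)) chart_curveK.
split.
  apply: (core hx Sx gx (fun i => cutoffx (c i)) (fun q => (outward_normal Omega q).1) (fun i x => (chart_normal (c i) x).1)) => //.
  - by apply: cwiM => //; apply: cwiB => //; exact: cwiM.
  - by move=> i; case: (@cutoff_continuous R (c i)).
  - move=> q Oq; rewrite big_split/= -!mulr_suml -/(cutoff_sum s c q) -/(S q) -/(Sx q) /hx.
    by field; apply: S0; exact: subc.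
  - by move=> i x nz; rewrite nE.
  - by move=> i; have [] := local_divergence oO kO (vc i) Ch.
apply: (core hy Sy gy (fun i => cutoffy (c i)) (fun q => (outward_normal Omega q).2) (fun i x => (chart_normal (c i) x).2)) => //.
- by apply: cwiM => //; apply: cwiB => //; exact: cwiM.
- by move=> i; case: (@cutoff_continuous R (c i)).
- move=> q Oq; rewrite big_split/= -!mulr_suml -/(cutoff_sum s c q) -/(S q) -/(Sy q) /hy.
  by field; apply: S0; exact: subc.
- by move=> i x nz; rewrite nE.
- by move=> i; have [] := local_divergence oO kO (vc i) Ch.
Qed.

End DivergenceTheorem.

(** * Functions of class C^1 up to the boundary of a space-time cylinder *)

Section SpaceTimeC1.
Context {R : realType}.
Implicit Types (Omega : set (R * R)) (D : set (R * R * R)) (f g : R * R * R -> R).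

Definition C1c D f f1 f2 f3 := [/\ cwi (closure D) f, cwi (closure D) f1, cwi (closure D) f2,
  cwi (closure D) f3 & has_partials D f f1 f2 f3].

Definition cylinder Omega : set (R * R * R) := Omega `*` setT.

Lemma open_cylinder Omega : open Omega -> open (cylinder Omega).
Proof.
move=> oO; have -> : cylinder Omega = fst @^-1` Omega by apply/seteqP; split => z //= [].
by apply: open_comp => // z _; exact: cvg_fst.
Qed.

Lemma closure_cylinder Omega : closure (cylinder Omega) = cylinder (closure Omega).
Proof.
apply/seteqP; split => -[q t] /=.
  move=> cz; split => // B nB.
  have [[q' t'] [[Oq' _] [Bq' _]]] := cz (B `*` setT) ltac:(by exists (B, setT) => //; split => //; exact: filterT).
  by exists q'.
move=> [cq _] B [[B1 B2] /= [n1 n2] sub].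
have [q' [Oq' Bq']] := cq _ n1.
exists (q', t); split => //; apply: sub; split => //=; exact: nbhs_singleton n2.
Qed.

Lemma Ck_closure1 D f : Ck_closure 1 D f -> exists f1 f2 f3, C1c D f f1 f2 f3.
Proof.
move=> [cf H].
have [f1 [d1 [c1 _]]] := H dir_x ltac:(by rewrite inE eqxx).
have [f2 [d2 [c2 _]]] := H dir_y ltac:(by rewrite !inE eqxx orbT).
have [f3 [d3 [c3 _]]] := H dir_t ltac:(by rewrite !inE eqxx !orbT).
exists f1, f2, f3; split; [exact/cwiP|exact/cwiP|exact/cwiP|exact/cwiP|].
by move=> z Dz; split; [exact: d1|exact: d2|exact: d3].
Qed.

Lemma Ck_closure2 D f : Ck_closure 2 D f -> exists f1 f2 f3,
  [/\ C1c D f f1 f2 f3, Ck_closure 1 D f1, Ck_closure 1 D f2 & Ck_closure 1 D f3].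
Proof.
move=> [cf H].
have [f1 [d1 k1]] := H dir_x ltac:(by rewrite inE eqxx).
have [f2 [d2 k2]] := H dir_y ltac:(by rewrite !inE eqxx orbT).
have [f3 [d3 k3]] := H dir_t ltac:(by rewrite !inE eqxx !orbT).
exists f1, f2, f3; split => //.
split; [exact/cwiP| | | |]; try (by apply/cwiP; case: k1); try (by apply/cwiP; case: k2);
  try (by apply/cwiP; case: k3).
by move=> z Dz; split; [exact: d1|exact: d2|exact: d3].
Qed.

Lemma C1c_sub D f f1 f2 f3 : C1c D f f1 f2 f3 -> [/\ cwi D f, cwi D f1, cwi D f2 & cwi D f3].
Proof. by move=> [c0 c1 c2 c3 _]; split; apply: cwi_sub (@subset_closure _ D) _. Qed.

Lemma C1c_chain D f f1 f2 f3 (c1 c2 c3 : R -> R) (r d1 d2 d3 : R) : open D ->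
  C1c D f f1 f2 f3 -> D (c1 r, c2 r, c3 r) ->
  is_derive r 1 c1 d1 -> is_derive r 1 c2 d2 -> is_derive r 1 c3 d3 ->
  is_derive r 1 (fun s => f (c1 s, c2 s, c3 s))
    (f1 (c1 r, c2 r, c3 r) * d1 + f2 (c1 r, c2 r, c3 r) * d2 + f3 (c1 r, c2 r, c3 r) * d3).
Proof.
move=> oD Cf Dz; have [_ k1 k2 k3] := C1c_sub Cf; have [_ _ _ _ pf] := Cf.
exact: (chain_rule3 oD pf k1 k2 k3 Dz).
Qed.

Lemma affine_derive (a b s : R) : is_derive s 1 (fun s => a + s * b) b.
Proof. by apply: is_derive_eq; rewrite /GRing.scale/=; ring. Qed.

Lemma C1c_direction D f f1 f2 f3 (z e : R * R * R) : open D -> C1c D f f1 f2 f3 -> D z ->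
  is_derive z e f (f1 z * e.1.1 + f2 z * e.1.2 + f3 z * e.2).
Proof.
move=> oD Cf Dz; apply: is_derive_of_line.
have := @C1c_chain D f f1 f2 f3 (fun s => z.1.1 + s * e.1.1) (fun s => z.1.2 + s * e.1.2)
  (fun s => z.2 + s * e.2) 0 e.1.1 e.1.2 e.2 oD Cf.
rewrite !mul0r !addr0 -!surjective_pairing => /(_ Dz (affine_derive _ _ _) (affine_derive _ _ _) (affine_derive _ _ _)).
by congr is_derive; apply/funext => s; congr f; rewrite [RHS]surjective_pairing; congr pair;
  rewrite [RHS]surjective_pairing.
Qed.

Lemma C1c_lin D (a b : R) f f1 f2 f3 g g1 g2 g3 : C1c D f f1 f2 f3 -> C1c D g g1 g2 g3 ->
  C1c D (fun z => a * f z + b * g z) (fun z => a * f1 z + b * g1 z)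
    (fun z => a * f2 z + b * g2 z) (fun z => a * f3 z + b * g3 z).
Proof.
move=> [c0 c1 c2 c3 pf] [k0 k1 k2 k3 pg].
have lin h h' : cwi (closure D) h -> cwi (closure D) h' -> cwi (closure D) (fun z => a * h z + b * h' z).
  by move=> ch ch'; apply: cwiD; apply: cwiM => //; exact: cwi_cst.
split; try exact: lin.
have dl z e (df dg : R) : is_derive z e f df -> is_derive z e g dg ->
    is_derive z e (fun z => a * f z + b * g z) (a * df + b * dg).
  by move=> d1 d2; apply: is_deriveD; exact: is_deriveZ.
by move=> z Dz; have [p1 p2 p3] := pf z Dz; have [q1 q2 q3] := pg z Dz; split; exact: dl.
Qed.

Lemma C1c_mul D f f1 f2 f3 g g1 g2 g3 : C1c D f f1 f2 f3 -> C1c D g g1 g2 g3 ->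
  C1c D (fun z => f z * g z) (fun z => f1 z * g z + f z * g1 z)
    (fun z => f2 z * g z + f z * g2 z) (fun z => f3 z * g z + f z * g3 z).
Proof.
move=> [c0 c1 c2 c3 pf] [k0 k1 k2 k3 pg].
split; try (by apply: cwiD; exact: cwiM); first exact: cwiM.
have dl (z e : R * R * R) (df dg : R) : is_derive z e f df -> is_derive z e g dg ->
    is_derive z e (fun z => f z * g z) (df * g z + f z * dg).
  move=> d1 d2; have H : is_derive z e (fun z => f z * g z) _ := is_deriveM d1 d2.
  by apply: is_derive_eq H _; rewrite /GRing.scale/=; ring.
by move=> z Dz; have [p1 p2 p3] := pf z Dz; have [q1 q2 q3] := pg z Dz; split; exact: dl.
Qed.

End SpaceTimeC1.

(** * Pull-back by rigid motions *)

Section RigidPullback.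
Context {R : realType}.
Context (Omega : set (R * R)) (oO : open Omega) (p : R * R) (t al : R).

Definition motion (z : R * R * R) : R * R * R := (rigid_motion p al z.1, t + z.2).
Definition moved : set (R * R) := rigid_motion p al @^-1` Omega.

Lemma rigid_continuous : continuous (rigid_motion p al).
Proof.
by move=> z; apply: cvgD; [exact: cvg_cst|exact: rotate_axes_continuous].
Qed.

Definition frame (q : R * R) : R * R := rotate_axes al (q - p).

Lemma frame_continuous : continuous frame.
Proof.
apply: cwi_setT; have cr : cwi setT (@rotate_axes R al) by apply: continuous_cwi; exact: rotate_axes_continuous.
apply: (cwi_comp cr) => // q _; apply: cvg_within_filter.
by apply: cvgB; [exact: cvg_id|exact: cvg_cst].
Qed.

Lemma rigidK : cancel (rigid_motion p al) frame.
Proof. by move=> z; rewrite /frame /rigid_motion addrAC subrr add0r rotate_axesNK. Qed.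

Lemma frameK : cancel frame (rigid_motion p al).
Proof. by move=> q; rewrite /frame /rigid_motion rotate_axesK addrC subrK. Qed.

Lemma open_moved : open moved.
Proof. by apply: open_comp => // z _; exact: rigid_continuous. Qed.

Lemma closure_moved : closure moved = rigid_motion p al @^-1` closure Omega.
Proof.
apply/seteqP; split=> z cz B nB.
  have [w [Ow Bw]] := cz _ (rigid_continuous nB).
  by exists (rigid_motion p al w).
have : nbhs (rigid_motion p al z) (frame @^-1` B).
  by apply: frame_continuous; rewrite rigidK.
move=> /cz[q [Oq Bq]]; exists (frame q); split => //.
by rewrite /moved/= frameK.
Qed.

Lemma compact_closure_moved : compact (closure Omega) -> compact (closure moved).
Proof.
move=> kO; have -> : closure moved = frame @` closure Omega.
  rewrite closure_moved; apply/seteqP; split => z /=.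
    by move=> cz; exists (rigid_motion p al z) => //; rewrite rigidK.
  by move=> [q cq <-]; rewrite frameK.
by apply: continuous_compact => //; apply: continuous_subspaceT; exact: frame_continuous.
Qed.

Lemma C1c_motion (f f1 f2 f3 : R * R * R -> R) : C1c (cylinder Omega) f f1 f2 f3 ->
  C1c (cylinder moved) (fun z => f (motion z))
    (fun z => cos al * f1 (motion z) + sin al * f2 (motion z))
    (fun z => - sin al * f1 (motion z) + cos al * f2 (motion z)) (fun z => f3 (motion z)).
Proof.
move=> Cf; have [c0 c1 c2 c3 pf] := Cf.
have cm : cwi (closure (cylinder moved)) motion.
  apply: cwi_pair; last by apply: cwiD; [exact: cwi_cst|exact: cwi_snd].
  have cr : cwi setT (rigid_motion p al) by apply: continuous_cwi; exact: rigid_continuous.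
  by apply: (cwi_comp cr) => //; exact: cwi_fst.
have sub z : closure (cylinder moved) z -> closure (cylinder Omega) (motion z).
  by rewrite !closure_cylinder closure_moved => -[].
have lin h : cwi (closure (cylinder Omega)) h -> cwi (closure (cylinder moved)) (fun z => h (motion z)).
  by move=> ch; exact: (cwi_comp ch cm sub).
split; try exact: lin.
- by apply: cwiD; apply: cwiM; (try exact: cwi_cst); exact: lin.
- by apply: cwiD; apply: cwiM; (try exact: cwi_cst); exact: lin.
move=> z [Dz _].
have Dm : cylinder Omega (motion z) by [].
have line (e : R * R * R) s : motion (z + s *: e) = motion z + s *: (rotate_axes (- al) e.1, e.2).
  by rewrite /motion /rigid_motion; congr pair; rewrite /= ?rotate_line addrA.
have dir e : is_derive z e (fun z => f (motion z)) (f1 (motion z) * (rotate_axes (- al) e.1).1 +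
    f2 (motion z) * (rotate_axes (- al) e.1).2 + f3 (motion z) * e.2).
  apply: is_derive_of_line; under eq_fun do rewrite line.
  by apply: is_derive_line0; exact: (C1c_direction _ (open_cylinder oO) Cf Dm).
by split; apply: is_derive_eq (dir _) _; rewrite rotate_axesNE/=; ring.
Qed.

End RigidPullback.

(** * The normal derivative, and the divergence theorem in a moved frame *)

Section NormalDerivative.
Context {R : realType}.
Local Notation mu := (@lebesgue_measure R).
Local Notation plane := (@plane R).
Local Notation mu2 := (mu \x mu)%E.
Context (Omega : set (R * R)) (oO : open Omega) (kO : compact (closure Omega)).
Context (sO : smooth_boundary Omega) (neO : Omega !=set0).
Local Notation bd := (boundary Omega).
Local Notation sigma := (arc_length bd).

Lemma outward_normalP q : bd q -> is_outward_normal Omega q (outward_normal Omega q).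
Proof.
move=> bq; have [cq _] := bq.
have [ch [gch /andP[r0 rR] _] bx] := exists_chart oO sO cq.
have bx' := in_box_le (ltW rR) bx.
by rewrite (outward_normalE oO gch bx' bq); exact: chart_normal_outward.
Qed.

(** By the mean value theorem the one-sided quotient equals the directional derivative at some point
    of the inward segment, which lies in [Omega]; the continuous extension of the derivatives to the
    boundary gives the limit. *)
Lemma normal_derivativeE u ux uy ut q (s : R) : C1c (cylinder Omega) u ux uy ut -> bd q ->
  normal_derivative Omega u q s =
  ux (q, s) * (outward_normal Omega q).1 + uy (q, s) * (outward_normal Omega q).2.
Proof.
move=> Cu bq; have [cu c1 c2 c3 pu] := Cu.
have [_ _ nrm] := outward_normalP bq.
rewrite /normal_derivative; set n := outward_normal Omega q in nrm *.
pose G z := ux z * n.1 + uy z * n.2.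
have cG : cwi (closure (cylinder Omega)) G.
  by apply: cwiD; apply: cwiM => //; exact: cwi_cst.
have cqs : closure (cylinder Omega) (q, s).
  by rewrite closure_cylinder; split => //; case: bq.
pose ray (e : R) : R * R * R := (q - e *: n, s).
have cray : continuous ray.
  apply: cwi_setT; apply: cwi_pair; last exact: cwi_cst.
  have -> : (fun e => q - e *: n) = (fun e => (q.1 - e * n.1, q.2 - e * n.2)).
    by apply/funext => e; rewrite [LHS]surjective_pairing.
  by apply: cwi_pair; apply: cwiB; (try exact: cwi_cst); apply: cwiM; (try exact: cwi_cst); exact: cwi_id.
have ray0 : ray 0 = (q, s) by rewrite /ray scale0r subr0.
have [d d0 Hd] : exists2 d, 0 < d & forall e, 0 < e < d -> Omega (q - e *: n).
  have {}nrm : nbhs (0 : R) (fun e => 0 < e -> Omega (q - e *: n) /\ ~ closure Omega (q + e *: n)) := nrm.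
  have /nbhs_ballP[d /= d0 Hd] := nrm.
  exists d => // e /andP[e0 ed]; have [] := Hd e _ e0 => //.
  by rewrite /ball/= sub0r normrN gtr0_norm.
have cl e : 0 <= e < d -> closure (cylinder Omega) (ray e).
  rewrite le_eqVlt => /andP[/predU1P[<- _|e0 ed]]; first by rewrite ray0.
  by apply: subset_closure; split => //; apply: Hd; rewrite e0.
have quot e : 0 < e < d -> exists2 x, 0 < x < e & e^-1 * (u (q, s) - u (ray e)) = G (ray x).
  move=> /andP[e0 ed].
  have dline x : 0 < x < d -> is_derive x 1 (fun x => u (ray x)) (- G (ray x)).
    move=> xd.
    have Dx : cylinder Omega (q.1 + x * - n.1, q.2 + x * - n.2, s + x * 0).
      split => //=; have -> : (q.1 + x * - n.1, q.2 + x * - n.2) = q - x *: n; last exact: Hd.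
      by rewrite [RHS]surjective_pairing !mulrN.
    have E y : ray y = (q.1 + y * - n.1, q.2 + y * - n.2, s + y * 0).
      rewrite /ray mulr0 addr0; congr pair.
      by rewrite [LHS]surjective_pairing !mulrN.
    have := @C1c_chain R (cylinder Omega) u ux uy ut (fun y => q.1 + y * - n.1)
      (fun y => q.2 + y * - n.2) (fun y => s + y * 0) x _ _ _ (open_cylinder oO) Cu Dx
      (affine_derive _ _ _) (affine_derive _ _ _) (affine_derive _ _ _).
    rewrite -!E => H; under eq_fun do rewrite E.
    by apply: is_derive_eq H _; rewrite /G; ring.
  have [||x] := @MVT R (fun x => u (ray x)) (fun x => - G (ray x)) 0 e e0.
  - move=> x; rewrite in_itv/= => /andP[x0 xe]; apply: dline.
    by rewrite x0 (lt_trans xe).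
  - apply/cwiP; apply: (cwi_comp cu); first exact: continuous_cwi.
    by move=> x /=; rewrite in_itv/= => /andP[x0 xe]; apply: cl; rewrite x0 (le_lt_trans xe).
  rewrite in_itv/= => xe E; exists x => //.
  rewrite ray0 subr0 in E; rewrite -opprB E; field.
  exact: lt0r_neq0.
apply: cvg_lim => //; apply/cvgrPdist_le => eps eps0.
have /cvgrPdist_le/(_ _ eps0) nG := cG _ cqs.
have {}nG : nbhs (q, s) (fun z => closure (cylinder Omega) z -> `|G (q, s) - G z| <= eps) := nG.
rewrite -ray0 in nG; have := cray 0 _ nG => {}nG.
have {nG} /nbhs_ballP[d' /= d'0 Hd'] : nbhs (0 : R) (fun x => closure (cylinder Omega) (ray x) ->
  `|G (ray 0) - G (ray x)| <= eps) := nG.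
rewrite ray0 in Hd'.
near=> e; have e0 : 0 < e by near: e; exact: nbhs_right_gt.
have ed : e < d by near: e; exact: nbhs_right_lt.
have ed' : e < d' by near: e; exact: nbhs_right_lt.
have [|x /andP[x0 xe] ->] := quot e; first by rewrite e0.
apply: Hd'; last by apply: cl; rewrite (ltW x0) (lt_trans xe).
by rewrite /ball/= sub0r normrN gtr0_norm// (lt_trans xe).
Unshelve. all: by end_near.
Qed.

Lemma C1bar_lin (a b : R) (f fx fy g gx gy : R * R -> R) : C1bar Omega f fx fy -> C1bar Omega g gx gy ->
  C1bar Omega (fun z => a * f z + b * g z) (fun z => a * fx z + b * gx z) (fun z => a * fy z + b * gy z).
Proof.
move=> [c0 c1 c2 pf] [k0 k1 k2 pg].
have lin (h h' : R * R -> R) : cwi (closure Omega) h -> cwi (closure Omega) h' -> cwi (closure Omega) (fun z => a * h z + b * h' z).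
  by move=> ch ch'; apply: cwiD; apply: cwiM => //; exact: cwi_cst.
split; try exact: lin.
have dl z e (df dg : R) : is_derive z e f df -> is_derive z e g dg ->
    is_derive z e (fun z => a * f z + b * g z) (a * df + b * dg).
  by move=> d1 d2; apply: is_deriveD; exact: is_deriveZ.
by move=> z Dz; have [p1 p2] := pf z Dz; have [q1 q2] := pg z Dz; split; exact: dl.
Qed.

(** The field is turned back to the original axes. Its divergence and its product with the normal
    are invariant under the rotation, and the area integral is transported by the rigid motion. *)
Lemma divergence_frame (p : R * R) (al : R) (G1 G1X G1Y G2 G2X G2Y : R * R -> R) :
  C1bar (moved Omega p al) G1 G1X G1Y -> C1bar (moved Omega p al) G2 G2X G2Y ->
  \int[mu2]_(z in moved Omega p al) (G1X z + G2Y z) =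
  \int[sigma]_(q in bd) (G1 (frame p al q) * (rotate_axes al (outward_normal Omega q)).1 +
                         G2 (frame p al q) * (rotate_axes al (outward_normal Omega q)).2).
Proof.
set O' := moved Omega p al => CG1 CG2.
have oO' : open O' by exact: open_moved.
have kO' : compact (closure O') by exact: compact_closure_moved.
have sub q : closure Omega q -> closure O' (frame p al q).
  by rewrite closure_moved /= frameK.
have cfr (h : R * R -> R) : cwi (closure O') h -> cwi (closure Omega) (fun q => h (frame p al q)).
  move=> ch; apply: (cwi_comp ch) => //; apply: continuous_cwi; exact: frame_continuous.
have pull G GX GY : C1bar O' G GX GY -> C1bar Omega (fun q => G (frame p al q))
    (fun q => cos al * GX (frame p al q) - sin al * GY (frame p al q))
    (fun q => sin al * GX (frame p al q) + cos al * GY (frame p al q)).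
  move=> [cG cGX cGY pG]; split; first exact: cfr.
  - by apply: cwiB; apply: cwiM; (try exact: cwi_cst); exact: cfr.
  - by apply: cwiD; apply: cwiM; (try exact: cwi_cst); exact: cfr.
  move=> q Oq; have O'q : O' (frame p al q) by rewrite /O'/moved/= frameK.
  have dir e : is_derive q e (fun q => G (frame p al q)) (GX (frame p al q) * (rotate_axes al e).1 +
      GY (frame p al q) * (rotate_axes al e).2).
    apply: is_derive_of_line.
    have E s : frame p al (q + s *: e) = frame p al q + s *: rotate_axes al e.
      by rewrite /frame addrAC rotate_line.
    under eq_fun do rewrite E.
    apply: is_derive_line0; apply: (derive_direction _ oO' pG) => //.
      by apply: cwi_sub cGX; exact: subset_closure.
    by apply: cwi_sub cGY; exact: subset_closure.
  by split; apply: is_derive_eq (dir _) _; rewrite /rotate_axes/=; ring.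
have [[c1 c1X c1Y _] [c2 c2X c2Y _]] := (CG1, CG2).
have cn := outward_normal_continuous oO sO.
have cn1 : cwi bd (fun q => (outward_normal Omega q).1) by apply: (cwi_comp (cwi_fst (A := setT)) cn).
have cn2 : cwi bd (fun q => (outward_normal Omega q).2) by apply: (cwi_comp (cwi_snd (A := setT)) cn).
have mO : measurable (Omega : set plane) by exact: open_plane_measurable.
have kbd : compact bd by exact: compact_boundary.
have mbd : measurable (bd : set plane) by exact: compact_plane_measurable.
have bdc : bd `<=` closure Omega by move=> q [].
have dint (h : R * R -> R) : cwi (closure O') h -> mu2.-integrable Omega (EFin \o (fun q => h (frame p al q))).
  by move=> ch; apply: cwi_domain_integrable => //; exact: cfr.
have bint (h k : R * R -> R) : cwi (closure O') h -> cwi bd k ->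
    sigma.-integrable bd (EFin \o (fun q => h (frame p al q) * k q)).
  move=> ch ck; apply: boundary_integrable => //; apply: cwiM => //.
  by apply: cwi_sub (cfr _ ch).
have cdom : cwi (closure O') (fun z => G1X z + G2Y z) by exact: cwiD.
transitivity (\int[mu2]_(q in Omega) (G1X (frame p al q) + G2Y (frame p al q))).
  have [L [M [_ _ bs]]] := domain_bounded_support oO kO (cfr _ cdom).
  rewrite [RHS]Rintegral_mkcond -(Rintegral_measure_preserving (measure_preserving_rigid p al)).
  - rewrite Rintegral_mkcond; apply: eq_Rintegral => z _; rewrite !patchE rigidK.
    by have -> : (z \in O') = (rigid_motion p al z \in Omega) by apply/idP/idP; rewrite !inE.
  - by case: bs.
  - exact: bounded_support_integrable bs.
have [Dx _] := divergence_theorem oO kO sO neO (C1bar_lin (cos al) (- sin al) (pull _ _ _ CG1) (pull _ _ _ CG2)).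
have [_ Dy] := divergence_theorem oO kO sO neO (C1bar_lin (sin al) (cos al) (pull _ _ _ CG1) (pull _ _ _ CG2)).
have lin (h k : R * R -> R) (x y : R) : cwi (closure O') h -> cwi (closure O') k -> cwi (closure O') (fun z => x * h z + y * k z).
  by move=> ch ck; apply: cwiD; apply: cwiM => //; exact: cwi_cst.
transitivity (\int[sigma]_(q in bd) ((cos al * G1 (frame p al q) + - sin al * G2 (frame p al q)) * (outward_normal Omega q).1) +
  \int[sigma]_(q in bd) ((sin al * G1 (frame p al q) + cos al * G2 (frame p al q)) * (outward_normal Omega q).2)).
  rewrite -Dx -Dy -RintegralD//.
  - apply: eq_Rintegral => q _; have cs1 := cos2Dsin2 al.
    by rewrite -[LHS]mul1r -cs1; ring.
  - by apply: (dint (fun z => cos al * (cos al * G1X z - sin al * G1Y z) + - sin al * (cos al * G2X z - sin al * G2Y z)));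
      apply: lin; apply: cwiB; apply: cwiM => //; exact: cwi_cst.
  - by apply: (dint (fun z => sin al * (sin al * G1X z + cos al * G1Y z) + cos al * (sin al * G2X z + cos al * G2Y z)));
      apply: (lin); exact: lin.
rewrite -RintegralD//.
- by apply: eq_Rintegral => q _; rewrite /rotate_axes/=; ring.
- by apply: (bint (fun z => cos al * G1 z + - sin al * G2 z)) => //; exact: lin.
- by apply: (bint (fun z => sin al * G1 z + cos al * G2 z)) => //; exact: lin.
Qed.

End NormalDerivative.

(** * The kernel *)

Section ParameterIntegral.
Context {R : realType}.
Local Notation mu := (@lebesgue_measure R).

Lemma derive_param_dir (V : normedModType R) (D : set V) (F F' : V * R -> R) (z e : V) (a b : R) :
  open D -> D z -> cwi (D `*` `[a, b]%classic) F -> cwi (D `*` `[a, b]%classic) F' ->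
  (forall z y, D z -> a <= y <= b -> is_derive z e (fun z => F (z, y)) (F' (z, y))) ->
  is_derive z e (fun z => \int[mu]_(y in `[a, b]) F (z, y)) (\int[mu]_(y in `[a, b]) F' (z, y)).
Proof.
move=> oD Dz cF cF' dF; apply: is_derive_of_line.
have cl : continuous (fun s : R => z + s *: e).
  by move=> s; apply: cvgD; [exact: cvg_cst|apply: cvgZ; [exact: cvg_id|exact: cvg_cst]].
have l0 : z + 0 *: e = z by rewrite scale0r addr0.
have [d /= d0 Hd] : exists2 d, 0 < d & forall s : R, 0 - d < s < 0 + d -> D (z + s *: e).
  have nD : nbhs (z + 0 *: e) D by rewrite l0; exact: open_nbhs_nbhs.
  have /nbhs_ballP[d /= d0 Hd] := cl _ _ nD.
  exists d => // s hs; apply: Hd; rewrite /ball/= sub0r normrN ltr_norml; lra.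
have cc (H : V * R -> R) : cwi (D `*` `[a, b]%classic) H ->
    cwi (`]0 - d, 0 + d[%classic `*` `[a, b]%classic) (fun r : R * R => H (z + r.1 *: e, r.2)).
  move=> cH; apply: (cwi_comp cH).
    apply: cwi_pair; last exact: cwi_snd.
    by apply: (cwi_comp (continuous_cwi (A := setT) cl)); [exact: cwi_fst|].
  by move=> [s y] [/= sI yI]; split => //=; apply: Hd; move: sI; rewrite in_itv.
have := @derive_param R (fun r => F (z + r.1 *: e, r.2)) (fun r => F' (z + r.1 *: e, r.2)) 0 d a b d0.
rewrite /= l0; apply.
- move=> s sd; apply: (cwi_comp (cc _ cF) (g := fun y => (s, y))).
    by apply: cwi_pair; [exact: cwi_cst|exact: cwi_id].
  by move=> y yI; split.
- move=> s y sd yI; apply: (@is_derive_line R V (fun z => F (z, y))); apply: dF => //.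
  by apply: Hd.
- exact: cc.
Qed.

End ParameterIntegral.

Lemma is_derive_mul {R : realType} (V : normedModType R) (f g : V -> R) z e (df dg : R) :
  is_derive z e f df -> is_derive z e g dg ->
  is_derive z e (fun x => f x * g x) (df * g z + f z * dg).
Proof.
move=> d1 d2; have H : is_derive z e (fun x => f x * g x) _ := is_deriveM d1 d2.
by apply: is_derive_eq H _; rewrite /GRing.scale/=; ring.
Qed.

Section Kernel.
Context {R : realType}.
Local Notation mu := (@lebesgue_measure R).

Lemma partial1 (f : R * R -> R) (z : R * R) d : is_derive z.1 1 (fun x => f (x, z.2)) d ->
  is_derive z (1, 0) f d.
Proof.
apply: is_derive_quotient => s; congr (f _ - _); last by case: z.
by rewrite [RHS]surjective_pairing /= scaler0 add0r.
Qed.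

Lemma partial2 (f : R * R -> R) (z : R * R) d : is_derive z.2 1 (fun y => f (z.1, y)) d ->
  is_derive z (0, 1) f d.
Proof.
apply: is_derive_quotient => s; congr (f _ - _); last by case: z.
by rewrite [RHS]surjective_pairing /= scaler0 add0r.
Qed.

Definition continuous_partials (f f1 f2 : R * R -> R) :=
  [/\ cwi setT f, cwi setT f1, cwi setT f2 & has_partials2 setT f f1 f2].

Context (k : R).

(* Real and imaginary parts of the derivatives of [exp (- k z ^ 2)] at
   [z = x - i y]. *)
Definition ga0 (z : R * R) := expR ((z.2 ^+ 2 - z.1 ^+ 2) * k) * cos (2 * z.1 * z.2 * k).
Definition gb0 (z : R * R) := expR ((z.2 ^+ 2 - z.1 ^+ 2) * k) * sin (2 * z.1 * z.2 * k).
Definition ga1 (z : R * R) := - (2 * k) * (z.1 * ga0 z + z.2 * gb0 z).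
Definition gb1 (z : R * R) := - (2 * k) * (z.1 * gb0 z - z.2 * ga0 z).
Definition ga2 (z : R * R) := - (2 * k) * (ga0 z + z.1 * ga1 z + z.2 * gb1 z).
Definition gb2 (z : R * R) := - (2 * k) * (gb0 z + z.1 * gb1 z - z.2 * ga1 z).

Lemma gauss_continuous : [/\ cwi setT ga0, cwi setT gb0, cwi setT ga1, cwi setT gb1 &
  cwi setT ga2 /\ cwi setT gb2].
Proof.
have c1 : cwi setT (@fst R R) by exact: cwi_fst.
have c2 : cwi setT (@snd R R) by exact: cwi_snd.
have cc (c : R) : cwi setT (fun _ : R * R => c) by exact: cwi_cst.
have ce : cwi setT (fun z : R * R => expR ((z.2 ^+ 2 - z.1 ^+ 2) * k)).
  apply: (cwi_comp (continuous_cwi (A := setT) (@continuous_expR R))) => //.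
  by apply: cwiM => //; apply: cwiB; under eq_fun do rewrite expr2; apply: cwiM.
have ca : cwi setT (fun z : R * R => 2 * z.1 * z.2 * k) by repeat apply: cwiM.
have c0 : cwi setT ga0.
  by apply: cwiM => //; apply: (cwi_comp (continuous_cwi (A := setT) (@continuous_cos R))).
have d0 : cwi setT gb0.
  by apply: cwiM => //; apply: (cwi_comp (continuous_cwi (A := setT) (@continuous_sin R))).
have ca1 : cwi setT ga1 by apply: cwiM => //; apply: cwiD; apply: cwiM.
have cb1 : cwi setT gb1 by apply: cwiM => //; apply: cwiB; apply: cwiM.
split => //; split; apply: cwiM => //; [apply: cwiD|apply: cwiB].
all: by (try apply: cwiD) => //; apply: cwiM.
Qed.

(** Cauchy-Riemann for [f (x - i y)]: the [x]-derivative is [f'] and the [y]-derivative is [- i f'],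
    which sends real and imaginary parts [(a, b)] to [(b, - a)]. *)
Lemma gauss_partials0 : has_partials2 setT ga0 ga1 gb1 /\ has_partials2 setT gb0 gb1 (fun z => - ga1 z).
Proof.
have eX (x y : R) : is_derive x 1 (fun x : R => expR ((y ^+ 2 - x ^+ 2) * k)) (- 2 * x * k * expR ((y ^+ 2 - x ^+ 2) * k)).
  have H : is_derive x 1 (fun x : R => (y ^+ 2 - x ^+ 2) * k) (- 2 * x * k).
    by apply: is_derive_eq; rewrite /GRing.scale/=; ring.
  have := is_derive1_comp (is_derive_expR _) H.
  by move=> H1; apply: is_derive_eq H1 _; rewrite /GRing.scale/=; ring.
have eY (x y : R) : is_derive y 1 (fun y : R => expR ((y ^+ 2 - x ^+ 2) * k)) (2 * y * k * expR ((y ^+ 2 - x ^+ 2) * k)).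
  have H : is_derive y 1 (fun y : R => (y ^+ 2 - x ^+ 2) * k) (2 * y * k).
    by apply: is_derive_eq; rewrite /GRing.scale/=; ring.
  have := is_derive1_comp (is_derive_expR _) H.
  by move=> H1; apply: is_derive_eq H1 _; rewrite /GRing.scale/=; ring.
have lX (x y : R) : is_derive x 1 (fun x : R => 2 * x * y * k) (2 * y * k).
  by apply: is_derive_eq; rewrite /GRing.scale/=; ring.
have lY (x y : R) : is_derive y 1 (fun y : R => 2 * x * y * k) (2 * x * k).
  by apply: is_derive_eq; rewrite /GRing.scale/=; ring.
have prod := @is_derive_mul R R.
have dc (f : R -> R) (x df : R) : is_derive x 1 f df -> is_derive x 1 (fun x => cos (f x)) (- (sin (f x)) * df).
  by move=> H; have H1 := is_derive1_comp (is_derive_cos _) H; apply: is_derive_eq H1 _; rewrite mulrC.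
have ds (f : R -> R) (x df : R) : is_derive x 1 f df -> is_derive x 1 (fun x => sin (f x)) (cos (f x) * df).
  by move=> H; have H1 := is_derive1_comp (is_derive_sin _) H; apply: is_derive_eq H1 _; rewrite mulrC.
split=> -[x y] _; split.
- by apply: partial1; apply: is_derive_eq (prod _ _ _ _ _ _ (eX x y) (dc _ _ _ (lX x y))) _; rewrite /= /ga1 /gb1 /ga0 /gb0/=; ring.
- by apply: partial2; apply: is_derive_eq (prod _ _ _ _ _ _ (eY x y) (dc _ _ _ (lY x y))) _; rewrite /= /ga1 /gb1 /ga0 /gb0/=; ring.
- by apply: partial1; apply: is_derive_eq (prod _ _ _ _ _ _ (eX x y) (ds _ _ _ (lX x y))) _; rewrite /= /ga1 /gb1 /ga0 /gb0/=; ring.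
- by apply: partial2; apply: is_derive_eq (prod _ _ _ _ _ _ (eY x y) (ds _ _ _ (lY x y))) _; rewrite /= /ga1 /gb1 /ga0 /gb0/=; ring.
Qed.

Lemma gauss_partials1 : has_partials2 setT ga1 ga2 gb2 /\ has_partials2 setT gb1 gb2 (fun z => - ga2 z).
Proof.
have [pa pb] := gauss_partials0.
have prod := @is_derive_mul R (R * R)%type.
have f1 (z : R * R) : is_derive z (1, 0) (@fst R R) 1 by apply: partial1; exact: is_derive_id.
have f2 (z : R * R) : is_derive z (0, 1) (@fst R R) 0 by apply: partial2; exact: is_derive_cst.
have s1 (z : R * R) : is_derive z (1, 0) (@snd R R) 0 by apply: partial1; exact: is_derive_cst.
have s2 (z : R * R) : is_derive z (0, 1) (@snd R R) 1 by apply: partial2; exact: is_derive_id.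
have lin (f g : R * R -> R) z e (df dg : R) (c : R) : is_derive z e f df -> is_derive z e g dg ->
    is_derive z e (fun z => - (2 * k) * (f z + c * g z)) (- (2 * k) * (df + c * dg)).
  by move=> d1 d2; apply: is_deriveZ; apply: is_deriveD; exact: is_deriveZ.
have E1 : ga1 = fun z => - (2 * k) * (z.1 * ga0 z + 1 * (z.2 * gb0 z)).
  by apply/funext => z; rewrite mul1r.
have E2 : gb1 = fun z => - (2 * k) * (z.1 * gb0 z + -1 * (z.2 * ga0 z)).
  by apply/funext => z; rewrite mulN1r.
split=> z zT; have [a1 a2] := pa z zT; have [b1 b2] := pb z zT; rewrite ?E1 ?E2; split.
- by apply: is_derive_eq (lin _ _ _ _ _ _ _ (prod _ _ _ _ _ _ (f1 z) a1) (prod _ _ _ _ _ _ (s1 z) b1)) _; rewrite /ga2 /=; ring.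
- by apply: is_derive_eq (lin _ _ _ _ _ _ _ (prod _ _ _ _ _ _ (f2 z) a2) (prod _ _ _ _ _ _ (s2 z) b2)) _; rewrite /gb2 /=; ring.
- by apply: is_derive_eq (lin _ _ _ _ _ _ _ (prod _ _ _ _ _ _ (f1 z) b1) (prod _ _ _ _ _ _ (s1 z) a1)) _; rewrite /gb2 /=; ring.
- by apply: is_derive_eq (lin _ _ _ _ _ _ _ (prod _ _ _ _ _ _ (f2 z) b2) (prod _ _ _ _ _ _ (s2 z) a2)) _; rewrite /ga2 /=; ring.
Qed.

(** The path is the ellipse [x + s cos th - i y sin th]. If [y = r cosh f] and [s = r sinh f], this
    is [x - i r sin (th + i f)]: the path in the definition of [w_h] with [th] shifted into the
    complex plane, which leaves the integral of an entire function over a period unchanged. *)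
Definition wmean (m : R -> R) (g : R * R -> R) (z : R * R * R) : R :=
  \int[mu]_(th in `[- pi, pi]) (m th * g (z.1.1 + z.2 * cos th, z.1.2 * sin th)).

Lemma wmean_integrand_continuous (m : R -> R) (g : R * R -> R) : continuous m -> cwi setT g ->
  cwi (setT `*` `[- pi, pi]%classic) (fun r : R * R * R * R => m r.2 * g (r.1.1.1 + r.1.2 * cos r.2, r.1.1.2 * sin r.2)).
Proof.
move=> cm cg; set A := (X in cwi X _).
have cs (f : R -> R) : continuous f -> cwi A (fun r => f r.2).
  by move=> cf; apply: (cwi_comp (continuous_cwi (A := setT) cf)) => //; exact: cwi_snd.
have c1 : cwi A (fun r => r.1) by exact: cwi_fst.
have c11 : cwi A (fun r => r.1.1) by apply: (cwi_comp (@cwi_fst _ _ setT) c1).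
have c12 : cwi A (fun r => r.1.2) by apply: (cwi_comp (@cwi_snd _ _ setT) c1).
have c111 : cwi A (fun r => r.1.1.1) by apply: (cwi_comp (@cwi_fst _ _ setT) c11).
have c112 : cwi A (fun r => r.1.1.2) by apply: (cwi_comp (@cwi_snd _ _ setT) c11).
apply: cwiM; first exact: cs.
apply: (cwi_comp cg) => //; apply: cwi_pair.
  by apply: cwiD => //; apply: cwiM => //; apply: cs; exact: continuous_cos.
by apply: cwiM => //; apply: cs; exact: continuous_sin.
Qed.

Lemma wmean_continuous (m : R -> R) (g : R * R -> R) : continuous m -> cwi setT g -> cwi setT (wmean m g).
Proof. by move=> cm cg; apply: (cwi_param (wmean_integrand_continuous cm cg)). Qed.

Lemma wmean_C1c (m : R -> R) (g gx gy : R * R -> R) : continuous m -> continuous_partials g gx gy ->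
  C1c setT (wmean m g) (wmean m gx) (wmean (fun th => m th * sin th) gy) (wmean (fun th => m th * cos th) gx).
Proof.
move=> cm [cg cgx cgy pg].
have cms : continuous (fun th => m th * sin th) by move=> x; apply: cvgM; [exact: cm|exact: continuous_sin].
have cmc : continuous (fun th => m th * cos th) by move=> x; apply: cvgM; [exact: cm|exact: continuous_cos].
split; rewrite ?closureT; try exact: wmean_continuous.
move=> z _.
have dir (e : R * R * R) (m' : R -> R) (g' : R * R -> R) : continuous m' -> cwi setT g' ->
  (forall th v, m' th * g' v = m th * (gx v * (e.1.1 + e.2 * cos th) + gy v * (e.1.2 * sin th))) ->
  is_derive z e (wmean m g) (wmean m' g' z).
  move=> cm' cg' E.
  have H := @derive_param_dir R (R * R * R)%type setT
    (fun r => m r.2 * g (r.1.1.1 + r.1.2 * cos r.2, r.1.1.2 * sin r.2))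
    (fun r => m' r.2 * g' (r.1.1.1 + r.1.2 * cos r.2, r.1.1.2 * sin r.2)) z e (- pi) pi openT I
    (wmean_integrand_continuous cm cg) (wmean_integrand_continuous cm' cg').
  apply: H.
  move=> {}z th _ _ /=; rewrite E; apply: is_deriveZ; apply: is_derive_of_line.
  have a1 : is_derive (0 : R) 1 (fun s : R => z.1.1 + z.2 * cos th + s * (e.1.1 + e.2 * cos th)) (e.1.1 + e.2 * cos th) by exact: affine_derive.
  have a2 : is_derive (0 : R) 1 (fun s : R => z.1.2 * sin th + s * (e.1.2 * sin th)) (e.1.2 * sin th) by exact: affine_derive.
  have Ef : (fun s : R => g ((z + s *: e).1.1 + (z + s *: e).2 * cos th, (z + s *: e).1.2 * sin th)) =
      (fun s => g (z.1.1 + z.2 * cos th + s * (e.1.1 + e.2 * cos th), z.1.2 * sin th + s * (e.1.2 * sin th))).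
    by apply/funext => s; congr (g (_, _)); rewrite /= /GRing.scale/=; ring.
  rewrite Ef; have := chain_rule2 openT pg cgx cgy I a1 a2.
  by rewrite !mul0r !addr0.
split; apply: dir => //= th v; ring.
Qed.

(* [kW] depends on [(y, s)] only through [y ^+ 2 - s ^+ 2] (Lorentz invariance);
   moving [s] into the argument makes the wave equation visible under the
   integral. *)
Definition kW := wmean (fun=> 1) ga0.
Definition kWx := wmean (fun=> 1) ga1.
Definition kWy := wmean sin gb1.
Definition kWs := wmean cos ga1.
Definition kWss := wmean (fun th => cos th * cos th) ga2.
Definition kWxx := wmean (fun=> 1) ga2.
Definition kWyy := wmean (fun th => sin th * sin th) (fun z => - ga2 z).
Definition kWxy := wmean sin gb2.
Definition kWxs := wmean cos ga2.
Definition kWys := wmean (fun th => sin th * cos th) gb2.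

Lemma kernel_C1c : [/\ C1c setT kW kWx kWy kWs, C1c setT kWx kWxx kWxy kWxs,
  C1c setT kWy kWxy kWyy kWys & C1c setT kWs kWxs kWys kWss].
Proof.
have [ca0 cb0 ca1 cb1 [ca2 cb2]] := gauss_continuous.
have [p0 _] := gauss_partials0; have [p1 q1] := gauss_partials1.
have cN (g : R * R -> R) : cwi setT g -> cwi setT (fun z : R * R => - g z) by exact: cwiN.
have c1 : continuous (fun _ : R => 1 : R) by move=> x; exact: cvg_cst.
have one1 (m : R -> R) : (fun th => 1 * m th) = m by apply/funext => th; rewrite mul1r.
have [h0 h1 h2 h3] : [/\ continuous_partials ga0 ga1 gb1, continuous_partials ga1 ga2 gb2,
  continuous_partials gb1 gb2 (fun z => - ga2 z) & True].
  by split => //; split => //; exact: cN.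
split.
- by have := wmean_C1c c1 h0; rewrite !one1.
- by have := wmean_C1c c1 h1; rewrite !one1.
- exact: wmean_C1c (@continuous_sin R) h2.
- have := wmean_C1c (@continuous_cos R) h1.
  by have -> : (fun th : R => cos th * sin th) = (fun th => sin th * cos th) by apply/funext => th; rewrite mulrC.
Qed.

Lemma wmean_integrable (m : R -> R) (g : R * R -> R) z : continuous m -> cwi setT g ->
  mu.-integrable `[- pi, pi] (EFin \o (fun th => m th * g (z.1.1 + z.2 * cos th, z.1.2 * sin th))).
Proof.
move=> cm cg; apply: cwi_itv_integrable.
apply: (cwi_comp (wmean_integrand_continuous cm cg) (g := fun th => (z, th))); last by [].
by apply: cwi_pair; [exact: cwi_cst|exact: cwi_id].
Qed.

(** [ga0] is harmonic, being the real part of a holomorphic function of [x - i y]. Under the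
    integral the second derivatives in [s], [x] and [y] are [cos ^ 2], 1 and [- sin ^ 2] times
    [ga2]. *)
Lemma kernel_wave z : kWss z = kWxx z + kWyy z.
Proof.
have [_ _ _ _ [ca2 _]] := gauss_continuous.
rewrite /kWxx /kWyy /wmean -RintegralD//.
- apply: eq_Rintegral => th _; have := cos2Dsin2 th => E.
  by rewrite -[X in X * ga2 _ + _]E; ring.
- by apply: (wmean_integrable (m := fun=> 1)) => // x; exact: cvg_cst.
- apply: (wmean_integrable (m := fun th => sin th * sin th) (g := fun z => - ga2 z)); last exact: cwiN.
  by move=> x; apply: cvgM; exact: continuous_sin.
Qed.

(* The integrand is minus the derivative in [th] of [gb0] along the circle. *)
Lemma kernel_boost z : z.2 * kWy z + z.1.2 * kWs z = 0.
Proof.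
have [_ cb0 ca1 cb1 _] := gauss_continuous; have [_ pb] := gauss_partials0.
have pi0 : (- pi : R) <= pi by rewrite (@le_trans _ _ 0)// ?oppr_le0 pi_ge0.
rewrite /kWy /kWs /wmean -!RintegralZl//; last 2 first.
- by apply: wmean_integrable => //; exact: continuous_cos.
- by apply: wmean_integrable => //; exact: continuous_sin.
pose f th := gb1 (z.1.1 + z.2 * cos th, z.1.2 * sin th) * (z.2 * - sin th) +
  - ga1 (z.1.1 + z.2 * cos th, z.1.2 * sin th) * (z.1.2 * cos th).
have cpath (g : R * R -> R) : cwi setT g -> cwi `[- pi, pi]%classic (fun th => g (z.1.1 + z.2 * cos th, z.1.2 * sin th)).
  move=> cg; apply: (cwi_comp cg) => //; apply: cwi_pair.
    by apply: cwiD; [exact: cwi_cst|apply: cwiM; [exact: cwi_cst|apply: continuous_cwi; exact: continuous_cos]].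
  by apply: cwiM; [exact: cwi_cst|apply: continuous_cwi; exact: continuous_sin].
have cs : cwi `[- pi, pi]%classic (@sin R) by apply: continuous_cwi; exact: continuous_sin.
have cc : cwi `[- pi, pi]%classic (@cos R) by apply: continuous_cwi; exact: continuous_cos.
have cf : cwi `[- pi, pi]%classic f.
  apply: cwiD; apply: cwiM.
  - exact: cpath.
  - by apply: cwiM; [exact: cwi_cst|exact: cwiN].
  - by apply: cwiN; exact: cpath.
  - by apply: cwiM; [exact: cwi_cst|].
have df (th : R) : is_derive th 1 (fun th => gb0 (z.1.1 + z.2 * cos th, z.1.2 * sin th)) (f th).
  apply: (chain_rule2 openT pb) => //; first exact: cwiN.
    have H : is_derive th 1 (fun th : R => z.2 * cos th) (z.2 * - sin th) := is_deriveZ _ (is_derive_cos th).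
    by have := is_deriveD (is_derive_cst z.1.1 th 1) H; rewrite add0r.
have := Rintegral_FTC pi0 cf (cpath _ cb0) (fun th _ => df th).
rewrite cosN sinN sinpi oppr0 subrr => I0.
rewrite -[RHS]oppr0 -I0 -[RHS]mulN1r -RintegralZl//; last exact: cwi_itv_integrable.
rewrite -RintegralD//.
- by apply: eq_Rintegral => th _; rewrite /f; ring.
- by apply: cwi_itv_integrable; apply: cwiM; [exact: cwi_cst|apply: cwiM => //; exact: cpath].
- by apply: cwi_itv_integrable; apply: cwiM; [exact: cwi_cst|apply: cwiM => //; exact: cpath].
Qed.

End Kernel.

(** * The kernel on the light cone *)

Section KernelCone.
Context {R : realType}.
Local Notation mu := (@lebesgue_measure R).

Lemma derive0_constant (f : R -> R) (a b : R) : a <= b -> cwi `[a, b]%classic f ->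
  (forall x, a < x < b -> is_derive x 1 f 0) -> f a = f b.
Proof.
move=> ab cf df; have := @Rintegral_FTC R (fun=> 0) f a b ab (@cwi_cst _ _ _ (0 : R)) cf df.
have -> : \int[mu]_(x in `[a, b]) (0 : R) = 0.
  by rewrite /Rintegral integral0.
by move/eqP; rewrite eq_sym subr_eq0 => /eqP.
Qed.

Context (k : R).

Lemma kW_origin (x : R) : kW k (x, 0, 0) = 2 * pi * expR (- (k * x ^+ 2)).
Proof.
rewrite /kW /wmean /=.
have -> : \int[mu]_(th in `[- pi, pi]) (1 * ga0 k (x + 0 * cos th, 0 * sin th)) =
    \int[mu]_(th in `[- pi, pi]) (cst (expR (- (k * x ^+ 2))) th).
  apply: eq_Rintegral => th _; rewrite /ga0 /= !mul0r addr0 mulr0 mul0r cos0 mulr1 mul1r.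
  by congr expR; rewrite expr0n/=; ring.
rewrite Rintegral_cst//= fine_lebesgue_itv.
  by rewrite opprK -mulr2n -mulr_natl; ring.
by rewrite (@le_trans _ _ 0)// ?oppr_le0 pi_ge0.
Qed.

Lemma kW_cwi {T : topologicalType} (A : set T) (g : T -> R * R * R) : cwi A g -> cwi A (fun s => kW k (g s)).
Proof. by move=> cg; have [[cW _ _ _ _] _ _ _] := kernel_C1c k; apply: (cwi_comp cW) => //; rewrite closureT. Qed.

(** Along the generator [(x, l, c * l)] the derivative is [kWy + c * kWs], which [kernel_boost]
    forces to vanish for [l > 0]; so the value is the one at the vertex. *)
Lemma kW_cone (x y c : R) : 0 <= y -> c ^+ 2 = 1 -> kW k (x, y, c * y) = 2 * pi * expR (- (k * x ^+ 2)).
Proof.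
move=> y0 c1; rewrite -kW_origin.
have [CW _ _ _] := kernel_C1c k.
pose g (l : R) := kW k (x + l * 0, 0 + l * 1, 0 + l * c).
have -> : kW k (x, y, c * y) = g y by rewrite /g mulr0 addr0 !add0r mulr1 mulrC.
have -> : kW k (x, 0, 0) = g 0 by rewrite /g !mul0r !addr0.
apply/esym; apply: derive0_constant => //.
  by apply: kW_cwi; apply: cwi_pair; [apply: cwi_pair|]; apply: cwiD; (try exact: cwi_cst); apply: cwiM; (try exact: cwi_cst); exact: cwi_id.
move=> l /andP[l0 _].
have H := C1c_chain (r := l) openT CW I (affine_derive x 0 l) (affine_derive 0 1 l) (affine_derive 0 c l).
apply: is_derive_eq H _; have := kernel_boost k (x + l * 0, 0 + l * 1, 0 + l * c); rewrite /= => B.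
apply: (@mulfI _ (l * c)).
  by rewrite mulf_neq0 ?(gt_eqF l0)//; apply: contra_eqN c1 => /eqP ->; rewrite expr0n/= eq_sym oner_eq0.
rewrite [RHS]mulr0 -[RHS]B.
move: (kWx _ _) (kWy _ _) (kWs _ _) => a b d.
by transitivity (l * c * b + l * c ^+ 2 * d); [ring|rewrite c1; ring].
Qed.

Lemma kW_boost_cone (x y c : R) : 0 < y -> c ^+ 2 = 1 -> kWy k (x, y, c * y) + c * kWs k (x, y, c * y) = 0.
Proof.
move=> y0 c1; have /= B := kernel_boost k (x, y, c * y).
apply: (@mulfI _ (c * y)).
  by rewrite mulf_neq0 ?(gt_eqF y0)//; apply: contra_eqN c1 => /eqP ->; rewrite expr0n/= eq_sym oner_eq0.
rewrite [RHS]mulr0 -[RHS]B mulrDr; congr (_ + _).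
by rewrite mulrA [c * y * c](_ : _ = c ^+ 2 * y); [rewrite c1 mul1r|ring].
Qed.

(** The hyperbola is an orbit of the Lorentz boosts: the derivative along it is the expression of
    [kernel_boost] divided by [w]. *)
Lemma kW_hyperbola (x r s : R) : 0 < r -> kW k (x, Num.sqrt (r ^+ 2 + s ^+ 2), s) = kW k (x, r, 0).
Proof.
move=> r0; pose w (s : R) := Num.sqrt (r ^+ 2 + s ^+ 2).
have [CW _ _ _] := kernel_C1c k.
have q0 (s' : R) : 0 < r ^+ 2 + s' ^+ 2 by rewrite ltr_pwDl ?exprn_gt0 ?sqr_ge0.
have w0 (s' : R) : 0 < w s' by rewrite sqrtr_gt0.
have dw (s' : R) : is_derive s' 1 w (s' / w s').
  have H : is_derive s' 1 (fun s => r ^+ 2 + s ^+ 2) (2 * s').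
    by apply: is_derive_eq; rewrite /GRing.scale/=; ring.
  have H1 := @is_derive1_comp R (fun y => Num.sqrt y) (fun s => r ^+ 2 + s ^+ 2) s' _ _ (is_derive1_sqrt (q0 s')) H.
  apply: is_derive_eq H1 _; rewrite -/(w s') /GRing.scale/=; field.
  by rewrite lt0r_neq0.
pose g s := kW k (x + s * 0, w s, 0 + s * 1).
have dg (s' : R) : is_derive s' 1 g 0.
  have H := C1c_chain (r := s') openT CW I (affine_derive x 0 s') (dw s') (affine_derive 0 1 s').
  apply: is_derive_eq H _; have := kernel_boost k (x + s' * 0, w s', 0 + s' * 1); rewrite /= => B.
  apply: (@mulfI _ (w s')); first by rewrite lt0r_neq0.
  rewrite [RHS]mulr0 -[RHS]B; field; by rewrite lt0r_neq0.
have cg (A : set R) : cwi A g.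
  apply: continuous_cwi => s'; exact: is_derive_continuous (dg s').
have g0 : g 0 = kW k (x, r, 0).
  by rewrite /g /w !mul0r !addr0 expr0n/= addr0 sqrtr_sqr gtr0_norm.
have gs : g s = kW k (x, Num.sqrt (r ^+ 2 + s ^+ 2), s) by rewrite /g /w mulr0 mulr1 addr0 add0r.
rewrite -gs -g0; have [s0|s0] := leP 0 s; last apply: esym; last move/ltW in s0.
  by apply/esym; apply: derive0_constant.
by apply/esym; apply: derive0_constant.
Qed.

(** Brings [kW] to the form of the definition of [w_h], with [sqrt (y ^ 2 - s ^ 2)]. On the cone
    itself the hyperbola degenerates, and both sides are the value at the vertex. *)
Lemma kW_axis (x y s : R) : `|s| <= y -> kW k (x, y, s) = kW k (x, Num.sqrt (y ^+ 2 - s ^+ 2), 0).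
Proof.
move=> sy; have y0 : 0 <= y := le_trans (normr_ge0 s) sy.
have [E|ne] := eqVneq `|s| y.
  have [c c1 ->] : exists2 c : R, c ^+ 2 = 1 & s = c * y.
    have [s0|s0] := leP 0 s; [exists 1|exists (-1)]; rewrite ?expr1n ?sqrrN ?expr1n//.
      by rewrite mul1r -E ger0_norm.
    by rewrite mulN1r -E ltr0_norm ?opprK.
  by rewrite kW_cone// exprMn c1 mul1r subrr sqrtr0 kW_origin.
have sy' : `|s| < y by rewrite lt_neqAle ne.
have d0 : 0 < y ^+ 2 - s ^+ 2.
  by rewrite subr_gt0 -(real_normK (num_real s)) ltr_pXn2r ?nnegrE.
rewrite -(@kW_hyperbola x _ s) ?sqrtr_gt0//.
by rewrite sqr_sqrtr ?ltW// subrK sqrtr_sqr ger0_norm.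
Qed.

End KernelCone.

Section KernelFormula.
Context {R : realType}.
Local Notation mu := (@lebesgue_measure R).

Definition kernel_scale (h : R) := (4 * pi `^ (3 / 2) * Num.sqrt h)^-1.

Lemma w_hE (h x y t : R) : `|t| <= y -> w_h h x y t = kernel_scale h * kW h^-1 (x, y, t).
Proof.
move=> ty; have Re_scale (c : R) (z : R[i]) : complex.Re (c%:C%C * z) = c * complex.Re z.
  by case: z => a b; rewrite /= mul0r subr0.
rewrite kW_axis// /w_h /w_h_complex Re_scale; congr (_ * _).
have ReI (a b : R) (f : R -> R[i]) : complex.Re (cintegral a b f) = \int[mu]_(s in `[a, b]) complex.Re (f s) by [].
rewrite ReI /kW /wmean; apply: eq_Rintegral => th _.
rewrite w_h_exponentE [LHS]/= /ga0 /= mul0r addr0 mul1r.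
by congr (expR _ * cos _); ring.
Qed.

Lemma v_hE (h x y t : R) : v_h h x y t = if `|t| <= y then - (kernel_scale h * kW h^-1 (x, y, t)) else 0.
Proof.
rewrite /v_h /heaviside subr_ge0; case: ifP => ty; last by rewrite oppr0 mul0r.
by rewrite mulN1r w_hE.
Qed.

End KernelFormula.

(** * Green's fields integrated over the light cone *)

Section ConeFields.
Context {R : realType}.
Local Notation mu := (@lebesgue_measure R).
Context (O : set (R * R)) (oO : open O).
Local Notation Q := (cylinder O).

(* For [0 <= y], [cone F (x, y)] is the integral of [F (x, y, s)] over
   [|s| <= y], substituted by [s = y * c] to fix the interval. *)
Definition cone (F : R * R * R -> R) (z : R * R) : R :=
  \int[mu]_(c in `[-1, 1]) (z.2 * F (z, z.2 * c)).
Definition cone_y (F F2 F3 : R * R * R -> R) (z : R * R) : R :=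
  \int[mu]_(c in `[-1, 1]) (F (z, z.2 * c) + z.2 * (F2 (z, z.2 * c) + F3 (z, z.2 * c) * c)).

Lemma cone_slice (A : set (R * R)) (F : R * R * R -> R) : cwi (cylinder A) F ->
  cwi (A `*` `[(-1 : R), 1]%classic) (fun r : R * R * R => F (r.1, r.1.2 * r.2)).
Proof.
move=> cF; apply: (cwi_comp cF); last by move=> [z c] [].
apply: cwi_pair; first exact: cwi_fst.
apply: cwiM; last exact: cwi_snd.
by apply: (cwi_comp (@cwi_snd _ _ setT) (@cwi_fst _ _ _)).
Qed.

Lemma cone_height (A : set (R * R)) : cwi (A `*` `[(-1 : R), 1]%classic) (fun r : R * R * R => r.1.2).
Proof. by apply: (cwi_comp (@cwi_snd _ _ setT) (@cwi_fst _ _ _)). Qed.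

Lemma cone_continuous (A : set (R * R)) F : cwi (cylinder A) F -> cwi A (cone F).
Proof.
move=> cF; apply: (@cwi_param _ _ A (-1) 1 (fun r : R * R * R => r.1.2 * F (r.1, r.1.2 * r.2))).
by apply: cwiM; [exact: cone_height|exact: cone_slice].
Qed.

Lemma C1bar_cone F F1 F2 F3 : C1c Q F F1 F2 F3 -> C1bar O (cone F) (cone F1) (cone_y F F2 F3).
Proof.
move=> CF; have [c0 c1 c2 c3 pF] := CF; rewrite !closure_cylinder in c0 c1 c2 c3.
have [k0 k1 k2 k3] : [/\ cwi (cylinder O) F, cwi (cylinder O) F1, cwi (cylinder O) F2 & cwi (cylinder O) F3].
  have sub : cylinder O `<=` cylinder (closure O) by move=> z [Oz _]; split => //; exact: subset_closure.
  by split; apply: cwi_sub sub _.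
pose f (r : R * R * R) := r.1.2 * F (r.1, r.1.2 * r.2).
pose f2 (r : R * R * R) := F (r.1, r.1.2 * r.2) + r.1.2 * (F2 (r.1, r.1.2 * r.2) + F3 (r.1, r.1.2 * r.2) * r.2).
have cf2 (A : set (R * R)) : cwi (cylinder A) F -> cwi (cylinder A) F2 -> cwi (cylinder A) F3 -> cwi (A `*` `[(-1 : R), 1]%classic) f2.
  move=> a0 a2 a3; apply: cwiD; first exact: cone_slice.
  apply: cwiM; first exact: cone_height.
  apply: cwiD; first exact: cone_slice.
  by apply: cwiM; [exact: cone_slice|exact: cwi_snd].
have cf (A : set (R * R)) G : cwi (cylinder A) G -> cwi (A `*` `[(-1 : R), 1]%classic) (fun r : R * R * R => r.1.2 * G (r.1, r.1.2 * r.2)).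
  by move=> cG; apply: cwiM; [exact: cone_height|exact: cone_slice].
have dir (z e : R * R) (c : R) : O z -> is_derive z e (fun z => z.2 * F (z, z.2 * c))
    (e.2 * F (z, z.2 * c) + z.2 * (F1 (z, z.2 * c) * e.1 + F2 (z, z.2 * c) * e.2 + F3 (z, z.2 * c) * (e.2 * c))).
  move=> Oz; apply: is_derive_of_line.
  have E : (fun s : R => (z + s *: e).2 * F (z + s *: e, (z + s *: e).2 * c)) =
      (fun s : R => (z.2 + s * e.2) * F (z.1 + s * e.1, z.2 + s * e.2, z.2 * c + s * (e.2 * c))).
    apply/funext => s; congr (_ * F (_, _)).
    by rewrite /= /GRing.scale/=; ring.
  have z0 : (z.1 + 0 * e.1, z.2 + 0 * e.2, z.2 * c + 0 * (e.2 * c)) = (z, z.2 * c).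
    by rewrite !mul0r !addr0; case: z {Oz E}.
  rewrite E; have Qz : Q (z.1 + 0 * e.1, z.2 + 0 * e.2, z.2 * c + 0 * (e.2 * c)) by rewrite z0.
  have := C1c_chain (r := 0) (open_cylinder oO) CF Qz (affine_derive z.1 e.1 0) (affine_derive z.2 e.2 0) (affine_derive (z.2 * c) (e.2 * c) 0).
  rewrite z0 => H; have H2 := is_derive_mul (affine_derive z.2 e.2 0) H.
  by apply: is_derive_eq H2 _; rewrite z0 mul0r addr0.
split.
- exact: cone_continuous.
- exact: cone_continuous.
- exact: (cwi_param (cf2 _ c0 c2 c3)).
move=> z Oz; split.
  have H := @derive_param_dir R (R * R)%type O f (fun r => r.1.2 * F1 (r.1, r.1.2 * r.2)) z (1, 0) (-1) 1 oO Oz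
    (cf _ _ k0) (cf _ _ k1).
  apply: H => z1 c Oz1 _; apply: is_derive_eq (dir _ _ _ Oz1) _; rewrite /=; ring.
have H := @derive_param_dir R (R * R)%type O f f2 z (0, 1) (-1) 1 oO Oz (cf _ _ k0) (cf2 _ k0 k2 k3).
apply: H => z1 c Oz1 _; apply: is_derive_eq (dir _ _ _ Oz1) _; rewrite /f2/=; ring.
Qed.

Lemma fibre_derive F F1 F2 F3 (z : R * R) (c : R) : C1c Q F F1 F2 F3 -> O z ->
  is_derive c 1 (fun c => F (z, z.2 * c)) (F3 (z, z.2 * c) * z.2).
Proof.
move=> CF Oz.
have E (s : R) : (z.1 + s * 0, z.2 + s * 0, 0 + s * z.2) = (z, z.2 * s).
  by rewrite !mulr0 !addr0 add0r mulrC; case: z {Oz}.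
have Qz : Q (z.1 + c * 0, z.2 + c * 0, 0 + c * z.2) by rewrite E.
have := C1c_chain (r := c) (open_cylinder oO) CF Qz (affine_derive z.1 0 c) (affine_derive z.2 0 c) (affine_derive 0 z.2 c).
under eq_fun do rewrite E.
by rewrite E => H; apply: is_derive_eq H _; ring.
Qed.

Lemma slice_cwi (F : R * R * R -> R) (z : R * R) : cwi Q F -> O z -> cwi `[(-1 : R), 1]%classic (fun c => F (z, z.2 * c)).
Proof.
move=> cF Oz; apply: (cwi_comp cF); last by [].
by apply: cwi_pair; [exact: cwi_cst|apply: cwiM; [exact: cwi_cst|exact: cwi_id]].
Qed.

(** The fundamental theorem in the fibre variable [c], applied to [F] and to [c * F]; the second
    gives Leibniz's rule for the moving end points [S = Y] and [S = - Y]. *)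
Lemma cone_FTC F F1 F2 F3 (z : R * R) : C1c Q F F1 F2 F3 -> O z ->
  cone F3 z = F (z, z.2) - F (z, - z.2) /\
  cone_y F F2 F3 z = cone F2 z + (F (z, z.2) + F (z, - z.2)).
Proof.
move=> CF Oz; have [c0 c1 c2 c3] := C1c_sub CF.
have l11 : (-1 : R) <= 1 by lra.
have h0 := slice_cwi c0 Oz; have h2 := slice_cwi c2 Oz; have h3 := slice_cwi c3 Oz.
have cid : cwi `[(-1 : R), 1]%classic (fun c : R => c) by exact: cwi_id.
have cz : cwi `[(-1 : R), 1]%classic (fun _ : R => z.2) by exact: cwi_cst.
split.
  have := @Rintegral_FTC R (fun c => z.2 * F3 (z, z.2 * c)) (fun c => F (z, z.2 * c)) (-1) 1 l11.
  rewrite mulrN1 mulr1; apply => //; first exact: cwiM.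
  by move=> c _; apply: is_derive_eq (fibre_derive _ CF Oz) _; rewrite mulrC.
have := @Rintegral_FTC R (fun c => F (z, z.2 * c) + c * (F3 (z, z.2 * c) * z.2)) (fun c => c * F (z, z.2 * c)) (-1) 1 l11.
rewrite mul1r mulr1 mulrN1 mulN1r opprK => I.
have cf : cwi `[(-1 : R), 1]%classic (fun c => F (z, z.2 * c) + c * (F3 (z, z.2 * c) * z.2)).
  by apply: cwiD => //; apply: cwiM => //; exact: cwiM.
transitivity (cone F2 z + \int[mu]_(c in `[-1, 1]) (F (z, z.2 * c) + c * (F3 (z, z.2 * c) * z.2))).
  rewrite /cone /cone_y -RintegralD//.
  - by apply: eq_Rintegral => c _; ring.
  - by apply: cwi_itv_integrable; apply: cwiM.
  - exact: cwi_itv_integrable.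
congr (_ + _); apply: I => //; first exact: cwiM.
move=> c _; have H := is_derive_mul (is_derive_id c 1) (fibre_derive c CF Oz).
by apply: is_derive_eq H _; rewrite mul1r.
Qed.

Lemma cone_add (F G : R * R * R -> R) z : cwi Q F -> cwi Q G -> O z ->
  cone F z + cone G z = cone (fun r => F r + G r) z.
Proof.
move=> cF cG Oz; rewrite /cone -RintegralD//; first by apply: eq_Rintegral => c _; ring.
- by apply: cwi_itv_integrable; apply: cwiM; [exact: cwi_cst|exact: slice_cwi].
- by apply: cwi_itv_integrable; apply: cwiM; [exact: cwi_cst|exact: slice_cwi].
Qed.

Lemma C1bar_mul (f fx fy g gx gy : R * R -> R) : C1bar O f fx fy -> C1bar O g gx gy ->
  C1bar O (fun z => f z * g z) (fun z => fx z * g z + f z * gx z) (fun z => fy z * g z + f z * gy z).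
Proof.
move=> [c0 c1 c2 pf] [k0 k1 k2 pg].
split; try (by apply: cwiD; exact: cwiM); first exact: cwiM.
by move=> z Oz; have [p1 p2] := pf z Oz; have [q1 q2] := pg z Oz; split; exact: is_derive_mul.
Qed.

Lemma C1bar_diag F F1 F2 F3 (c : R) : C1c Q F F1 F2 F3 ->
  C1bar O (fun z => F (z, c * z.2)) (fun z => F1 (z, c * z.2)) (fun z => F2 (z, c * z.2) + c * F3 (z, c * z.2)).
Proof.
move=> CF; have [c0 c1 c2 c3 pF] := CF.
have cc G : cwi (closure Q) G -> cwi (closure O) (fun z => G (z, c * z.2)).
  move=> cG; apply: (cwi_comp cG); last by move=> z Oz; rewrite closure_cylinder.
  by apply: cwi_pair; [exact: cwi_id|apply: cwiM; [exact: cwi_cst|exact: cwi_snd]].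
split; try exact: cc; first by apply: cwiD; [exact: cc|apply: cwiM; [exact: cwi_cst|exact: cc]].
move=> z Oz.
have dir (e : R * R) : is_derive z e (fun z => F (z, c * z.2)) (F1 (z, c * z.2) * e.1 + F2 (z, c * z.2) * e.2 + F3 (z, c * z.2) * (c * e.2)).
  apply: is_derive_of_line.
  have E : (fun s : R => F (z + s *: e, c * (z + s *: e).2)) =
      (fun s : R => F (z.1 + s * e.1, z.2 + s * e.2, c * z.2 + s * (c * e.2))).
    by apply/funext => s; congr (F (_, _)); rewrite /= /GRing.scale/=; ring.
  have z0 : (z.1 + 0 * e.1, z.2 + 0 * e.2, c * z.2 + 0 * (c * e.2)) = (z, c * z.2).
    by rewrite !mul0r !addr0; case: z {Oz E}.
  rewrite E; have Qz : Q (z.1 + 0 * e.1, z.2 + 0 * e.2, c * z.2 + 0 * (c * e.2)) by rewrite z0.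
  have := C1c_chain (r := 0) (open_cylinder oO) CF Qz (affine_derive z.1 e.1 0) (affine_derive z.2 e.2 0) (affine_derive (c * z.2) (c * e.2) 0).
  by rewrite z0.
by split; apply: is_derive_eq (dir _) _; rewrite /=; ring.
Qed.

End ConeFields.

Section DivergenceFree.
Context {R : realType}.
Local Notation mu := (@lebesgue_measure R).

Lemma C1c_restrict (D : set (R * R * R)) f f1 f2 f3 : C1c setT f f1 f2 f3 -> C1c D f f1 f2 f3.
Proof.
rewrite /C1c closureT => -[c0 c1 c2 c3 pf]; split; try by apply: cwi_sub (@subsetT _ _) _.
by move=> z _; exact: pf.
Qed.

Context (O : set (R * R)) (oO : open O) (k : R).
Local Notation Q := (cylinder O).

(** The value of [kW] on the cone, by [kW_cone]. *)
Definition trace_weight (x : R) := 2 * pi * expR (- (k * x ^+ 2)).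

Lemma C1bar_trace_weight : C1bar O (fun z => trace_weight z.1)
  (fun z => - (2 * k * z.1) * trace_weight z.1) (fun=> 0).
Proof.
have cE (A : set (R * R)) : cwi A (fun z => trace_weight z.1).
  apply: cwiM; first exact: cwi_cst.
  apply: (cwi_comp (continuous_cwi (A := setT) (@continuous_expR R))) => //; apply: cwiN.
  apply: cwiM; first exact: cwi_cst.
  by under eq_fun do rewrite expr2; apply: cwiM; exact: cwi_fst.
split => //.
- by apply: cwiM => //; apply: cwiN; apply: cwiM; [exact: cwi_cst|exact: cwi_fst].
- exact: cwi_cst.
move=> z _; split; last by apply: partial2 => /=; exact: is_derive_cst.
apply: partial1.
have H : is_derive z.1 1 (fun x : R => - (k * x ^+ 2)) (- (2 * k * z.1)).
  by apply: is_derive_eq; rewrite /GRing.scale/=; ring.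
have H1 := is_deriveZ (2 * pi) (is_derive1_comp (is_derive_expR _) H).
by apply: is_derive_eq H1 _; rewrite /GRing.scale/= /trace_weight; ring.
Qed.

Context (U UX UY US UXX UXY UXS UYX UYY UYS USX USY USS : R * R * R -> R).
Context (CU : C1c Q U UX UY US) (CX : C1c Q UX UXX UXY UXS) (CY : C1c Q UY UYX UYY UYS).
Context (CS : C1c Q US USX USY USS).
Context (waveU : forall z, Q z -> USS z = UXX z + UYY z).

(* The shape [1 * _ + -1 * _] matches the conclusions of [C1c_lin] and
   [C1bar_lin]. *)
Definition green (UD kD : R * R * R -> R) (r : R * R * R) := 1 * (kW k r * UD r) + -1 * (U r * kD r).
Definition trace (z : R * R) := trace_weight z.1 * (1 * U (z, 1 * z.2) + 1 * U (z, -1 * z.2)).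
Definition flux1 (z : R * R) := cone (green UX (kWx k)) z.
Definition flux2 (z : R * R) := 1 * cone (green UY (kWy k)) z + -1 * trace z.

(** The divergence of the integrated field consists of a fibre integral and of end-point values of
    the [Y]-component. The wave equations of [u] and of [kW] turn the fibre integral into end-point
    values too. On the cone the terms with [u] undifferentiated cancel, since [kWy] is [- kWs] on
    one sheet and [kWs] on the other, and the rest is the [Y]-derivative of the trace. *)
Lemma flux_divergence_free : exists H1X H1Y H2X H2Y,
  [/\ C1bar O flux1 H1X H1Y, C1bar O flux2 H2X H2Y &
      forall z, O z -> 0 < z.2 -> H1X z + H2Y z = 0].
Proof.
have [CW CWx CWy CWs] := kernel_C1c k.
have {CW} W := C1c_restrict Q CW; have {CWx} Wx := C1c_restrict Q CWx.
have {CWy} Wy := C1c_restrict Q CWy; have {CWs} Ws := C1c_restrict Q CWs.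
have C1 := C1c_lin 1 (-1) (C1c_mul W CX) (C1c_mul CU Wx).
have C2 := C1c_lin 1 (-1) (C1c_mul W CY) (C1c_mul CU Wy).
have C3 := C1c_lin 1 (-1) (C1c_mul W CS) (C1c_mul CU Ws).
have B1 := C1bar_cone oO C1; have B2 := C1bar_cone oO C2.
have BD := C1bar_mul C1bar_trace_weight (C1bar_lin 1 1 (C1bar_diag oO 1 CU) (C1bar_diag oO (-1) CU)).
have BH := C1bar_lin 1 (-1) B2 BD.
do 4 eexists; split; [exact: B1|exact: BH|move=> z Oz z0 /=].
have [_ ->] := cone_FTC oO C2 Oz.
have [E3 _] := cone_FTC oO C3 Oz.
have [_ k1 _ _] := C1c_sub C1; have [_ _ k2 _] := C1c_sub C2.
have {}E3 := etrans (_ : _ = cone _ z) E3.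
set A := cone _ z; set B := cone _ z.
(* Here both wave equations enter: the fibre integrand is the [S]-derivative of
   [kW u_S - u kW_S]. *)
have AB : A + B = 1 * (kW k (z, z.2) * US (z, z.2)) + -1 * (U (z, z.2) * kWs k (z, z.2)) -
    (1 * (kW k (z, - z.2) * US (z, - z.2)) + -1 * (U (z, - z.2) * kWs k (z, - z.2))).
  rewrite (cone_add k1 k2 Oz); apply: E3; apply: eq_Rintegral => c _; congr (_ * _).
  by rewrite waveU// kernel_wave; ring.
have {AB} -> : A = 1 * (kW k (z, z.2) * US (z, z.2)) + -1 * (U (z, z.2) * kWs k (z, z.2)) -
    (1 * (kW k (z, - z.2) * US (z, - z.2)) + -1 * (U (z, - z.2) * kWs k (z, - z.2))) - B.
  by rewrite -AB addrK.
move: B => B; rewrite ?mul0r ?add0r [1 * z.2]mul1r [-1 * z.2]mulN1r.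
have z1 : z = (z.1, z.2) by case: (z).
have e1 : (1 : R) ^+ 2 = 1 by rewrite expr1n.
have eN : (-1 : R) ^+ 2 = 1 by rewrite sqrrN expr1n.
have W1 : kW k (z, z.2) = trace_weight z.1 by rewrite z1 /trace_weight -(kW_cone k z.1 (ltW z0) e1) mul1r.
have W2 : kW k (z, - z.2) = trace_weight z.1 by rewrite z1 /trace_weight -(kW_cone k z.1 (ltW z0) eN) mulN1r.
have K1 : kWy k (z, z.2) = - kWs k (z, z.2).
  by apply/eqP; rewrite -addr_eq0; have := kW_boost_cone k z.1 z0 e1; rewrite !mul1r -z1 => ->.
have K2 : kWy k (z, - z.2) = kWs k (z, - z.2).
  by apply/eqP; rewrite -subr_eq0; have := kW_boost_cone k z.1 z0 eN; rewrite !mulN1r -z1 => ->.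
by rewrite W1 W2 K1 K2; ring.
Qed.

End DivergenceFree.

(** * The identity for a fixed angle *)

Section Ramp.
Context {R : realType}.
Local Notation mu := (@lebesgue_measure R).
Local Notation plane := (@plane R).
Local Notation mu2 := (mu \x mu)%E.

(* A C^1 function that is 0 for [y <= 0] and 1 for [e <= y]. *)
Definition ramp (e y : R) := 1 - sqpos (1 - sqpos (y / e)).
Definition dramp (e y : R) := dsqpos (1 - sqpos (y / e)) * (dsqpos (y / e) / e).

Lemma sqpos1 : sqpos 1 = 1 :> R.
Proof. by rewrite /sqpos max_r ?expr1n. Qed.

Lemma ramp_derive (e y : R) : is_derive y 1 (ramp e) (dramp e y).
Proof.
have H0 : is_derive y 1 (fun y : R => y / e) e^-1.
  by apply: is_derive_eq; rewrite /GRing.scale/=; ring.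
have H1 := @is_derive1_comp R (@sqpos R) (fun y => y / e) y _ _ (sqpos_derive _) H0.
have H2 := is_deriveB (is_derive_cst (1 : R) y 1) H1.
have H3 := @is_derive1_comp R (@sqpos R) _ y _ _ (sqpos_derive _) H2.
have H4 := is_deriveB (is_derive_cst (1 : R) y 1) H3.
by apply: is_derive_eq H4 _; rewrite /dramp !sub0r /GRing.scale/= /comp; ring.
Qed.

Lemma ramp_continuous e : continuous (ramp e).
Proof. by move=> y; exact: is_derive_continuous (ramp_derive e y). Qed.

Lemma dramp_continuous e : continuous (dramp e).
Proof.
apply: cwi_setT; have cs : cwi setT (@sqpos R) by apply: continuous_cwi; exact: sqpos_continuous.
have cd : cwi setT (@dsqpos R) by apply: continuous_cwi; exact: dsqpos_continuous.
have ci : cwi setT (fun y : R => y / e) by apply: cwiM; [exact: cwi_id|exact: cwi_cst].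
apply: cwiM; last by apply: cwiM; [exact: (cwi_comp cd)|exact: cwi_cst].
apply: (cwi_comp cd) => //; apply: cwiB; first exact: cwi_cst.
exact: (cwi_comp cs).
Qed.

Lemma ramp0 (e y : R) : 0 < e -> y <= 0 -> ramp e y = 0 /\ dramp e y = 0.
Proof.
move=> e0 y0; have h : y / e <= 0 by rewrite pmulr_lle0 ?invr_gt0.
by rewrite /ramp /dramp (sqpos0 h) (dsqpos0 h) subr0 sqpos1 subrr mul0r mulr0.
Qed.

Lemma ramp1 (e y : R) : 0 < e -> e <= y -> ramp e y = 1 /\ dramp e y = 0.
Proof.
move=> e0 ye; have h : 1 <= y / e by rewrite ler_pdivlMr// mul1r.
have h1 : 1 - sqpos (y / e) <= 0.
  by rewrite subr_le0 /sqpos max_r ?(le_trans ler01)// exprn_ege1.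
by rewrite /ramp /dramp (sqpos0 h1) (dsqpos0 h1) subr0 mul0r.
Qed.

Lemma ramp_bounds (e y : R) : 0 <= ramp e y <= 1.
Proof.
rewrite /ramp subr_ge0 lerBlDr lerDl sqpos_ge0 andbT.
rewrite /sqpos exprn_ile1// ?le_max ?lexx// ge_max ler01/= lerBlDr lerDl.
exact: sqpos_ge0.
Qed.

Lemma dramp_ge0 (e y : R) : 0 < e -> 0 <= dramp e y.
Proof.
by move=> e0; rewrite /dramp /dsqpos !mulr_ge0 ?invr_ge0 ?(ltW e0)// le_max lexx.
Qed.

Lemma dramp_integral (e L : R) : 0 < e -> e <= L -> \int[mu]_(y in `[- L, L]) dramp e y = 1.
Proof.
move=> e0 eL; have L0 : 0 <= L := le_trans (ltW e0) eL.
transitivity (ramp e L - ramp e (- L)).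
  apply: Rintegral_FTC.
  - by rewrite (@le_trans _ _ 0)// oppr_le0.
  - by apply: continuous_cwi; exact: dramp_continuous.
  - by apply: continuous_cwi; exact: ramp_continuous.
  - by move=> y _; exact: ramp_derive.
have L' : - L <= 0 by rewrite oppr_le0.
by have [-> _] := ramp1 e0 eL; have [-> _] := ramp0 e0 L'; rewrite subr0.
Qed.

(** The ramp itself does not converge uniformly, but its product with [y] does; the boundary term
    carries exactly this factor. *)
Lemma ramp_linear (e y : R) : 0 < e -> `|ramp e y * y - Num.max y 0| <= e.
Proof.
move=> e0; have [y0|y0] := leP y 0.
  by have [-> _] := ramp0 e0 y0; rewrite mul0r subrr normr0 ltW.
have [ye|ye] := leP e y; first by have [-> _] := ramp1 e0 ye; rewrite mul1r subrr normr0 ltW.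
have /andP[r0 r1] := ramp_bounds e y.
rewrite -{3}[y]mul1r -mulrBl normrM (gtr0_norm y0) distrC ger0_norm ?subr_ge0//.
by apply: le_trans (ltW ye); apply: ler_piMl; [exact: ltW|rewrite lerBlDr lerDl].
Qed.

Lemma zero_extension_continuous (O : set (R * R)) (f : R * R -> R) : open O -> cwi (closure O) f ->
  (forall z, boundary O z -> f z = 0) -> continuous (f \_ O).
Proof.
move=> oO cf f0 z; have [Oz|nOz] := pselect (O z).
  have /= H := cf z (subset_closure Oz); apply/cvgrPdist_lt => eps eps0.
  have {H} /cvgrPdist_lt/(_ _ eps0) H := H.
  have {}H : nbhs z (fun y => closure O y -> `|f z - f y| < eps) := H.
  have nO : nbhs z O by exact: open_nbhs_nbhs.
  apply: filterS2 nO H => y Oy /(_ (subset_closure Oy)).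
  by rewrite !patchE !mem_set.
apply/cvgrPdist_lt => eps eps0; rewrite patchE memNset//.
have [cz|ncz] := pselect (closure O z).
  have bz : boundary O z by split => // iz; apply: nOz; exact: interior_subset.
  have /cvgrPdist_lt/(_ _ eps0) H := cf z cz.
  have {}H : nbhs z (fun y => closure O y -> `|f z - f y| < eps) := H.
  apply: filterS H => y H; rewrite patchE; case: ifPn => [|_]; last by rewrite subrr normr0.
  by rewrite inE => Oy; have := H (subset_closure Oy); rewrite f0.
have nc : nbhs z (~` closure O).
  by apply: open_nbhs_nbhs; split => //; apply: closed_openC; exact: closed_closure.
apply: filterS nc => y ncy; rewrite patchE memNset ?subrr ?normr0// => Oy.
by apply: ncy; exact: subset_closure.
Qed.

Lemma square_integral (L : R) (F : R * R -> R) : cwi (square L) F ->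
  \int[mu2]_z (F \_ (square L)) z = \int[mu]_(x in `[- L, L]) \int[mu]_(y in `[- L, L]) F (x, y).
Proof.
move=> cF; have [L1 [M [_ _ bs]]] := cwi_bounded_support (@compact_square R L) cF.
rewrite (bounded_support_iterated bs) [RHS]Rintegral_mkcond.
apply: eq_Rintegral => x _; rewrite patchE mem_setE in_itv/=.
case: ifPn => xL; last first.
  rewrite (_ : (fun y => _) = cst 0) ?Rintegral_cst//= ?mul0r//.
  apply/funext => y; rewrite patchE memNset// => -[/= xL' _].
  by move: xL; rewrite -ler_norml xL'.
rewrite [RHS]Rintegral_mkcond; apply: eq_Rintegral => y _; rewrite !patchE mem_setE in_itv/= -ler_norml.
have [yL|yL] := boolP (`|y| <= L); first by rewrite mem_set//; split => //=; rewrite ler_norml.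
by rewrite memNset// => -[_ /= yL']; rewrite yL' in yL.
Qed.

Lemma Rintegral_dominated (D : set (R * R)) (f : R * R -> R) (g : R -> R) (L M : R) :
  measurable (D : set plane) -> D `<=` square L -> 0 <= L ->
  mu2.-integrable D (EFin \o f) -> continuous g -> (forall y, 0 <= g y) ->
  (forall z, D z -> `|f z| <= M * g z.2) -> 0 <= M ->
  `|\int[mu2]_(z in D) f z| <= 2 * L * (M * \int[mu]_(y in `[- L, L]) g y).
Proof.
move=> mD DL L0 If cg g0 fM M0.
have cG : cwi (square L) (fun z : R * R => M * g z.2).
  apply: cwiM; first exact: cwi_cst.
  by apply: (cwi_comp (continuous_cwi (A := setT) cg)) => //; exact: cwi_snd.
have [L1 [M1 [_ _ bs]]] := cwi_bounded_support (@compact_square R L) cG.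
apply: (le_trans (le_normr_Rintegral mD If)).
have Ig := bounded_support_integrable bs.
have -> : 2 * L * (M * \int[mu]_(y in `[- L, L]) g y) = \int[mu2]_z ((fun z => M * g z.2) \_ (square L)) z.
  rewrite square_integral//=.
  have -> : (fun x : R => \int[mu]_(y in `[- L, L]) (M * g y)) = cst (M * \int[mu]_(y in `[- L, L]) g y).
    by apply/funext => x; rewrite RintegralZl//; apply: cwi_itv_integrable; exact: continuous_cwi.
  rewrite Rintegral_cst//= fine_lebesgue_itv; first by ring.
  by rewrite (le_trans _ L0)// oppr_le0.
rewrite Rintegral_mkcond; apply: le_Rintegral => //.
- rewrite -restrict_EFin; apply/integrable_restrict => //; rewrite setTI.
  by have := integrable_norm If; apply: eq_integrable.
- move=> z _; rewrite !patchE; case: ifPn => [|_].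
    by rewrite inE => Dz; rewrite mem_set; [exact: fM|exact: DL].
  by case: ifPn => // _; rewrite mulr_ge0.
Qed.

End Ramp.

Section RampIdentity.
Context {R : realType}.
Local Notation mu := (@lebesgue_measure R).
Local Notation mu2 := (mu \x mu)%E.
Context (Omega : set (R * R)) (oO : open Omega) (kO : compact (closure Omega)).
Context (sO : smooth_boundary Omega) (neO : Omega !=set0).
Local Notation bd := (boundary Omega).
Local Notation sigma := (arc_length bd).

Lemma C1bar_ramp (O : set (R * R)) (e : R) :
  C1bar O (fun z => ramp e z.2) (fun=> 0) (fun z => dramp e z.2).
Proof.
have c2 (A : set (R * R)) (f : R -> R) : continuous f -> cwi A (fun z => f z.2).
  by move=> cf; apply: (cwi_comp (continuous_cwi (A := setT) cf)) => //; exact: cwi_snd.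
split; [exact: c2 (@ramp_continuous _ _)|exact: cwi_cst|exact: c2 (@dramp_continuous _ _)|].
move=> z _; split; first by apply: partial1 => /=; exact: is_derive_cst.
by apply: partial2; exact: ramp_derive.
Qed.

(** The divergence theorem for the ramped field. The field is divergence-free where the ramp is
    positive, and the ramp depends on [Y] only, so just [dramp] times the second component remains
    inside. *)
Lemma ramp_identity (p : R * R) (al e : R) (f1 f1X f1Y f2 f2X f2Y : R * R -> R) : 0 < e ->
  C1bar (moved Omega p al) f1 f1X f1Y -> C1bar (moved Omega p al) f2 f2X f2Y ->
  (forall z, moved Omega p al z -> 0 < z.2 -> f1X z + f2Y z = 0) ->
  \int[mu2]_(z in moved Omega p al) (dramp e z.2 * f2 z) =
  \int[sigma]_(q in bd) (ramp e (frame p al q).2 *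
    (f1 (frame p al q) * (rotate_axes al (outward_normal Omega q)).1 +
     f2 (frame p al q) * (rotate_axes al (outward_normal Omega q)).2)).
Proof.
move=> e0 C1 C2 div0.
have D := divergence_frame oO kO sO neO (C1bar_mul (C1bar_ramp _ e) C1) (C1bar_mul (C1bar_ramp _ e) C2).
transitivity (\int[sigma]_(q in bd) (ramp e (frame p al q).2 * f1 (frame p al q) * (rotate_axes al (outward_normal Omega q)).1 +
     ramp e (frame p al q).2 * f2 (frame p al q) * (rotate_axes al (outward_normal Omega q)).2)).
  rewrite -D; apply: eq_Rintegral => z; rewrite inE => Oz.
  have [z0|z0] := leP z.2 0.
    by have [-> ->] := ramp0 e0 z0; rewrite !mul0r !addr0.
  by rewrite mul0r add0r addrCA -mulrDr div0// mulr0 addr0.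
by apply: eq_Rintegral => q _; ring.
Qed.

End RampIdentity.

Section ConeIdentity.
Context {R : realType}.
Local Notation mu := (@lebesgue_measure R).
Local Notation mu2 := (mu \x mu)%E.
Context (Omega : set (R * R)) (oO : open Omega) (kO : compact (closure Omega)).
Context (sO : smooth_boundary Omega) (neO : Omega !=set0).
Local Notation bd := (boundary Omega).
Local Notation sigma := (arc_length bd).
Local Notation Q := (cylinder Omega).
Context (u ux uy ut uxx uxy uxt uyx uyy uyt utx uty utt : R * R * R -> R).
Context (Cu : C1c Q u ux uy ut) (Cx : C1c Q ux uxx uxy uxt) (Cy : C1c Q uy uyx uyy uyt).
Context (Ct : C1c Q ut utx uty utt).
Context (wave : forall z, Q z -> utt z = uxx z + uyy z).
Context (dir : forall q s, bd q -> u (q, s) = 0).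

Definition normal_slope (q : R * R) (s : R) :=
  ux (q, s) * (outward_normal Omega q).1 + uy (q, s) * (outward_normal Omega q).2.

(** The integral of [kW] times the normal slope over [|S| <= Y], after the substitution [S = Y c]
    and without its Jacobian [Y]. *)
Definition cone_mean (k : R) (p : R * R) (t al : R) (q : R * R) :=
  \int[mu]_(c in `[-1, 1]) (kW k (frame p al q, (frame p al q).2 * c) * normal_slope q (t + (frame p al q).2 * c)).

(** The maximum restores the Jacobian and makes the term vanish for [Y < 0], as the kernel does,
    while keeping it continuous in the angle and the point. *)
Definition angular (k : R) (p : R * R) (t al : R) (q : R * R) :=
  Num.max (frame p al q).2 0 * cone_mean k p t al q.

Lemma cone_mean_continuous (k : R) (p : R * R) (t : R) :
  cwi (setT `*` bd) (fun r : R * (R * R) => cone_mean k p t r.1 r.2).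
Proof.
pose A : set (R * (R * R) * R) := (setT `*` bd) `*` `[(-1 : R), 1]%classic.
have c1 : cwi A (fun r => r.1) by exact: cwi_fst.
have c2 : cwi A (fun r => r.2) by exact: cwi_snd.
have c11 : cwi A (fun r => r.1.1) by apply: (cwi_comp (@cwi_fst _ _ setT) c1).
have c12 : cwi A (fun r => r.1.2) by apply: (cwi_comp (@cwi_snd _ _ setT) c1).
have c121 : cwi A (fun r => r.1.2.1) by apply: (cwi_comp (@cwi_fst _ _ setT) c12).
have c122 : cwi A (fun r => r.1.2.2) by apply: (cwi_comp (@cwi_snd _ _ setT) c12).
have cc : cwi A (fun r => cos r.1.1) by apply: (cwi_comp (continuous_cwi (A := setT) (@continuous_cos R))).
have cs : cwi A (fun r => sin r.1.1) by apply: (cwi_comp (continuous_cwi (A := setT) (@continuous_sin R))).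
have cf : cwi A (fun r => frame p r.1.1 r.1.2).
  have cst (c : R) : cwi A (fun=> c) by exact: cwi_cst.
  apply: cwi_pair.
    by apply: cwiD; apply: cwiM => //; apply: cwiB.
  by apply: cwiD; apply: cwiM => //; (try apply: cwiN); apply: cwiB.
have cf2 : cwi A (fun r => (frame p r.1.1 r.1.2).2) by apply: (cwi_comp (@cwi_snd _ _ setT) cf).
have cn := outward_normal_continuous oO sO.
have cn' : cwi A (fun r => outward_normal Omega r.1.2) by apply: (cwi_comp cn c12) => r [[]].
have cn1 : cwi A (fun r => (outward_normal Omega r.1.2).1) by apply: (cwi_comp (@cwi_fst _ _ setT) cn').
have cn2 : cwi A (fun r => (outward_normal Omega r.1.2).2) by apply: (cwi_comp (@cwi_snd _ _ setT) cn').
have cu (g : R * R * R -> R) : cwi (closure Q) g -> cwi A (fun r => g (r.1.2, t + (frame p r.1.1 r.1.2).2 * r.2)).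
  move=> cg; apply: (cwi_comp cg); last by move=> r [[_ [br _]] _]; rewrite closure_cylinder.
  by apply: cwi_pair => //; apply: cwiD; [exact: cwi_cst|exact: cwiM].
have [_ cux cuy _ _] := Cu.
apply: (@cwi_param _ _ _ (-1) 1 (fun r => kW k (frame p r.1.1 r.1.2, (frame p r.1.1 r.1.2).2 * r.2) *
  normal_slope r.1.2 (t + (frame p r.1.1 r.1.2).2 * r.2))).
apply: cwiM; first by apply: kW_cwi; apply: cwi_pair => //; exact: cwiM.
by apply: cwiD; apply: cwiM => //; exact: cu.
Qed.

End ConeIdentity.

Section StripLimit.
Context {R : realType}.
Local Notation mu := (@lebesgue_measure R).
Local Notation mu2 := (mu \x mu)%E.

(** The functions [dramp e] form an approximate identity in [Y]: they are non-negative, have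
    integral 1 and vanish outside [[0, e]]. It acts on the integrals of [T] along horizontal lines,
    which are continuous in [Y]. *)
Lemma strip_limit (O : set (R * R)) (T : R * R -> R) (L eps : R) : open O -> O `<=` square L -> 0 < L ->
  continuous (T \_ O) -> 0 < eps ->
  exists2 d, 0 < d & forall e, 0 < e < d ->
    `|\int[mu2]_(z in O) (dramp e z.2 * T z) - \int[mu]_(x in `[- L, L]) ((T \_ O) (x, 0))| <= eps.
Proof.
move=> oO OL L0 cT eps0; set T0 := T \_ O; have c0 (A : set (R * R)) : cwi A T0 by exact: continuous_cwi.
pose Phi (y : R) := \int[mu]_(x in `[- L, L]) T0 (x, y).
have cPhi : cwi setT Phi.
  apply: (@cwi_param _ _ setT (- L) L (fun r : R * R => T0 (r.2, r.1))).
  by apply: (cwi_comp (c0 setT)) => //; apply: cwi_pair; [exact: cwi_snd|exact: cwi_fst].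
have near0 : \forall y \near (0 : R), `|Phi 0 - Phi y| <= eps.
  by have /cvgrPdist_le := cwi_setT cPhi (x := 0); apply.
have /nbhs_ballP[d /= d0 Hd] := near0.
exists (Num.min d L); first by rewrite lt_min d0.
move=> e /andP[e0]; rewrite lt_min => /andP[ed eL].
have cde (A : set R) : cwi A (dramp e) by apply: continuous_cwi; exact: dramp_continuous.
have -> : \int[mu2]_(z in O) (dramp e z.2 * T z) = \int[mu]_(y in `[- L, L]) (dramp e y * Phi y).
  transitivity (\int[mu2]_z ((fun z => dramp e z.2 * T0 z) \_ (square L)) z).
    rewrite Rintegral_mkcond; apply: eq_Rintegral => z _; rewrite !patchE /T0 patchE.
    case: ifPn => Oz; first by rewrite mem_set//; apply: OL; move: Oz; rewrite inE.
    by rewrite mulr0; case: ifP.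
  have cf : cwi setT (fun z : R * R => dramp e z.2 * T0 z).
    by apply: cwiM => //; apply: (cwi_comp (cde setT)) => //; exact: cwi_snd.
  rewrite square_integral; last exact: cwi_sub cf.
  rewrite (rectangle_Fubini (f := fun z => dramp e z.2 * T0 z)); last exact: cwi_sub cf.
  apply: eq_Rintegral => y _; rewrite -RintegralZl//; apply: cwi_itv_integrable.
  by apply: (cwi_comp (c0 setT)) => //; apply: cwi_pair; [exact: cwi_id|exact: cwi_cst].
have -> : \int[mu]_(x in `[- L, L]) T0 (x, 0) = \int[mu]_(y in `[- L, L]) (dramp e y * Phi 0).
  by rewrite RintegralZr ?dramp_integral ?mul1r ?ltW//; apply: cwi_itv_integrable.
have cP (A : set R) : cwi A Phi by exact: cwi_sub cPhi.
have iv (f : R -> R) : cwi `[- L, L]%classic f -> mu.-integrable `[- L, L] (EFin \o f) by exact: cwi_itv_integrable.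
rewrite -RintegralB//; last 2 first.
- by apply: iv; exact: cwiM.
- by apply: iv; apply: cwiM => //; exact: cwi_cst.
have cdiff : cwi `[- L, L]%classic (fun y => dramp e y * Phi y - dramp e y * Phi 0).
  by apply: cwiB; apply: cwiM => //; exact: cwi_cst.
apply: (le_trans (le_normr_Rintegral _ _)) => //; first exact: iv.
have -> : eps = \int[mu]_(y in `[- L, L]) (eps * dramp e y).
  by rewrite RintegralZl ?dramp_integral ?mulr1 ?ltW//; apply: iv.
apply: le_Rintegral => //.
- by have := integrable_norm (iv _ cdiff); apply: eq_integrable.
- by apply: iv; apply: cwiM => //; exact: cwi_cst.
move=> y _; rewrite -mulrBr normrM ger0_norm ?dramp_ge0// mulrC.
have [y0|y0] := leP y 0; first by have [_ ->] := ramp0 e0 y0; rewrite !mulr0.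
have [ye|ye] := leP e y; first by have [_ ->] := ramp1 e0 ye; rewrite !mulr0.
apply: ler_wpM2r; first exact: dramp_ge0.
rewrite distrC; apply: Hd; rewrite /ball/= sub0r normrN gtr0_norm//; exact: lt_trans ed.
Qed.

End StripLimit.

Section ConeIdentity.
Context {R : realType}.
Local Notation mu := (@lebesgue_measure R).
Local Notation mu2 := (mu \x mu)%E.
Context (Omega : set (R * R)) (oO : open Omega) (kO : compact (closure Omega)).
Context (sO : smooth_boundary Omega) (neO : Omega !=set0).
Local Notation bd := (boundary Omega).
Local Notation sigma := (arc_length bd).
Local Notation Q := (cylinder Omega).
Context (u ux uy ut uxx uxy uxt uyx uyy uyt utx uty utt : R * R * R -> R).
Context (Cu : C1c Q u ux uy ut) (Cx : C1c Q ux uxx uxy uxt) (Cy : C1c Q uy uyx uyy uyt).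
Context (Ct : C1c Q ut utx uty utt).
Context (wave : forall z, Q z -> utt z = uxx z + uyy z).
Context (dir : forall q s, bd q -> u (q, s) = 0).
Context (k : R) (p : R * R) (t al : R).

Local Notation O' := (moved Omega p al).
Local Notation m := (motion p t al).
Local Notation fr := (frame p al).
Local Notation U := (fun z => u (m z)).
Local Notation UX := (fun z => cos al * ux (m z) + sin al * uy (m z)).
Local Notation UY := (fun z => - sin al * ux (m z) + cos al * uy (m z)).

Lemma motion_frame q s : m (fr q, s) = (q, t + s).
Proof. by rewrite /motion/= frameK. Qed.

Lemma closure_moved_cwi (f : R * R * R -> R) : cwi (closure Q) f -> cwi (cylinder (closure O')) (fun z => f (m z)).
Proof.
move=> cf; apply: (cwi_comp cf); last first.
  by move=> z [cz _]; rewrite closure_cylinder; split => //=; move: cz; rewrite closure_moved.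
apply: cwi_pair; last by apply: cwiD; [exact: cwi_cst|exact: cwi_snd].
have cr : cwi setT (rigid_motion p al) by apply: continuous_cwi; exact: rigid_continuous.
by apply: (cwi_comp cr) => //; exact: cwi_fst.
Qed.

(** On the boundary [u] vanishes at all times, so the trace and the terms [u grad W] disappear; the
    product with the normal does not depend on the axes. *)
Lemma flux_normal q : bd q ->
  flux1 k U UX (fr q) * (rotate_axes al (outward_normal Omega q)).1 +
  flux2 k U UY (fr q) * (rotate_axes al (outward_normal Omega q)).2 =
  (fr q).2 * cone_mean Omega ux uy k p t al q.
Proof.
move=> bq; rewrite /flux1 /flux2 /trace; have [cq _] := bq.
have cfq : closure O' (fr q) by rewrite closure_moved /= frameK.
have U0 s : U (fr q, s) = 0 by rewrite /= motion_frame dir.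
rewrite !U0 !mulr0 addr0 !mulr0 addr0 mul1r.
have [_ cx cy _ _] := Cu.
set n := outward_normal Omega q; set Y := (fr q).2.
have coneE G kD : cone (green k U G kD) (fr q) = \int[mu]_(c in `[-1, 1]) (Y * (kW k (fr q, Y * c) * G (fr q, Y * c))).
  apply: eq_Rintegral => c _; congr (_ * _); rewrite /green U0 mul0r mulr0 addr0 mul1r.
  by [].
rewrite !coneE.
have ciX : cwi `[(-1 : R), 1]%classic (fun c => ux (m (fr q, Y * c))).
  by apply: (slice_cwi (F := fun z => ux (m z)) (O := closure O')) => //; exact: closure_moved_cwi.
have ciY : cwi `[(-1 : R), 1]%classic (fun c => uy (m (fr q, Y * c))).
  by apply: (slice_cwi (F := fun z => uy (m z)) (O := closure O')) => //; exact: closure_moved_cwi.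
have ciW : cwi `[(-1 : R), 1]%classic (fun c => kW k (fr q, Y * c)).
  by apply: kW_cwi; apply: cwi_pair; [exact: cwi_cst|apply: cwiM; [exact: cwi_cst|exact: cwi_id]].
have cst (a : R) : cwi `[(-1 : R), 1]%classic (fun=> a) by exact: cwi_cst.
have iX : cwi `[(-1 : R), 1]%classic (fun c => Y * (kW k (fr q, Y * c) * (cos al * ux (m (fr q, Y * c)) + sin al * uy (m (fr q, Y * c))))).
  by apply: cwiM => //; apply: cwiM => //; apply: cwiD; exact: cwiM.
have iY : cwi `[(-1 : R), 1]%classic (fun c => Y * (kW k (fr q, Y * c) * (- sin al * ux (m (fr q, Y * c)) + cos al * uy (m (fr q, Y * c))))).
  by apply: cwiM => //; apply: cwiM => //; apply: cwiD; exact: cwiM.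
rewrite -!RintegralZr//; try exact: cwi_itv_integrable.
rewrite -RintegralD//; try by apply: cwi_itv_integrable; exact: cwiM.
rewrite /cone_mean -/Y -RintegralZl//; last first.
  apply: cwi_itv_integrable; apply: cwiM => //; apply: cwiD; apply: cwiM => //.
    by apply: cwi_eq ciX => c _; rewrite motion_frame.
  by apply: cwi_eq ciY => c _; rewrite motion_frame.
apply: eq_Rintegral => c _; rewrite motion_frame /normal_slope -/n /rotate_axes/=.
set a := ux _; set b := uy _; set w := kW k _.
transitivity (Y * (w * ((a * n.1 + b * n.2) * (cos al ^+ 2 + sin al ^+ 2)))); first by ring.
by rewrite cos2Dsin2 mulr1.
Qed.

Lemma cone_mean_cwi : cwi bd (cone_mean Omega ux uy k p t al).
Proof.
have H := @cone_mean_continuous R Omega oO sO u ux uy ut Cu k p t.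
apply: (cwi_comp H (g := fun q => (al, q))); last by [].
by apply: cwi_pair; [exact: cwi_cst|exact: cwi_id].
Qed.

(** The ramped boundary integral is [C - Tr]: the strip integral [C] of the cone part is small, and
    the strip integral [Tr] of the trace approaches the line integral. Both errors and the removal
    of the ramp are bounded for one small [e]. *)
Lemma cone_identity (L : R) : 0 < L -> O' `<=` square L ->
  \int[sigma]_(q in bd) angular Omega ux uy k p t al q =
  - \int[mu]_(x in `[- L, L]) ((2 * trace_weight k x) * ((fun q => u (q, t)) \_ Omega) (rigid_motion p al (x, 0))).
Proof.
move=> L0 OL.
have oO' : open O' by exact: open_moved.
have kO' : compact (closure O') by exact: compact_closure_moved.
have kbd : compact bd by exact: compact_boundary.
have mbd : measurable (bd : set (plane (R := R))) by exact: compact_plane_measurable.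
have mO' : measurable (O' : set (plane (R := R))) by exact: open_plane_measurable.
have CU := C1c_motion oO p t al Cu.
have CX := C1c_lin (cos al) (sin al) (C1c_motion oO p t al Cx) (C1c_motion oO p t al Cy).
have CY := C1c_lin (- sin al) (cos al) (C1c_motion oO p t al Cx) (C1c_motion oO p t al Cy).
have CS := C1c_motion oO p t al Ct.
have [|f1X [f1Y [f2X [f2Y [B1 B2 div0]]]]] := flux_divergence_free oO' k CU CX CY CS.
  move=> z Oz; rewrite wave; last by case: Oz.
  set a := uxx _; set b := uxy _; set c := uyx _; set d := uyy _.
  by transitivity ((a + d) * (cos al ^+ 2 + sin al ^+ 2)); [rewrite cos2Dsin2 mulr1|ring].
have [M M0 HM] := cwi_bounded kbd cone_mean_cwi.
have cfr2 : cwi bd (fun q => (fr q).2).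
  by apply: (cwi_comp (@cwi_snd _ _ setT)); last (by []); apply: continuous_cwi; exact: frame_continuous.
have cmax : cwi bd (fun q => Num.max (fr q).2 0).
  by under eq_fun do rewrite maxC; apply: (cwi_comp (continuous_cwi (A := setT) (@maxr0_continuous R))).
have cang : cwi bd (angular Omega ux uy k p t al) by apply: cwiM => //; exact: cone_mean_cwi.
have cgr : cwi (cylinder (closure O')) (green k U UY (kWy k)).
  have [_ _ [cK _ _ _ _] _] := kernel_C1c k; rewrite closureT in cK.
  have [c0 _ _ _ _] := CU; have [c0' _ _ _ _] := CY; rewrite closure_cylinder in c0 c0'.
  have cst (a : R) : cwi (cylinder (closure O')) (fun=> a) by exact: cwi_cst.
  apply: cwiD; apply: cwiM => //; apply: cwiM => //; first by apply: kW_cwi; exact: cwi_id.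
  by apply: cwi_sub cK.
have cG : cwi (closure O') (cone (green k U UY (kWy k))).
  exact: (cone_continuous cgr).
(* The fibre over a point of height [Y] has length [2 |Y|], hence a bound linear in the height. *)
have [M2 M20 HM2] : exists2 M2, 0 <= M2 & forall z, closure O' z -> `|cone (green k U UY (kWy k)) z| <= M2 * `|z.2|.
  have [B B0 HB] := cwi_bounded (compact_setX kO' (@segment_compact R (-1) 1)) (cone_slice cgr).
  exists (B * 2) => [|z cz]; first by rewrite mulr_ge0.
  have := @Rintegral_itv_bound R (-1) 1 (B * `|z.2|) (fun c => z.2 * green k U UY (kWy k) (z, z.2 * c)).
  have -> : (1 - -1 : R) = 2 by ring.
  rewrite mulrAC; apply; first by lra.
    by apply: cwiM; [exact: cwi_cst|exact: (slice_cwi cgr)].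
  move=> c cI; rewrite normrM mulrC; apply: ler_wpM2r => //.
  by apply: (HB (z, c)); split => //=; rewrite in_itv.
(* By the Dirichlet condition the trace vanishes on the boundary, so the strip limit applies however
   the line [Y = 0] meets the boundary. *)
have cTr : continuous (trace k U \_ O').
  apply: zero_extension_continuous => //.
    by have [] := C1bar_mul (C1bar_trace_weight O' k) (C1bar_lin 1 1 (C1bar_diag oO' 1 CU) (C1bar_diag oO' (-1) CU)).
  move=> z [cz nz]; have bz : bd (rigid_motion p al z).
    split; first by move: cz; rewrite closure_moved.
    by move=> /interior_subset iz; apply: nz; move/interior_id: oO' => ->.
  by rewrite /trace /motion/= !dir// !mulr0 addr0 mulr0.
have TrE x : (trace k U \_ O') (x, 0) = (2 * trace_weight k x) * ((fun q => u (q, t)) \_ Omega) (rigid_motion p al (x, 0)).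
  rewrite !patchE; have -> : ((x, 0 : R) \in O') = (rigid_motion p al (x, 0) \in Omega) by apply/idP/idP; rewrite !inE.
  case: ifPn => _; last by rewrite mulr0.
  by rewrite /trace /motion/= !mulr0 addr0; ring.
under [in RHS]eq_Rintegral => x _ do rewrite -TrE.
apply/eqP; rewrite -subr_eq0 opprK -normr_le0; apply/ler_addgt0Pr => eps eps0; rewrite add0r.
pose S := fine (sigma bd).
have [d d0 Hd] := strip_limit oO' OL L0 cTr (divr_gt0 eps0 (ltr0Sn R 1)).
(* [e * B] bounds the two errors of order [e]: [e * M * S] from the ramp in the boundary integral
   and [2 * L * (e * M2)] from the cone part. The summand 1 makes [B] positive. The strip limit
   takes the other [eps / 2]. *)
pose B := M * S + 2 * L * M2 + 1.
have S0 : 0 <= S by rewrite fine_ge0// measure_ge0.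
have B0 : 0 < B by rewrite ltr_wpDl ?addr_ge0 ?mulr_ge0 // ltW.
pose e := Num.min (d / 2) (Num.min L (eps / 2 / B)).
have e0 : 0 < e by rewrite !lt_min L0 !divr_gt0.
have ed : e < d by rewrite gt_min ltr_pdivrMr// ltr_pMr// ltr1n.
have eL : e <= L by rewrite !ge_min lexx orbT.
have eB : e * B <= eps / 2 by rewrite -ler_pdivlMr// !ge_min lexx !orbT.
have {Hd} := Hd e; rewrite e0 ed => /(_ isT).
set P0 := \int[mu]_(x in _) _; set Tr := \int[mu2]_(z in _) _ => HT.
have id := ramp_identity oO kO sO neO e0 B1 B2 div0.
set A := \int[sigma]_(q in bd) angular _ _ _ _ _ _ _ _.
pose A' := \int[sigma]_(q in bd) ((ramp e (fr q).2 * (fr q).2) * cone_mean Omega ux uy k p t al q).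
have cramp : cwi bd (fun q => ramp e (fr q).2 * (fr q).2).
  by apply: cwiM => //; apply: (cwi_comp (continuous_cwi (A := setT) (@ramp_continuous R e))).
have HA : `|A - A'| <= e * M * S.
  rewrite /A /A' -RintegralB//; last 2 first.
  - exact: (boundary_integrable oO kO sO neO cang).
  - by apply: (boundary_integrable oO kO sO neO); apply: cwiM => //; exact: cone_mean_cwi.
  apply: Rintegral_bound => //.
  - exact: (boundary_length_lty oO kO sO neO).
  - by apply: (boundary_integrable oO kO sO neO); apply: cwiB => //; apply: cwiM => //; exact: cone_mean_cwi.
  move=> q bq; rewrite /angular -mulrBl normrM distrC; apply: ler_pM => //; [exact: ramp_linear|exact: HM].
pose C := \int[mu2]_(z in O') (dramp e z.2 * cone (green k U UY (kWy k)) z).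
have cdr (D : set (R * R)) : cwi D (fun z : R * R => dramp e z.2).
  by apply: (cwi_comp (continuous_cwi (A := setT) (@dramp_continuous R e))) => //; exact: cwi_snd.
have iC : mu2.-integrable O' (EFin \o (fun z => dramp e z.2 * cone (green k U UY (kWy k)) z)).
  by apply: (cwi_domain_integrable oO' kO'); exact: cwiM.
have ctr : cwi (closure O') (trace k U).
  by have [] := C1bar_mul (C1bar_trace_weight O' k) (C1bar_lin 1 1 (C1bar_diag oO' 1 CU) (C1bar_diag oO' (-1) CU)).
have iT : mu2.-integrable O' (EFin \o (fun z => dramp e z.2 * trace k U z)).
  by apply: (cwi_domain_integrable oO' kO'); exact: cwiM.
have HC : `|C| <= 2 * L * (e * M2).
  have -> : 2 * L * (e * M2) = 2 * L * (e * M2 * \int[mu]_(y in `[- L, L]) dramp e y) by rewrite dramp_integral// mulr1.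
  apply: Rintegral_dominated => //.
  - exact: ltW.
  - exact: dramp_continuous.
  - by move=> y; exact: dramp_ge0.
  - move=> z Oz; rewrite normrM ger0_norm ?dramp_ge0// mulrC.
    have [y0|y0] := leP z.2 0; first by have [_ ->] := ramp0 e0 y0; rewrite !mulr0.
    have [ye|ye] := leP e z.2; first by have [_ ->] := ramp1 e0 ye; rewrite !mulr0.
    apply: ler_wpM2r; first exact: dramp_ge0.
    apply: (le_trans (HM2 _ (subset_closure Oz))); rewrite mulrC; apply: ler_wpM2r => //.
    by rewrite gtr0_norm// ltW.
  - by rewrite mulr_ge0// ltW.
have E : A' = C - Tr.
  transitivity (\int[mu2]_(z in O') (dramp e z.2 * flux2 k U UY z)).
    by rewrite id; apply: eq_Rintegral => q; rewrite inE => bq; rewrite flux_normal// mulrA.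
  by rewrite /C /Tr -RintegralB//; apply: eq_Rintegral => z _; rewrite /flux2; ring.
have -> : A + P0 = (A - A') + C - (Tr - P0) by rewrite E; ring.
rewrite (le_trans (ler_normB _ _))//; have := ler_normD (A - A') C.
have : e * B = e * M * S + 2 * L * (e * M2) + e by rewrite /B; ring.
by move: HA HC HT eB e0; lra.
Qed.

End ConeIdentity.

(** * Averaging over the angle *)

Section InnerIntegral.
Context {R : realType}.
Local Notation mu := (@lebesgue_measure R).
Local Notation plane := (@plane R).
Local Notation mu2 := (mu \x mu)%E.

Lemma Rintegral_affine (a m c d : R) (f : R -> R) : 0 <= m -> c <= d ->
  cwi `[a + c * m, a + d * m]%classic f ->
  \int[mu]_(x in `[a + c * m, a + d * m]) f x = m * \int[mu]_(s in `[c, d]) f (a + s * m).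
Proof.
move=> m0 cd cf; have mono s r : s <= r -> a + s * m <= a + r * m.
  by move=> sr; rewrite lerD2l; apply: ler_wpM2r.
have cg : cwi `[c, d]%classic (fun s => f (a + s * m)).
  apply: (cwi_comp cf).
    by apply: cwiD; [exact: cwi_cst|apply: cwiM; [exact: cwi_id|exact: cwi_cst]].
  by move=> s /=; rewrite !in_itv/= => /andP[cs sd]; rewrite !mono.
have [m1|m1] := eqVneq m 0.
  rewrite m1 mul0r !mulr0 addr0; apply/eqP; rewrite -normr_le0.
  rewrite -[leRHS](mulr0 `|f a|) -[X in _ <= _ * X](subrr a).
  apply: Rintegral_itv_bound => //; first by move: cf; rewrite m1 !mulr0 addr0.
  by move=> x /le_anti <-.
have mp : 0 < m by rewrite lt_neqAle eq_sym m1.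
have dxi (s : R) : is_derive s 1 (fun s => a + s * m) m by exact: affine_derive.
have [E _] := image_monotone cd dxi (fun _ _ => mp).
have cm : continuous (fun _ : R => m) by move=> x; exact: cvg_cst.
rewrite -E in cf; have H := substitution_increasing cd dxi cm (fun _ _ => mp) cf.
transitivity (\int[mu]_(s in `[c, d]) (f (a + s * m) * m)); last first.
  rewrite [RHS]mulrC; apply: RintegralZr; [exact: measurable_itv|exact: cwi_itv_integrable].
by rewrite /Rintegral -H E.
Qed.

Lemma coord_le_enorm (v : R * R) : `|v.2| <= enorm v.
Proof. by rewrite /enorm -sqrtr_sqr ler_wsqrtr// lerDr sqr_ge0. Qed.

Context (Omega : set (R * R)) (oO : open Omega) (kO : compact (closure Omega)).
Context (sO : smooth_boundary Omega).
Local Notation bd := (boundary Omega).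
Local Notation Q := (cylinder Omega).
Context (u ux uy ut : R * R * R -> R) (Cu : C1c Q u ux uy ut).
Context (p : R * R) (t : R).

Lemma frame_angle_continuous (A : set R) q : cwi A (fun al => frame p al q).
Proof.
have cc : cwi A (@cos R) by apply: continuous_cwi; exact: continuous_cos.
have cs : cwi A (@sin R) by apply: continuous_cwi; exact: continuous_sin.
have cst (a : R) : cwi A (fun _ : R => a) by exact: cwi_cst.
by apply: cwi_pair; apply: cwiD; apply: cwiM.
Qed.

(** Fubini in time and angle over the region where the rotated kernel is non-zero. For a fixed angle
    the time slice is [[t - Y, t + Y]], or empty when [Y < 0], and [s = t + Y c] turns it into
    [angular]. *)
Lemma kernel_slope_integral (h : R) (q : R * R) : bd q ->
  \int[mu]_(s in `[t - enorm (q - p), t + enorm (q - p)])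
    (V_h h (q.1 - p.1) (q.2 - p.2) (s - t) * normal_derivative Omega u q s) =
  - (kernel_scale h / (2 * pi)) * \int[mu]_(al in `[- pi, pi]) angular Omega ux uy h^-1 p t al q.
Proof.
move=> bq; set K := kernel_scale h; set k := h^-1; set tau := enorm _.
pose N s := normal_slope Omega ux uy q s.
have cN : cwi setT N.
  have [_ cx cy _ _] := Cu; have cq (g : R * R * R -> R) : cwi (closure Q) g -> cwi setT (fun s => g (q, s)).
    move=> cg; apply: (cwi_comp cg); first by apply: cwi_pair; [exact: cwi_cst|exact: cwi_id].
    by move=> s _; rewrite closure_cylinder; split => //; case: bq.
  by apply: cwiD; apply: cwiM; (try exact: cwi_cst); exact: cq.
pose f1 (r : R * R) := - (K * kW k (frame p r.2 q, r.1 - t)).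
have cfr : cwi setT (fun r : R * R => frame p r.2 q).
  apply: (@cwi_comp _ _ _ setT setT snd (fun al => frame p al q)) => //; first exact: frame_angle_continuous.
  exact: cwi_snd.
have cs : cwi setT (fun r : R * R => r.1 - t) by apply: cwiB; [exact: cwi_fst|exact: cwi_cst].
have cf1 : cwi setT f1.
  by apply: cwiN; apply: cwiM; [exact: cwi_cst|apply: kW_cwi; exact: cwi_pair].
pose D : set (R * R) := [set r | `|r.1 - t| <= (frame p r.2 q).2 /\ - pi <= r.2 <= pi].
pose B : set (R * R) := `[t - tau, t + tau]%classic `*` `[- pi, pi]%classic.
(* The next inclusion is where the radius of the time window comes from: [Y] is a coordinate of
   [q - p] in turned axes, hence at most [enorm (q - p)]. *)
have kB : compact B by apply: compact_setX; exact: segment_compact.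
have DB : D `<=` B.
  move=> [s al] [h1 h2]; split; rewrite /= in_itv//= -ler_distl.
  apply: (le_trans h1); apply: le_trans (ler_norm _) _.
  by rewrite /tau -(enorm_rotate al); exact: coord_le_enorm.
have mD : measurable (D : set plane).
  apply: closed_plane_measurable.
  have -> : D = (fun r => (frame p r.2 q).2 - `|r.1 - t|) @^-1` [set y | 0 <= y] `&` (@snd R R) @^-1` `[- pi, pi]%classic.
    by apply/seteqP; split => -[s al] /= [h1 h2]; split; move: h1 h2; rewrite /= ?subr_ge0 ?in_itv.
  apply: closedI; apply: closed_comp.
  - move=> r _; apply: cwi_setT; apply: cwiB; first by apply: (cwi_comp (@cwi_snd _ _ setT) cfr).
    by apply: (cwi_comp (continuous_cwi (A := setT) (@norm_continuous R R))).
  - exact: closed_ge.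
  - by move=> r _; exact: cvg_snd.
  - exact: itv_closed.
have [L1 [M1 [_ _ bs1]]] := patch_bounded_support kB mD DB (cwi_sub (@subsetT _ B) cf1).
pose f (r : R * R) := (2 * pi)^-1 * (f1 r * N r.1).
have cf : cwi setT f.
  apply: cwiM; first exact: cwi_cst.
  by apply: cwiM => //; apply: (cwi_comp cN) => //; exact: cwi_fst.
have [L2 [M2 [_ _ bs2]]] := patch_bounded_support kB mD DB (cwi_sub (@subsetT _ B) cf).
have fE s al : (f \_ D) (s, al) = (2 * pi)^-1 * N s * (f1 \_ D) (s, al).
  by rewrite !patchE; case: ifP => _; [rewrite /f/=; ring|rewrite mulr0].
have VE s : V_h h (q.1 - p.1) (q.2 - p.2) (s - t) = (2 * pi)^-1 * \int[mu]_al (f1 \_ D) (s, al).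
  rewrite /V_h Rintegral_mkcond; congr (_ * _); apply: eq_Rintegral => al _.
  rewrite !patchE mem_setE in_itv/=; case: ifPn => al1; last first.
    by rewrite memNset// => -[_ /= al2]; rewrite al2 in al1.
  rewrite /v_h_rot v_hE; case: ifPn => h1.
    by rewrite mem_set//= /f1/= -/K -/k /frame; congr (- (_ * kW _ (_, _))); case: rotate_axes.
  by rewrite memNset// => -[/= h2 _]; move: h1; rewrite h2.
transitivity (\int[mu]_s \int[mu]_al (f \_ D) (s, al)).
  rewrite Rintegral_mkcond; apply: eq_Rintegral => s _; rewrite patchE mem_setE in_itv/=.
  have EN : \int[mu]_al (f \_ D) (s, al) = (2 * pi)^-1 * N s * \int[mu]_al (f1 \_ D) (s, al).
    rewrite -RintegralZl//; last exact: bounded_support_section1 bs1.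
    by apply: eq_Rintegral => al _; exact: fE.
  case: ifPn => sI; first by rewrite VE (normal_derivativeE oO sO s Cu bq) EN mulrAC.
  rewrite (_ : (fun al => _) = cst 0) ?Rintegral_cst ?mul0r//.
  by apply/funext => al; rewrite patchE memNset// => /DB[/=]; rewrite in_itv/= (negbTE sI).
rewrite (bounded_support_Fubini bs2) -RintegralZl//; last first.
  apply: cwi_itv_integrable; apply: cwiM; last first.
    apply: (cwi_comp (cone_mean_continuous oO sO Cu (k := k) (p := p) (t := t)) (g := fun al => (al, q))); last by [].
    by apply: cwi_pair; [exact: cwi_id|exact: cwi_cst].
  have c2 : cwi `[- pi, pi]%classic (fun al => (frame p al q).2).
    apply: (cwi_comp (@cwi_snd _ _ setT) (g := fun al => frame p al q)) => //.
    exact: frame_angle_continuous.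
  have := cwi_comp (continuous_cwi (A := setT) (@maxr0_continuous R)) c2 (fun _ _ => I).
  by apply: cwi_eq => al _; rewrite maxC.
rewrite [RHS]Rintegral_mkcond; apply: eq_Rintegral => al _; rewrite patchE mem_setE in_itv/=.
case: ifPn => al1; last first.
  rewrite (_ : (fun s => _) = cst 0) ?Rintegral_cst ?mul0r//.
  by apply/funext => s; rewrite patchE memNset// => -[_ /= al2]; rewrite al2 in al1.
set Y := (frame p al q).2; rewrite /angular -/Y.
have [Y0|Y0] := leP 0 Y; last first.
  rewrite mul0r mulr0 (_ : (fun s => _) = cst 0) ?Rintegral_cst ?mul0r//.
  apply/funext => s; rewrite patchE memNset// => -[/= h1 _].
  by have := le_lt_trans h1 Y0; rewrite normr_lt0.
transitivity (\int[mu]_(s in `[t + -1 * Y, t + 1 * Y]) f (s, al)).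
  rewrite [RHS]Rintegral_mkcond; apply: eq_Rintegral => s _; rewrite !patchE mem_setE in_itv/= mulN1r mul1r -ler_distl.
  have [h1|h1] := boolP (`|s - t| <= Y); first by rewrite mem_set.
  by rewrite memNset// => -[/= h2 _]; rewrite h2 in h1.
have cfs (A : set R) : cwi A (fun s => f (s, al)).
  by apply: (cwi_comp cf) => //; apply: cwi_pair; [exact: cwi_id|exact: cwi_cst].
have l11 : (-1 : R) <= 1 by lra.
rewrite (Rintegral_affine Y0 l11 (cfs _)).
rewrite mulrCA; congr (_ * _).
rewrite -RintegralZl//; last first.
  apply: cwi_itv_integrable; apply: cwiM.
    by apply: kW_cwi; apply: cwi_pair; [exact: cwi_cst|apply: cwiM; [exact: cwi_cst|exact: cwi_id]].
  apply: (cwi_comp cN (g := fun c => t + Y * c)) => //.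
  by apply: cwiD; [exact: cwi_cst|apply: cwiM; [exact: cwi_cst|exact: cwi_id]].
apply: eq_Rintegral => c _; rewrite /f /f1 /= [c * Y]mulrC addrAC subrr add0r -/K -/k /N; move: (2 * pi)^-1 => c2; ring.
Qed.

End InnerIntegral.

Section BoundaryFubini.
Context {R : realType}.
Local Notation mu := (@lebesgue_measure R).
Context (Omega : set (R * R)) (oO : open Omega) (kO : compact (closure Omega)).
Context (sO : smooth_boundary Omega) (neO : Omega !=set0).
Local Notation bd := (boundary Omega).
Local Notation sigma := (arc_length bd).

(** Through the atlas this becomes Fubini on one rectangle for each chart. *)
Lemma boundary_Fubini (a b : R) (F : R * (R * R) -> R) : cwi (setT `*` bd) F ->
  \int[sigma]_(q in bd) \int[mu]_(al in `[a, b]) F (al, q) =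
  \int[mu]_(al in `[a, b]) \int[sigma]_(q in bd) F (al, q).
Proof.
move=> cF; have [s [c [vc tot]]] := exists_atlas oO kO sO neO.
have cFq : cwi (bd `*` `[a, b]%classic) (fun r => F (r.2, r.1)).
  by apply: (cwi_comp cF); [apply: cwi_pair; [exact: cwi_snd|exact: cwi_fst]|move=> [q al] []].
have cint : cwi bd (fun q => \int[mu]_(al in `[a, b]) F (al, q)).
  exact: (cwi_param (f := fun r => F (r.2, r.1)) cFq).
have cFa al : cwi bd (fun q => F (al, q)).
  by apply: (cwi_comp cF); [apply: cwi_pair; [exact: cwi_cst|exact: cwi_id]|].
have [-> _] := boundary_integral_atlas oO kO sO neO vc tot cint.
pose I i : set R := `[c_x (c i) - c_r (c i), c_x (c i) + c_r (c i)]%classic.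
pose G i al := \int[mu]_(x in I i) (F (al, chart_curve (c i) x) * arc_density s c i x).
transitivity (\int[mu]_(al in `[a, b]) \sum_(i <- s) G i al); last first.
  apply: eq_Rintegral => al _.
  by have [-> _] := boundary_integral_atlas oO kO sO neO vc tot (cFa al).
have chartwise i : mu.-integrable `[a, b] (EFin \o G i) /\
    \int[mu]_(x in I i) ((\int[mu]_(al in `[a, b]) F (al, chart_curve (c i) x)) * arc_density s c i x) =
    \int[mu]_(al in `[a, b]) G i al.
  have [bch|[h _]] := valid_chart_cases oO (vc i); last first.
    have d0 x : arc_density s c i x = 0 by rewrite /arc_density /weight h !mul0r.
    have z0 (f : R -> R) : \int[mu]_(x in I i) (f x * arc_density s c i x) = 0.
      rewrite (_ : (fun x => _) = cst 0) ?Rintegral_cst ?mul0r//; first exact: measurable_itv.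
      by apply/funext => x; rewrite d0 mulr0.
    have G0 : G i = cst 0 by apply/funext => al; exact: z0.
    rewrite G0 z0 Rintegral_cst ?mul0r//; split => //; exact: integrable0.
  have Ibd x : I i x -> bd (chart_curve (c i) x) by rewrite /I/= in_itv/=; exact: bch.
  have [[sp _] _ _] := vc i.
  have cg : cwi (I i) (chart_curve (c i)).
    by apply: continuous_cwi; apply: curve_continuous; exact: chart_curve_is_smooth.
  have cd := arc_density_continuous vc tot Ibd.
  have c1 : cwi (I i `*` `[a, b]%classic) (fun r : R * R => F (r.2, chart_curve (c i) r.1) * arc_density s c i r.1).
    have c0 : cwi (I i `*` `[a, b]%classic) (fun r : R * R => r.1) by exact: cwi_fst.
    apply: cwiM; last by apply: (cwi_comp cd c0) => -[x al] [].
    apply: (cwi_comp cF).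
      by apply: cwi_pair; [exact: cwi_snd|apply: (cwi_comp cg c0) => -[x al] []].
    by move=> [x al] [/= /Ibd].
  have c2 : cwi (`[a, b]%classic `*` I i) (fun r : R * R => F (r.1, chart_curve (c i) r.2) * arc_density s c i r.2).
    apply: (cwi_comp c1 (g := fun r => (r.2, r.1))); last by move=> [al x] [].
    by apply: cwi_pair; [exact: cwi_snd|exact: cwi_fst].
  split.
    apply: cwi_itv_integrable.
    exact: (cwi_param (f := fun r : R * R => F (r.1, chart_curve (c i) r.2) * arc_density s c i r.2) c2).
  rewrite -(rectangle_Fubini (f := fun r : R * R => F (r.2, chart_curve (c i) r.1) * arc_density s c i r.1) c1).
  apply: eq_Rintegral => x; rewrite inE => xI; rewrite -RintegralZr//.
  apply: cwi_itv_integrable; apply: (cwi_comp cFq (g := fun al => (chart_curve (c i) x, al))).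
    by apply: cwi_pair; [exact: cwi_cst|exact: cwi_id].
  by move=> al alI; split => //; exact: Ibd.
have [-> _] := @Rintegral_sum_seq R _ _ mu `[a, b]%classic _ s G (measurable_itv _) (fun i => (chartwise i).1).
by apply: eq_bigr => i _; exact: (chartwise i).2.
Qed.

End BoundaryFubini.

(** * Gaussian means *)

Section GaussianLimit.
Context {R : realType}.
Local Notation mu := (@lebesgue_measure R).

Definition gauss_partial (L : R) := \int[mu]_(y in `[- L, L]) expR (- y ^+ 2).

Lemma continuous_gauss (k : R) : continuous (fun y : R => expR (- (k * y ^+ 2))).
Proof.
apply: cwi_setT; apply: (cwi_comp (continuous_cwi (A := setT) (@continuous_expR R))) => //.
apply: cwiN; apply: cwiM; first exact: cwi_cst.
by under eq_fun do rewrite expr2; apply: cwiM; exact: cwi_id.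
Qed.

Lemma gauss_partial_cvg : gauss_partial L @[L --> +oo] --> Num.sqrt (pi : R).
Proof.
have c0 (A : set R) : cwi A (fun y : R => expR (- y ^+ 2)).
  by apply: cwi_eq (continuous_cwi (A := A) (@continuous_gauss 1)) => y _; rewrite mul1r.
have half (L : R) : 0 <= L -> gauss_partial L = 2 * gauss_integral_proof.integral0_gauss L.
  move=> L0; have L1 : - L <= 0 by rewrite oppr_le0.
  rewrite /gauss_partial (Rintegral_itv_cat L1 L0)//.
  rewrite /gauss_integral_proof.integral0_gauss -[2]/(1 + 1) mulrDl mul1r; congr (_ + _).
  have := @integration_by_substitution_oppr R (fun y => expR (- y ^+ 2)) 0 L L0.
  rewrite oppr0 => /(_ (continuous_subspaceT _)) H.
  rewrite /Rintegral H; last by move=> y; apply: cwi_setT.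
  by congr fine; apply: eq_integral => y _; rewrite /= sqrrN.
have H := @gauss_integral_proof.cvg_integral0_gauss_sqr R.
have : 2 * Num.sqrt (gauss_integral_proof.integral0_gauss x ^+ 2) @[x --> +oo] --> 2 * Num.sqrt (pi / 4 : R).
  apply: cvgM; first exact: cvg_cst.
  by apply: continuous_cvg H; exact: sqrt_continuous.
have -> : 2 * Num.sqrt (pi / 4 : R) = Num.sqrt pi.
  rewrite sqrtrM ?pi_ge0// sqrtrV// mulrCA (_ : Num.sqrt 4 = 2 :> R) ?mulfV ?mulr1//.
  by rewrite (_ : 4 = 2 ^+ 2) ?sqrtr_sqr ?ger0_norm// -natrX.
apply: cvg_trans; apply: near_eq_cvg; near=> L.
have L0 : 0 <= L by near: L; exact: nbhs_pinfty_ge.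
by rewrite half// sqrtr_sqr ger0_norm//; exact: gauss_integral_proof.integral0_gauss_ge0.
Unshelve. all: by end_near.
Qed.

Lemma gauss_scale (h L : R) : 0 < h -> 0 <= L ->
  \int[mu]_(x in `[- L, L]) expR (- (h^-1 * x ^+ 2)) = Num.sqrt h * gauss_partial (L / Num.sqrt h).
Proof.
move=> h0 L0; have s0 : 0 < Num.sqrt h by rewrite sqrtr_gt0.
have sn : Num.sqrt h != 0 by rewrite lt0r_neq0.
have le : - (L / Num.sqrt h) <= L / Num.sqrt h.
  by rewrite (@le_trans _ _ 0)// ?oppr_le0 divr_ge0// ltW.
have := @Rintegral_affine R 0 (Num.sqrt h) _ _ (fun x => expR (- (h^-1 * x ^+ 2))) (ltW s0) le.
rewrite !add0r mulNr divfK// => -> ; last by apply: continuous_cwi; exact: continuous_gauss.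
congr (_ * _); apply: eq_Rintegral => y _; congr (expR (- _)).
by rewrite add0r exprMn sqr_sqrtr ?ltW// mulrCA mulVf ?mulr1// lt0r_neq0.
Qed.

(** The difference of the two sides is the integral of the derivative of [- (h / 2) * x * E x], and
    the end-point terms add up to something non-positive. *)
Lemma gauss_second_moment (h L : R) : 0 < h -> 0 <= L ->
  \int[mu]_(x in `[- L, L]) (x ^+ 2 * expR (- (h^-1 * x ^+ 2))) <=
  h / 2 * \int[mu]_(x in `[- L, L]) expR (- (h^-1 * x ^+ 2)).
Proof.
move=> h0 L0; have hn : h != 0 by rewrite lt0r_neq0.
set E := fun x : R => expR (- (h^-1 * x ^+ 2)).
have cE (A : set R) : cwi A E by apply: continuous_cwi; exact: continuous_gauss.
have c2 (A : set R) : cwi A (fun x : R => x ^+ 2) by under eq_fun do rewrite expr2; apply: cwiM; exact: cwi_id.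
have cc (A : set R) (a : R) : cwi A (fun _ : R => a) by exact: cwi_cst.
have dE (x : R) : is_derive x 1 E (- (2 * h^-1 * x) * E x).
  have H : is_derive x 1 (fun x : R => - (h^-1 * x ^+ 2)) (- (2 * h^-1 * x)).
    by apply: is_derive_eq; rewrite /GRing.scale/=; ring.
  by have H1 := is_derive1_comp (is_derive_expR _) H; apply: is_derive_eq H1 _; rewrite /E /GRing.scale/=; ring.
have dF (x : R) : is_derive x 1 (fun x => x * (- (h / 2) * E x)) (x ^+ 2 * E x - h / 2 * E x).
  have H := is_derive_mul (is_derive_id x 1) (is_deriveZ (- (h / 2)) (dE x)).
  apply: is_derive_eq H _; rewrite /GRing.scale/=; move: (E x) => e.
  by rewrite -[X in 1 * X]/(- (h / 2) * e); field.
have L1 : - L <= L by rewrite (@le_trans _ _ 0)// oppr_le0.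
have := @Rintegral_FTC R (fun x => x ^+ 2 * E x - h / 2 * E x) (fun x => x * (- (h / 2) * E x)) (- L) L L1.
move=> /(_ (cwiB (cwiM (c2 _) (cE _)) (cwiM (cc _ _) (cE _))) (cwiM (@cwi_id _ _) (cwiM (cc _ _) (cE _))) (fun x _ => dF x)).
rewrite RintegralB//; last 2 first.
- by apply: cwi_itv_integrable; exact: cwiM.
- by apply: cwi_itv_integrable; exact: cwiM.
rewrite RintegralZl//; last exact: cwi_itv_integrable.
move=> I; rewrite -subr_le0 I.
have -> : L * (- (h / 2) * E L) - - L * (- (h / 2) * E (- L)) = - (L * h * E L).
  by rewrite {2}/E sqrrN -/(E L); field.
by rewrite oppr_le0 !mulr_ge0 ?expR_ge0// ltW.
Qed.

End GaussianLimit.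

Section GaussianMean.
Context {R : realType}.
Local Notation mu := (@lebesgue_measure R).
Context (T : R * R -> R) (cT : continuous T) (M : R) (TM : forall z, `|T z| <= M).
Context (p : R * R) (L : R) (L0 : 0 < L).

Lemma pi_neq0 : (pi : R) != 0.
Proof. by rewrite lt0r_neq0 ?pi_gt0. Qed.

Definition ray (al x : R) := rigid_motion p al (x, 0).
(** For [h > 0], the mass in [[- L, L]] of the normalised Gaussian of variance [h / 2]. *)
Definition gauss_mass (h : R) := gauss_partial (L / Num.sqrt h) / Num.sqrt pi.
(** For [h > 0] the weight is normalised over full lines: [2 * kernel_scale h * (2 pi) * sqrt (pi h)
    = 1]. This is the origin of the constant in [w_h]. *)
Definition gaussian_mean (h : R) := 2 * kernel_scale h *
  \int[mu]_(al in `[- pi, pi]) \int[mu]_(x in `[- L, L]) (expR (- (h^-1 * x ^+ 2)) * T (ray al x)).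

Lemma ray_coords al x : ray al x = (p.1 + x * cos al, p.2 + x * sin al).
Proof.
by rewrite /ray /rigid_motion rotate_axesNE [LHS]surjective_pairing; congr pair => /=; ring.
Qed.

Lemma ray_integrand_continuous : cwi setT (fun r : R * R => T (ray r.1 r.2)).
Proof.
apply: (cwi_comp (continuous_cwi (A := setT) cT)) => //.
apply: (@cwi_eq _ _ _ (fun r : R * R => (p.1 + r.2 * cos r.1, p.2 + r.2 * sin r.1))).
  by move=> r _; rewrite ray_coords.
have c1 : cwi setT (fun r : R * R => r.1) by exact: cwi_fst.
have c2 : cwi setT (fun r : R * R => r.2) by exact: cwi_snd.
have cc : cwi setT (fun r : R * R => cos r.1) by apply: (cwi_comp (continuous_cwi (A := setT) (@continuous_cos R))).
have cs : cwi setT (fun r : R * R => sin r.1) by apply: (cwi_comp (continuous_cwi (A := setT) (@continuous_sin R))).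
by apply: cwi_pair; apply: cwiD; (try exact: cwi_cst); exact: cwiM.
Qed.

(** Near [p] continuity gives [eps]; at distance at least [r] the crude bound [2 * M] is below the
    quadratic term. A bound of this form calls only for the second moment, and it is uniform in the
    angle. *)
Lemma ray_modulus (eps : R) : 0 < eps ->
  exists2 r, 0 < r & forall al x, `|T (ray al x) - T p| <= eps + 2 * M / r ^+ 2 * x ^+ 2.
Proof.
move=> eps0; have near_p : \forall q \near p, `|T p - T q| <= eps.
  by have /cvgrPdist_le := cT (x := p); apply.
have /nbhs_ballP[r /= r0 Hr] := near_p.
have M0 : 0 <= M := le_trans (normr_ge0 _) (TM p).
exists r => // al x; have [xr|xr] := ltP `|x| r.
  apply: (@le_trans _ _ eps); last by rewrite lerDl mulr_ge0 ?sqr_ge0// divr_ge0 ?sqr_ge0 ?mulr_ge0.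
  have shrink c : `|c| <= 1 -> `|x * c| < r.
    by move=> c1; rewrite normrM; apply: le_lt_trans xr; rewrite ler_piMr.
  have c1 : `|cos al| <= 1 by rewrite ler_norml cos_geN1 cos_le1.
  have s1 : `|sin al| <= 1 by rewrite ler_norml sin_geN1 sin_le1.
  rewrite distrC; apply: Hr; rewrite ray_coords; split; rewrite /ball/= opprD addNKr normrN; exact: shrink.
have rx : r ^+ 2 <= x ^+ 2 by rewrite -(real_normK (num_real x)) ler_pXn2r ?nnegrE// ltW.
apply: (@le_trans _ _ (2 * M)).
  by rewrite (le_trans (ler_normB _ _))// mulr_natl mulr2n lerD.
apply: (@le_trans _ _ (2 * M / r ^+ 2 * x ^+ 2)); last by rewrite lerDr ltW.
by rewrite mulrAC ler_pdivlMr ?exprn_gt0// ler_wpM2l// mulr_ge0.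
Qed.

Lemma kernel_scaleE (h : R) : 0 < h -> kernel_scale h = (4 * pi * Num.sqrt pi * Num.sqrt h)^-1.
Proof.
move=> h0; rewrite /kernel_scale; have -> : (3 / 2 : R) = 1 + 2^-1 by field.
rewrite powRD; last by rewrite pi_neq0 implybT.
by rewrite powRr1 ?pi_ge0// powR12_sqrt ?pi_ge0// mulrA.
Qed.

Lemma gaussian_mean_error (h eps r : R) : 0 < h -> 0 < r -> 0 <= eps ->
  (forall al x, `|T (ray al x) - T p| <= eps + 2 * M / r ^+ 2 * x ^+ 2) ->
  `|gaussian_mean h - gauss_mass h * T p| <= (eps + M * h / r ^+ 2) * gauss_mass h.
Proof.
move=> h0 r0 eps0 HT.
set E := fun x : R => expR (- (h^-1 * x ^+ 2)).
have cE (A : set R) : cwi A E by apply: continuous_cwi; exact: continuous_gauss.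
have cst (A : set R) (a : R) : cwi A (fun _ : R => a) by exact: cwi_cst.
have c2 (A : set R) : cwi A (fun x : R => x ^+ 2) by under eq_fun do rewrite expr2; apply: cwiM; exact: cwi_id.
have M0 : 0 <= M := le_trans (normr_ge0 _) (TM p).
have L1 : - L <= L by rewrite (@le_trans _ _ 0)// ?oppr_le0 ltW.
have pi1 : - pi <= pi :> R by rewrite (@le_trans _ _ 0)// ?oppr_le0 pi_ge0.
pose I := \int[mu]_(x in `[- L, L]) E x.
have massE : gauss_mass h = 2 * kernel_scale h * (2 * pi * I).
  rewrite /I gauss_scale ?(ltW L0)// kernel_scaleE// /gauss_mass.
  have sh : Num.sqrt h != 0 by rewrite lt0r_neq0 ?sqrtr_gt0.
  have sp : Num.sqrt (pi : R) != 0 by rewrite lt0r_neq0 ?sqrtr_gt0 ?pi_gt0.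
  move: pi_neq0 sh sp; move: (Num.sqrt h) (Num.sqrt pi) (gauss_partial _) => a b c.
  by move: (pi : R) => d d0 a0 b0; field; rewrite a0 b0 d0.
have cin : cwi setT (fun r : R * R => E r.2 * T (ray r.1 r.2)).
  apply: cwiM; last exact: ray_integrand_continuous.
  by apply: (cwi_comp (cE setT)) => //; exact: cwi_snd.
have cal : cwi `[- pi, pi]%classic (fun al => \int[mu]_(x in `[- L, L]) (E x * T (ray al x))).
  apply: (cwi_param (f := fun r : R * R => E r.2 * T (ray r.1 r.2))).
  exact: cwi_sub cin.
have crow al : cwi `[- L, L]%classic (fun x => E x * T (ray al x)).
  by apply: (cwi_comp cin (g := fun x => (al, x))) => //; apply: cwi_pair; [exact: cwi_cst|exact: cwi_id].
have -> : gaussian_mean h - gauss_mass h * T p = 2 * kernel_scale h *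
    \int[mu]_(al in `[- pi, pi]) (\int[mu]_(x in `[- L, L]) (E x * T (ray al x)) - I * T p).
  rewrite RintegralB//; last 2 first.
  - exact: cwi_itv_integrable.
  - exact: cwi_itv_integrable.
  rewrite (_ : \int[mu]_(x in `[- pi, pi]) (I * T p) = 2 * pi * I * T p).
    by rewrite massE mulrBr; congr (_ - _); rewrite -!mulrA.
  by rewrite Rintegral_cst//= fine_lebesgue_itv//; ring.
have K0 : 0 <= kernel_scale h.
  by rewrite kernel_scaleE// invr_ge0 !mulr_ge0 ?sqrtr_ge0 ?pi_ge0.
rewrite normrM ger0_norm ?mulr_ge0// massE.
have row al : `|\int[mu]_(x in `[- L, L]) (E x * T (ray al x)) - I * T p| <= (eps + M * h / r ^+ 2) * I.
  have -> : \int[mu]_(x in `[- L, L]) (E x * T (ray al x)) - I * T p =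
      \int[mu]_(x in `[- L, L]) (E x * T (ray al x) - E x * T p).
    rewrite RintegralB//; last 2 first.
    - exact: cwi_itv_integrable.
    - by apply: cwi_itv_integrable; exact: cwiM.
    by rewrite RintegralZr//; exact: cwi_itv_integrable.
  have cd : cwi `[- L, L]%classic (fun x => E x * T (ray al x) - E x * T p).
    by apply: cwiB => //; exact: cwiM.
  apply: (le_trans (le_normr_Rintegral _ (cwi_itv_integrable cd))) => //.
  apply: (@le_trans _ _ (\int[mu]_(x in `[- L, L]) (eps * E x + 2 * M / r ^+ 2 * (x ^+ 2 * E x)))).
    apply: le_Rintegral => //.
    - by have := integrable_norm (cwi_itv_integrable cd); apply: eq_integrable.
    - by apply: cwi_itv_integrable; apply: cwiD; apply: cwiM => //; exact: cwiM.
    move=> x _; rewrite -mulrBr normrM ger0_norm ?expR_ge0//.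
    have := ler_wpM2l (expR_ge0 (- (h^-1 * x ^+ 2))) (HT al x).
    by move/le_trans; apply; rewrite /E le_eqVlt; apply/orP; left; apply/eqP; ring.
  rewrite RintegralD//; last 2 first.
  - by apply: cwi_itv_integrable; exact: cwiM.
  - by apply: cwi_itv_integrable; apply: cwiM => //; exact: cwiM.
  rewrite !RintegralZl//; last 2 first.
  - by apply: cwi_itv_integrable; exact: cwiM.
  - exact: cwi_itv_integrable.
  rewrite [leRHS]mulrDl lerD2l.
  have -> : M * h / r ^+ 2 * I = 2 * M / r ^+ 2 * (h / 2 * I) by field; rewrite lt0r_neq0.
  apply: ler_wpM2l; first by rewrite divr_ge0 ?sqr_ge0 ?mulr_ge0.
  by apply: gauss_second_moment => //; exact: ltW.
have -> : (eps + M * h / r ^+ 2) * (2 * kernel_scale h * (2 * pi * I)) =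
    2 * kernel_scale h * ((eps + M * h / r ^+ 2) * I * (pi - - pi)) by ring.
apply: ler_wpM2l; first by rewrite mulr_ge0.
apply: Rintegral_itv_bound => //; first by apply: cwiB.
Qed.

Lemma gauss_mass_cvg : gauss_mass h @[h --> 0^'+] --> (1 : R).
Proof.
have sp : Num.sqrt (pi : R) != 0 by rewrite lt0r_neq0 ?sqrtr_gt0 ?pi_gt0.
rewrite -[X in _ --> X](mulfV sp); apply: cvgM; last exact: cvg_cst.
apply: (cvg_comp (fun h => L / Num.sqrt h) (@gauss_partial R)); last exact: gauss_partial_cvg.
apply/cvgryPge => A; near=> h.
have h0 : 0 < h by near: h; exact: nbhs_right_gt.
have s0 : 0 < Num.sqrt h by rewrite sqrtr_gt0.
rewrite ler_pdivlMr//.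
have A1 : 0 < `|A| + 1 by rewrite ltr_wpDl.
apply: (@le_trans _ _ ((`|A| + 1) * Num.sqrt h)).
  by apply: ler_wpM2r; [exact: ltW|rewrite (le_trans (ler_norm A))// lerDl].
rewrite mulrC -ler_pdivlMr// -[leRHS]ger0_norm ?divr_ge0 ?(ltW L0) ?(ltW A1)//.
rewrite -sqrtr_sqr ler_wsqrtr//; near: h; apply: nbhs_right_le.
by rewrite exprn_gt0// divr_gt0.
Unshelve. all: by end_near.
Qed.

Lemma gaussian_mean_cvg : gaussian_mean h @[h --> 0^'+] --> T p.
Proof.
apply/cvgrPdist_le => eps eps0.
have M0 : 0 <= M := le_trans (normr_ge0 _) (TM p).
(* Two errors of [eps / 8], times a mass of at most 2, make [eps / 2]. *)
have [r r0 Hr] := ray_modulus (divr_gt0 eps0 (ltr0Sn R 7)).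
have d0 : 0 < eps / 2 / (`|T p| + 1) by rewrite !divr_gt0// ltr_wpDl.
have near1 := (cvgrPdist_le _ _).1 gauss_mass_cvg _ d0.
have near2 := (cvgrPdist_le _ _).1 gauss_mass_cvg _ (ltr01).
have B0 : 0 <= M / r ^+ 2 by rewrite divr_ge0// sqr_ge0.
near=> h.
have h0 : 0 < h by near: h; exact: nbhs_right_gt.
have h1 : `|1 - gauss_mass h| <= eps / 2 / (`|T p| + 1) by near: h; exact: near1.
have h2 : `|1 - gauss_mass h| <= 1 by near: h; exact: near2.
have h3 : h <= eps / 8 / (M / r ^+ 2 + 1).
  by near: h; apply: nbhs_right_le; rewrite !divr_gt0// ltr_wpDl.
have h4 : M * h / r ^+ 2 <= eps / 8.
  move: h3; rewrite ler_pdivlMr ?ltr_wpDl//.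
  have -> : M * h / r ^+ 2 = h * (M / r ^+ 2) by rewrite mulrAC mulrC.
  by rewrite mulrDr mulr1; lra.
have h5 : gauss_mass h <= 2 by move: h2; rewrite ler_norml; lra.
have e8 : 0 <= eps / 8 by rewrite divr_ge0 ?(ltW eps0).
have Eh := gaussian_mean_error h0 r0 e8 Hr.
have h6 : `|gaussian_mean h - gauss_mass h * T p| <= eps / 2.
  apply: (le_trans Eh); apply: (@le_trans _ _ ((eps / 8 + M * h / r ^+ 2) * 2)); last lra.
  by apply: ler_wpM2l h5; rewrite addr_ge0// divr_ge0 ?sqr_ge0// mulr_ge0// ltW.
have h7 : `|(1 - gauss_mass h) * T p| <= eps / 2.
  rewrite normrM; move: h1; rewrite ler_pdivlMr ?ltr_wpDl// => h1.
  apply: le_trans h1; apply: ler_wpM2l => //; by rewrite lerDl.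
have -> : T p - gaussian_mean h = (1 - gauss_mass h) * T p - (gaussian_mean h - gauss_mass h * T p) by ring.
by rewrite (le_trans (ler_normB _ _))//; lra.
Unshelve. all: by end_near.
Qed.

End GaussianMean.

(** * The representation formula *)

Section WaveSolution.
Context {R : realType}.
Local Notation mu := (@lebesgue_measure R).

(** One square serves all angles, so that the lines can be cut at a common length [L] before the
    angular average. *)
Lemma moved_in_square (Omega : set (R * R)) (p : R * R) : compact (closure Omega) ->
  exists2 L, 0 < L & forall al, moved Omega p al `<=` square L.
Proof.
move=> /compact_in_square[L L0 HL]; pose B := (L + `|p.1|) + (L + `|p.2|) + 1.
exists B => [|al z Oz]; first by rewrite ltr_wpDl// !addr_ge0.
have [h1 h2] := HL _ (subset_closure (Oz : Omega (rigid_motion p al z))); set q := rigid_motion p al z in h1 h2.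
have q1 : `|(q - p).1| <= L + `|p.1| by apply: le_trans (ler_normB _ _) _; rewrite lerD2r.
have q2 : `|(q - p).2| <= L + `|p.2| by apply: le_trans (ler_normB _ _) _; rewrite lerD2r.
have c1 : `|cos al| <= 1 by rewrite ler_norml cos_geN1 cos_le1.
have s1 : `|sin al| <= 1 by rewrite ler_norml sin_geN1 sin_le1.
have mulB a b c : `|a| <= b -> `|c| <= 1 -> `|a * c| <= b :> R.
  by move=> ab c1'; rewrite normrM; apply: le_trans ab; rewrite ler_piMr.
rewrite -(rigidK p al z) -/q /frame /rotate_axes; split=> /=.
  apply: le_trans (ler_normD _ _) _; apply: (@le_trans _ _ ((L + `|p.1|) + (L + `|p.2|))); last by rewrite lerDl.
  by apply: lerD; exact: mulB.
apply: le_trans (ler_normD _ _) _; apply: (@le_trans _ _ ((L + `|p.1|) + (L + `|p.2|))); last by rewrite lerDl.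
by apply: lerD; apply: mulB => //; rewrite normrN.
Qed.

Lemma wave_C1c (Omega : set (R * R)) (u : R * R * R -> R) : open Omega ->
  Ck_closure 2 (Omega `*` setT) u -> wave_equation Omega u ->
  exists ux uy ut uxx uxy uxt uyx uyy uyt utx uty utt,
  [/\ C1c (cylinder Omega) u ux uy ut, C1c (cylinder Omega) ux uxx uxy uxt,
      C1c (cylinder Omega) uy uyx uyy uyt, C1c (cylinder Omega) ut utx uty utt &
      forall z, cylinder Omega z -> utt z = uxx z + uyy z].
Proof.
move=> oO hu hw; have [ux [uy [ut [Cu kx ky kt]]]] := Ck_closure2 hu.
have [uxx [uxy [uxt Cx]]] := Ck_closure1 kx; have [uyx [uyy [uyt Cy]]] := Ck_closure1 ky.
have [utx [uty [utt Ct]]] := Ck_closure1 kt.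
exists ux, uy, ut, uxx, uxy, uxt, uyx, uyy, uyt, utx, uty, utt; split => // z Qz.
have [_ _ _ _ pu] := Cu; have [_ _ _ _ px] := Cx; have [_ _ _ _ py] := Cy; have [_ _ _ _ pt] := Ct.
have second e (v vv : R * R * R -> R) : (forall z, cylinder Omega z -> is_derive z e u (v z)) ->
    is_derive z e v (vv z) -> 'D_e ('D_e u) z = vv z.
  move=> d1 d2; apply: (derive_val (is_derive := _)).
  apply: is_derive_locally d2; have oQ := open_cylinder oO.
  have nQ : nbhs z (cylinder Omega) by exact: open_nbhs_nbhs.
  by apply: filterS nQ => y Qy; rewrite (derive_val (is_derive := d1 y Qy)).
have Ex := second dir_x ux uxx (fun z Qz => let: And3 h _ _ := pu z Qz in h) (let: And3 h _ _ := px z Qz in h).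
have Ey := second dir_y uy uyy (fun z Qz => let: And3 _ h _ := pu z Qz in h) (let: And3 _ h _ := py z Qz in h).
have Et := second dir_t ut utt (fun z Qz => let: And3 _ _ h := pu z Qz in h) (let: And3 _ _ h := pt z Qz in h).
rewrite -[utt z]Et -[uxx z]Ex -[uyy z]Ey; apply: subr0_eq; exact: hw Qz.
Qed.

End WaveSolution.

Theorem theorem1 (R : realType) (Omega : set (R * R)) (u : R * R * R -> R)
    (hOmega : bounded_domain Omega) (hsmooth : smooth_boundary Omega)
    (hu : Ck_closure 2 (Omega `*` setT) u)
    (hwave : wave_equation Omega u) (hdir : dirichlet Omega u)
    (p : R * R) (hp : Omega p) (t : R) :
  \int[arc_length (boundary Omega)]_(q in boundary Omega)
     \int[lebesgue_measure]_(s in `[t - enorm (q - p), t + enorm (q - p)])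
       (V_h h (q.1 - p.1) (q.2 - p.2) (s - t) * normal_derivative Omega u q s)
    @[h --> 0^'+] --> u (p, t).
Proof.
have [oO _ neO bO] := hOmega; have kO := compact_closure_bounded bO.
have [ux [uy [ut [uxx [uxy [uxt [uyx [uyy [uyt [utx [uty [utt [Cu Cx Cy Ct wave]]]]]]]]]]]]] := wave_C1c oO hu hwave.
have [L L0 HL] := moved_in_square p kO.
(* The Dirichlet condition makes the extension by zero continuous, so the Gaussian means may run
   over segments that leave [Omega]. *)
pose T := (fun q => u (q, t)) \_ Omega.
have cut : cwi (closure Omega) (fun q => u (q, t)).
  have [cu _ _ _ _] := Cu; rewrite closure_cylinder in cu.
  by apply: (cwi_comp cu (g := fun q => (q, t))) => //; apply: cwi_pair; [exact: cwi_id|exact: cwi_cst].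
have cT : continuous T by apply: zero_extension_continuous => // z bz; exact: hdir.
have [M M0 HM] := cwi_bounded kO cut.
have TM z : `|T z| <= M.
  by rewrite /T patchE; case: ifPn => [|_]; rewrite ?normr0// inE => Oz; apply: HM; exact: subset_closure.
have -> : u (p, t) = T p by rewrite /T patchE mem_set.
have H := @gaussian_mean_cvg R T cT M TM p L L0.
(* The boundary integral equals the Gaussian mean exactly, for each [h]; only the mean is taken to
   the limit. *)
apply: cvg_trans H; apply: near_eq_cvg; apply: nearW => h.
set bd := boundary Omega; set K := kernel_scale h.
have cang : cwi (setT `*` bd) (fun r : R * (R * R) => angular Omega ux uy h^-1 p t r.1 r.2).
  apply: cwiM; last exact: cone_mean_continuous oO hsmooth _ _ _ _ Cu _ _ _.
  have c2 : cwi (setT `*` bd) (fun r : R * (R * R) => (frame p r.1 r.2).2).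
    have c1 : cwi (setT `*` bd) (fun r : R * (R * R) => r.1) by exact: cwi_fst.
    have cq : cwi (setT `*` bd) (fun r : R * (R * R) => r.2) by exact: cwi_snd.
    have cq1 : cwi (setT `*` bd) (fun r : R * (R * R) => r.2.1) by apply: (cwi_comp (@cwi_fst _ _ setT) cq).
    have cq2 : cwi (setT `*` bd) (fun r : R * (R * R) => r.2.2) by apply: (cwi_comp (@cwi_snd _ _ setT) cq).
    apply: cwiD; apply: cwiM.
    - by apply: cwiN; apply: cwiB => //; exact: cwi_cst.
    - by apply: (cwi_comp (continuous_cwi (A := setT) (@continuous_sin R))).
    - by apply: cwiB => //; exact: cwi_cst.
    - by apply: (cwi_comp (continuous_cwi (A := setT) (@continuous_cos R))).
  have := cwi_comp (continuous_cwi (A := setT) (@maxr0_continuous R)) c2 (fun _ _ => I).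
  by apply: cwi_eq => r _; rewrite maxC.
transitivity (- (K / (2 * pi)) * \int[arc_length bd]_(q in bd) \int[lebesgue_measure]_(al in `[- pi, pi]) angular Omega ux uy h^-1 p t al q); last first.
  rewrite -RintegralZl//; last 2 first.
  - by apply: compact_plane_measurable; exact: compact_boundary.
  - apply: boundary_integrable => //; apply: (cwi_param (f := fun r : R * R * R => angular Omega ux uy h^-1 p t r.2 r.1)).
    apply: (cwi_comp cang (g := fun r => (r.2, r.1))); last by move=> [q al] [].
    by apply: cwi_pair; [exact: cwi_snd|exact: cwi_fst].
  by apply: eq_Rintegral => q; rewrite inE => bq; rewrite (kernel_slope_integral oO hsmooth Cu p t h bq).
rewrite (boundary_Fubini oO kO hsmooth neO (- pi) pi cang) /=.
have cray := @ray_integrand_continuous R T cT p.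
have cE (A : set R) : cwi A (fun x : R => expR (- (h^-1 * x ^+ 2))) by apply: continuous_cwi; exact: continuous_gauss.
have cin : cwi setT (fun r : R * R => expR (- (h^-1 * r.2 ^+ 2)) * T (ray p r.1 r.2)).
  by apply: cwiM => //; apply: (cwi_comp (cE setT)) => //; exact: cwi_snd.
have angle al : \int[arc_length bd]_(q in bd) angular Omega ux uy h^-1 p t al q =
    - (4 * pi) * \int[lebesgue_measure]_(x in `[- L, L]) (expR (- (h^-1 * x ^+ 2)) * T (ray p al x)).
  rewrite (cone_identity oO kO hsmooth neO Cu Cx Cy Ct wave hdir h^-1 t L0 (HL al)) mulNr -RintegralZl//.
    by congr (- _); apply: eq_Rintegral => x _; rewrite /trace_weight /ray /T; ring.
  apply: cwi_itv_integrable; apply: (cwi_comp cin (g := fun x => (al, x))) => //.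
  by apply: cwi_pair; [exact: cwi_cst|exact: cwi_id].
have -> : \int[lebesgue_measure]_(al in `[- pi, pi]) \int[arc_length bd]_(q in bd) angular Omega ux uy h^-1 p t al q =
    - (4 * pi) * \int[lebesgue_measure]_(al in `[- pi, pi]) \int[lebesgue_measure]_(x in `[- L, L])
      (expR (- (h^-1 * x ^+ 2)) * T (ray p al x)).
  rewrite -RintegralZl//; first by apply: eq_Rintegral => al _; exact: angle.
  apply: cwi_itv_integrable.
  apply: (cwi_param (f := fun r : R * R => expR (- (h^-1 * r.2 ^+ 2)) * T (ray p r.1 r.2))).
  exact: cwi_sub cin.
(* The factor [- K / (2 pi)] of the angular average and [- 4 pi] of the identity for one angle
   multiply to [2 K]. *)
rewrite /gaussian_mean -/K; move: (\int[_]_(_ in _) _) => X.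
have halve (c d : R) : c != 0 -> - (d / (2 * c)) * (- (4 * c) * X) = 2 * d * X by move=> c0; field.
by rewrite halve// pi_neq0.
Qed.
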